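(* Let $G$ be a finite simple bipartite graph. Then the following conditions are equivalent: (i) $\omega(I_{\mathcal{M}_G})=2$; (ii) $G$ has no odd subdivision of $K_{2,3}$ as a subgraph; (iii) each block of $G$ is a bipartite graph having no odd subdivision of $K_{2,3}$ as a subgraph. Otherwise (i.e. if these conditions fail), one has $\omega(I_{\mathcal{M}_G})=3$.
   Context: Let $G$ have edge set $E(G)=\{e_1,\dots,e_n\}$. A matching of $G$ is a (possibly empty) set of pairwise non-adjacent edges. For $M\subset E(G)$ put $\rho(M)=\sum_{e_j\in M}\mathbf{e}_j\in\mathbb{R}^n$. The matching polytope is $\mathcal{M}_G=\mathrm{conv}\{\rho(M): M \text{ a matching of } G\}\subset\mathbb{R}^n$. Toric ideal: for a lattice polytope $\mathcal{P}\subset\mathbb{R}^n_{\ge0}$ with $\mathcal{P}\cap\mathbb{Z}^n=\{\mathbf{a}_1,\dots,\mathbf{a}_N\}$ and a field $\mathbb{K}$, $I_{\mathcal{P}}$ is the kernel of the $\mathbb{K}$-algebra map $\mathbb{K}[x_1,\dots,x_N]\to\mathbb{K}[t_1,\dots,t_n,s]$, $x_i\mapsto \mathbf{t}^{\mathbf{a}_i}s$, with $\deg x_i=1$. For a homogeneous ideal $I$, $\omega(I)$ is the maximal degree of minimal generators of $I$; by convention $\omega(\{0\})=2$ (so $\omega(I_{\mathcal P})\ge 2$ always). An odd subdivision of a graph $H$ is a graph obtained from $H$ by replacing each edge by a path of odd length (with new internal vertices); $H$ itself is an odd subdivision of $H$. A cut vertex of a connected graph is a vertex whose removal disconnects it;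 a block of $G$ is a maximal connected subgraph of $G$ with no cut vertices (of its own). Subgraphs are not required to be induced. *)

(* Defs.v *)
From mathcomp Require Import all_boot all_order all_algebra.
From mathcomp Require Import reals.
From mathcomp Require Import mpoly.

Set Implicit Arguments.
Unset Strict Implicit.
Unset Printing Implicit Defensive.

Import GRing.Theory Num.Theory.
Local Open Scope ring_scope.

(* A finite simple graph is given with an explicit vertex set inside an ambient
   finite type, so that G and its subgraphs are objects of the same type. *)
Record graph (T : finType) := Graph {
  verts : {set T};
  edges : {set {set T}};
  edges_wf : [forall f in edges, (f \subset verts) && (#|f| == 2)%N] }.

Section Graphs.
Variable T : finType.
Implicit Types (G H B : graph T) (v : T).

Definition subgraph H G : Prop :=
  verts H \subset verts G /\ edges H \subset edges G.

Definition adj G : rel T := [rel x y | [set x; y] \in edges G].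

Definition bipartite G : Prop :=
  exists A : {set T}, forall x y, adj G x y -> (x \in A) != (y \in A).

Definition disconnected G : Prop :=
  exists x y, [/\ x \in verts G, y \in verts G & ~~ connect (adj G) x y].

(* The empty graph is not connected; an isolated vertex is. *)
Definition connected G : Prop := verts G != set0 /\ ~ disconnected G.

Fact del_vertex_wf G v :
  [forall f in [set f in edges G | v \notin f],
     (f \subset verts G :\ v) && (#|f| == 2)%N].
Proof.
apply/forall_inP => f; rewrite inE => /andP[fG vf].
by have /andP[fV ->] := forall_inP (edges_wf G) f fG; rewrite subsetD1 fV vf.
Qed.

Definition del_vertex G v : graph T := Graph (del_vertex_wf G v).

Definition cut_vertex G v : Prop :=
  v \in verts G /\ disconnected (del_vertex G v).

Definition nonseparable G : Prop :=
  connected G /\ forall v, ~ cut_vertex G v.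

Definition block B G : Prop :=
  [/\ subgraph B G, nonseparable B &
      forall H, subgraph H G -> nonseparable H -> subgraph B H ->
        subgraph H B].

Definition matching G (M : {set {set T}}) : bool :=
  (M \subset edges G) && trivIset M.

End Graphs.

Fact complete_bipartite_wf (m n : nat) :
  [forall f in [set [set inl i; inr j] | i : 'I_m, j : 'I_n],
     (f \subset [set: 'I_m + 'I_n]) && (#|f| == 2)%N].
Proof.
by apply/forall_inP => _ /imset2P[i j _ _ ->]; rewrite subsetT cards2.
Qed.

Definition complete_bipartite (m n : nat) : graph ('I_m + 'I_n)%type :=
  Graph (complete_bipartite_wf m n).

Section OddSubdivision.
Variables (S T : finType).

(* The edges of the path x :: s. *)
Definition path_edges (x : T) (s : seq T) : {set {set T}} :=
  [set:: pairmap (fun y z => [set y; z]) x s].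

(* H' is obtained from H by replacing each edge uv with the path
   phi u, p u v, phi v, where p u v lists the new internal vertices in order
   from u to v; this path has size (p u v) + 1 edges. *)
Record odd_subdivision_by (H : graph S) (H' : graph T)
    (phi : S -> T) (p : S -> S -> seq T) : Prop := {
  osub_inj : {in verts H &, injective phi};
  osub_rev : forall u v, adj H u v -> p v u = rev (p u v);
  osub_uniq : forall u v, adj H u v -> uniq (p u v);
  osub_odd : forall u v, adj H u v -> odd (size (p u v)).+1;
  osub_new : forall u v, adj H u v -> [disjoint p u v & phi @: verts H];
  osub_disjoint : forall u v u' v', adj H u v -> adj H u' v' ->
    [set u; v] != [set u'; v'] -> [disjoint p u v & p u' v'];
  osub_verts : verts H' =
    phi @: verts H :|: \bigcup_(e : S * S | adj H e.1 e.2) [set:: p e.1 e.2];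
  osub_edges : edges H' =
    \bigcup_(e : S * S | adj H e.1 e.2)
       path_edges (phi e.1) (rcons (p e.1 e.2) (phi e.2)) }.

Definition odd_subdivision (H : graph S) (H' : graph T) : Prop :=
  exists phi p, odd_subdivision_by H H' phi p.

Definition has_odd_subdivision (H : graph S) (G : graph T) : Prop :=
  exists H' : graph T, subgraph H' G /\ odd_subdivision H H'.

End OddSubdivision.

Section MatchingPolytope.
Variables (R : realType) (T : finType) (G : graph T).

(* The edges e_1, ..., e_n are listed by enum_val, with n = #|edges G|. *)
Definition rho (M : {set {set T}}) : 'rV[R]_#|edges G| :=
  \sum_(j < #|edges G| | enum_val j \in M) delta_mx 0 j.

Definition matching_polytope (x : 'rV[R]_#|edges G|) : Prop :=
  exists c : {set {set T}} -> R,
    [/\ forall M, matching G M -> 0 <= c M,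
        \sum_(M | matching G M) c M = 1 &
        x = \sum_(M | matching G M) c M *: rho M].

End MatchingPolytope.

Arguments rho R {T} G M.
Arguments matching_polytope R {T} G x.

(* a_1, ..., a_N are the lattice points of P, without repetition. They are
   recorded as exponent vectors, since P lies in the nonnegative orthant. *)
Definition lattice_points (R : realType) (n N : nat)
    (P : 'rV[R]_n -> Prop) (a : 'I_N -> 'X_{1..n}) : Prop :=
  injective a /\
  forall z : 'rV[int]_n,
    P (map_mx intr z) <-> exists i, z = \row_j ((a i j)%:Z).

Section ToricIdeal.
Variables (K : fieldType) (n N : nat) (a : 'I_N -> 'X_{1..n}).

(* In K[t_1, ..., t_n, s], s is the last variable. *)
Definition toric_map : {mpoly K[N]} -> {mpoly K[n.+1]} :=
  mmap (@mpolyC n.+1 K) (fun i => mwiden 'X_[a i] * 'X_ord_max).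

Definition toric_ideal (f : {mpoly K[N]}) : Prop := toric_map f = 0.

End ToricIdeal.

Arguments toric_map K {n N} a.
Arguments toric_ideal K {n N} a f.

Section Omega.
Variables (K : fieldType) (N : nat).
Implicit Types (I : {mpoly K[N]} -> Prop) (s : seq {mpoly K[N]}).

Definition generates s I : Prop :=
  forall f, I f <->
    exists c : 'I_(size s) -> {mpoly K[N]}, f = \sum_(i < size s) c i * s`_i.

Definition minimal_generating_system s I : Prop :=
  [/\ {in s, forall g, g \is homog mdeg}, generates s I &
      {in s, forall g, ~ generates (rem g s) I}].

Definition minimal_generator I (g : {mpoly K[N]}) : Prop :=
  exists s, minimal_generating_system s I /\ g \in s.

(* omega I d reads "omega(I) = d"; the degree of g <> 0 is (msize g).-1. *)
Definition omega I (d : nat) : Prop :=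
  ((forall f, I f <-> f = 0) /\ d = 2%N) \/
  (~ (forall f, I f <-> f = 0) /\
   (exists g, minimal_generator I g /\ (msize g).-1 = d) /\
   (forall g, minimal_generator I g -> ((msize g).-1 <= d)%N)).

End Omega.

(* Main.v *)
Require Import Defs.
From mathcomp Require Import reals boolp mpoly.
From mathcomp Require Import all_boot all_order all_fingroup all_algebra.
From mathcomp Require Import path zify.

Set Implicit Arguments.
Unset Strict Implicit.
Unset Printing Implicit Defensive.

(* The monomials of degree k of the toric ring are the sums of k matchings, and
   the binomials of the toric ideal are the pairs of families of k matchings
   with the same sum, that is, pairs of k-edge-colourings of the same bipartite
   multigraph. So the ideal is generated in degree d as soon as any two
   colourings are linked by recolourings of at most d colour classes at a time.

   Degree 3 always suffices. A matching is an involution, hence a permutation,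
   of the vertex set, and families of permutations are linked by a walk in the
   style of Jacobson and Matthews: class 1 is driven towards a target class one
   edge at a time through near-colourings with a defect in two colours.
   Consecutive near-colourings have proper resolutions that differ in three
   colours only.

   An odd subdivision of K_{2,3} is a theta: two vertices on the same side of
   the bipartition joined by three internally disjoint paths. A theta carries
   two families of three matchings with the same sum, no two matchings of which
   can be exchanged, so that the corresponding cubic is a minimal generator.

   Without a theta, three colours can be handled by Kempe changes. By induction
   on the number of edges: an edge whose ends have degrees summing up to at most
   four can be removed, and the ends of a double edge can be removed or
   contracted. A simple subcubic bipartite graph of minimum degree two in which
   the vertices of degree two are independent contains a theta. To see this,
   take a cycle C and a component O of its complement. If O had two attachments
   on the same side there would be a theta, so it has at most one on each side.
   Removing O and one attachment then leaves a graph dense enough to contain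
   another cycle, whose complement has a larger component. *)

(** * Exchanges in families of permutations *)

(** The walk through permutations leaves the involutions, but this does no harm: a permutation is
    read back as a matching from its values on the side [A] alone, and injectivity together with
    support there already makes these edges disjoint. This reading rests on bipartiteness. The
    result in degree 3 also feeds the quadratic case, where each move on three matchings is a pair
    of 3-edge-colourings of a subcubic multigraph, so that Kempe changes have to be studied for
    three colours only. A missing colour is encoded as a fixed point throughout; hence equal sums
    also record equal numbers of absent colours, and the diagonal multiplicity at a vertex is three
    minus its degree. On the algebraic side, fibres in degree at most one are singletons, so [omega]
    lies between 2 and 3 and only the value 2 has to be decided. A theta excludes it by a cubic
    monomial all of whose proper divisors are alone in their fibres. *)

Section Linked.
Variables (X : eqType) (E : Type) (w : X -> E -> nat) (V : pred X) (d : nat).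

(* With w the incidence vectors of matchings, these are the exchanges performed
   by binomials of degree at most d in the toric ideal. *)
Inductive linked : seq X -> seq X -> Prop :=
| linked_perm s t of perm_eq s t : linked s t
| linked_move x y r of size x <= d & size y = size x
    & (forall e, \sum_(i <- x) w i e = \sum_(i <- y) w i e) & all V y :
    linked (x ++ r) (y ++ r)
| linked_trans s t u of linked s t & linked t u : linked s u.

Lemma linked_cons z s t : linked s t -> linked (z :: s) (z :: t).
Proof.
elim=> {s t} [s t st|x y r sx sy wxy Vy|s t u _ IH1 _ IH2].
- by apply: linked_perm; rewrite perm_cons.
- apply: (@linked_trans _ (x ++ (z :: r))).
    by apply: linked_perm; rewrite -cat1s catA -[z :: r]cat1s catA perm_cat2r perm_catC.
  apply: (@linked_trans _ (y ++ (z :: r))); first exact: linked_move.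
  by apply: linked_perm; rewrite -[z :: (_ ++ _)]cat1s catA -[z :: r]cat1s catA perm_cat2r perm_catC.
- exact: linked_trans IH1 IH2.
Qed.

Lemma linked_catr r s t : linked s t -> linked (s ++ r) (t ++ r).
Proof.
move=> st; apply: (@linked_trans _ (r ++ s)); first by apply: linked_perm; rewrite perm_catC.
apply: (@linked_trans _ (r ++ t)); last by apply: linked_perm; rewrite perm_catC.
by elim: r => //= z r IH; apply: linked_cons.
Qed.

(** The terms outside [D] coincide and cancel from the sums, so the members indexed by [D] form a
    single move. *)
Lemma linked_codom (I : finType) (f g : I -> X) (D : {set I}) :
  #|D| <= d -> (forall i, i \notin D -> f i = g i) ->
  (forall e, \sum_i w (f i) e = \sum_i w (g i) e) -> (forall i, V (g i)) ->
  linked (codom f) (codom g).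
Proof.
move=> Dd fg wfg Vg.
have split (h : I -> X) : perm_eq (codom h) (map h (enum D) ++ map h (enum (~: D))).
  rewrite codomE -map_cat; apply: perm_map.
  apply: uniq_perm; first exact: enum_uniq.
    rewrite cat_uniq !enum_uniq andbT /=; apply/hasPn => i.
    by rewrite !mem_enum inE.
  by move=> i; rewrite mem_cat !mem_enum !inE; case: (i \in D).
apply: (linked_trans (linked_perm (split f))).
apply: (@linked_trans _ (map g (enum D) ++ map g (enum (~: D)))); last first.
  by apply: linked_perm; rewrite perm_sym; exact: split.
have -> : map f (enum (~: D)) = map g (enum (~: D)).
  by apply/eq_in_map => i; rewrite mem_enum inE; apply: fg.
apply: linked_move; rewrite ?size_map -?cardE //; last first.
  by apply/allP => _ /mapP [i _ ->].
move=> e; rewrite !big_map !big_enum /=.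
move: (wfg e); rewrite [LHS](bigID (mem D)) [RHS](bigID (mem D)) /=.
have -> : \sum_(i | i \notin D) w (f i) e = \sum_(i | i \notin D) w (g i) e.
  by apply: eq_bigr => i /fg ->.
by move/addIn.
Qed.

End Linked.

(** * Exchanging two maps along a trail of values *)

Section Trail.
Variables (T U : finType).
Implicit Types (f g : T -> U).

Definition cnt f (t : U) : nat := \sum_x (f x == t).

Lemma cnt_split f g (Z : {set T}) t :
  cnt (fun x => if x \in Z then g x else f x) t +
  cnt (fun x => if x \in Z then f x else g x) t = cnt f t + cnt g t.
Proof. by rewrite /cnt -!big_split; apply: eq_bigr => x _ /=; case: ifP; rewrite // addnC. Qed.

(* Sum over U of the counts is #|T|; a set closed under f x |-> g x receives
   at least as many values of g as of f. *)
Lemma trail f g y : cnt g y < cnt f y ->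
  exists (Z : {set T}) y', [/\ cnt f y' < cnt g y',
    forall t, cnt (fun x => if x \in Z then g x else f x) t + (t == y) = cnt f t + (t == y') &
    forall t, cnt (fun x => if x \in Z then f x else g x) t + (t == y') = cnt g t + (t == y)].
Proof.
move=> ltgf.
pose e : rel U := [rel u v | [exists x, (f x == u) && (g x == v)]].
have [y' cyy' lty'] : exists2 y', connect e y y' & cnt f y' < cnt g y'.
  apply/exists_inP; apply: contraT => /exists_inPn noy.
  have sumcnt h : \sum_(u | connect e y u) cnt h u = \sum_x (connect e y (h x) : nat).
    rewrite exchange_big /=; apply: eq_bigr => x _.
    rewrite big_mkcond (bigD1 (h x)) //= eqxx big1 ?addn0; first by case: connect.
    by move=> u; rewrite eq_sym => /negPf ->; case: ifP.
  have : \sum_(u | connect e y u) cnt g u < \sum_(u | connect e y u) cnt f u.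
    rewrite (bigD1 y) ?connect0 //= [ltnRHS](bigD1 y) ?connect0 //=.
    rewrite -addSn leq_add //; apply: leq_sum => u /andP[cu _].
    by rewrite leqNgt noy.
  rewrite !sumcnt ltnNge; case/negP; apply: leq_sum => x _.
  case: (boolP (connect e y (f x))) => // cf; rewrite (connect_trans cf) //.
  by apply: connect1; apply/existsP; exists x; rewrite !eqxx.
suff [Z HZ] : exists Z : {set T},
    forall t, cnt (fun x => if x \in Z then g x else f x) t + (t == y) = cnt f t + (t == y').
  exists Z, y'; split=> // t; move: (cnt_split f g Z t) (HZ t); lia.
move: cyy' => /connectP [q eq ->]; case/shortenP: eq => {}q eq uq _ {ltgf lty' y'}.
(* The invariant that [f] maps [Z] into the path before its end keeps each newly chosen point out of
   [Z], because the path is simple. *)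
suff [Z _ HZ] : exists2 Z : {set T}, (forall x, x \in Z -> f x \in belast y q) &
    forall t, cnt (fun x => if x \in Z then g x else f x) t + (t == y) = cnt f t + (t == last y q).
  by exists Z.
elim: q y eq uq => [|z q IH] y /=.
  by move=> _ _; exists set0 => [x|t]; rewrite ?inE //; congr (_ + _); apply: eq_bigr => x _; rewrite inE.
case/andP=> /existsP [x0 /andP[/eqP fx0 /eqP gx0]] eq /andP[yq uq].
have [Z Zq HZ] := IH _ eq uq.
have x0Z : x0 \notin Z.
  by apply: contra yq => /Zq; rewrite fx0; apply: mem_belast.
exists (x0 |: Z) => [x|t].
  by rewrite !inE => /orP[/eqP ->|/Zq ->]; rewrite ?fx0 ?eqxx ?orbT.
have := HZ t; rewrite /cnt (bigD1 x0) //= (negPf x0Z) fx0.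
rewrite [X in X + (t == y)](bigD1 x0) //= setU11 gx0.
rewrite [in X in _ -> _ + X + _ = _](eq_bigr (fun x => (if x \in Z then g x else f x) == t : nat)); last first.
  by move=> x /negPf nx; rewrite !inE nx.
rewrite [y == t]eq_sym [z == t]eq_sym; lia.
Qed.

End Trail.

(** * Driving one of several permutations to a target *)

Section Birkhoff.
Variables (T : finType) (I : finType) (i0 : I) (F : {perm T}).
Implicit Types (f g : I -> T -> T) (r : I -> {perm T}).

Definition same_sum f g := forall x u, \sum_i (f i x == u) = \sum_i (g i x == u).

Definition swap (p q : I) (Z : {set T}) f : I -> T -> T :=
  fun i x => f (if x \in Z then tperm p q i else i) x.

Lemma same_sum_swap p q Z f : same_sum (swap p q Z f) f.
Proof.
move=> x u; rewrite /swap; case: (x \in Z) => //.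
by rewrite [RHS](reindex_inj (@perm_inj _ (tperm p q))).
Qed.

Lemma same_sum_trans f g h : same_sum f g -> same_sum g h -> same_sum f h.
Proof. by move=> fg gh x u; rewrite fg. Qed.

Lemma swap1 p q x f : p != q ->
  [/\ forall t, cnt (swap p q [set x] f p) t + (f p x == t) = cnt (f p) t + (f q x == t),
      forall t, cnt (swap p q [set x] f q) t + (f q x == t) = cnt (f q) t + (f p x == t)
    & forall i, i != p -> i != q -> swap p q [set x] f i =1 f i].
Proof.
move=> pq; split=> [t|t|i ip iq y]; rewrite /swap /cnt; last first.
- by rewrite tpermD 1?eq_sym //; case: ifP.
- rewrite (bigD1 x) //= [in RHS](bigD1 x) //= inE eqxx tpermR.
  rewrite (eq_bigr (fun y => f q y == t : nat)); first lia.
  by move=> y /negPf; rewrite inE => ->.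
- rewrite (bigD1 x) //= [in RHS](bigD1 x) //= inE eqxx tpermL.
  rewrite (eq_bigr (fun y => f p y == t : nat)); first lia.
  by move=> y /negPf; rewrite inE => ->.
Qed.

Lemma swap_trail p q y f : p != q -> cnt (f q) y < cnt (f p) y ->
  exists Z y', [/\ cnt (f p) y' < cnt (f q) y',
    forall t, cnt (swap p q Z f p) t + (t == y) = cnt (f p) t + (t == y'),
    forall t, cnt (swap p q Z f q) t + (t == y') = cnt (f q) t + (t == y)
    & forall i, i != p -> i != q -> swap p q Z f i =1 f i].
Proof.
move=> pq /trail [Z [y' [lt Hp Hq]]]; exists Z, y'; split=> // [t|t|i ip iq x].
- rewrite -Hp; congr (_ + _); apply: eq_bigr => x _; rewrite /swap.
  by rewrite tpermL; case: ifP.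
- rewrite -Hq; congr (_ + _); apply: eq_bigr => x _; rewrite /swap.
  by rewrite tpermR; case: ifP.
- by rewrite /swap tpermD 1?eq_sym //; case: ifP.
Qed.

Lemma cnt1_inj (h : T -> T) : (forall t, cnt h t = 1) -> injective h.
Proof.
move=> h1 x y hxy; apply/eqP; case: eqVneq => // nxy.
have := h1 (h x); rewrite /cnt (bigD1 x) //= (bigD1 y) 1?eq_sym //= -hxy eqxx; lia.
Qed.

Lemma cnt_perm (s : {perm T}) t : cnt s t = 1.
Proof.
rewrite /cnt (bigD1 ((s^-1)%g t)) //= permKV eqxx big1 // => x nx.
by apply/eqP; rewrite eqb0; apply: contra nx => /eqP <-; rewrite permK.
Qed.

(* A near-colouring: colour i0 hits y1 twice and misses y, colour a the other
   way round; y1 = y means that every colour is a permutation. *)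
Definition near a y1 y f := [/\ a != i0,
  forall t, cnt (f i0) t + (t == y) = 1 + (t == y1),
  forall t, cnt (f a) t + (t == y1) = 1 + (t == y)
  & forall i, i != i0 -> i != a -> forall t, cnt (f i) t = 1].

Lemma eq_cnt (g h : T -> T) : g =1 h -> cnt g =1 cnt h.
Proof. by move=> gh t; apply: eq_bigr => x _; rewrite gh. Qed.

(** The trail of colours [i0] and [a] that starts at the doubled value [y1] can only end at [y], the
    one value that [i0] hits less often than [a]; exchanging along it repairs both colours. *)
Lemma resolve a y1 y f : near a y1 y f ->
  exists r, same_sum r f /\ forall i, i != i0 -> i != a -> r i =1 f i.
Proof.
move=> [ai0 H0 Ha H].
suff [g [gf gi ginj]] : exists g, [/\ same_sum g f, forall i, i != i0 -> i != a -> g i =1 f i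
    & forall i t, cnt (g i) t = 1].
  exists (fun i => perm (cnt1_inj (ginj i))); split=> [x u|i i1 i2 x].
    by rewrite -gf; apply: eq_bigr => i _; rewrite permE.
  by rewrite permE gi.
have [yy|ny] := eqVneq y1 y.
  exists f; split=> // i t; have [->|ni0] := eqVneq i i0; first by have := H0 t; rewrite yy; lia.
  by have [->|nia] := eqVneq i a; [have := Ha t; rewrite yy; lia|exact: H].
have lt : cnt (f a) y1 < cnt (f i0) y1.
  by have := H0 y1; have := Ha y1; rewrite eqxx (negPf ny); lia.
have ia : i0 != a by rewrite eq_sym.
have [Z [y' [lt' Hp Hq Hi]]] := swap_trail ia lt.
have y'y : y' = y.
  apply/eqP; move: lt' (H0 y') (Ha y'); case: eqVneq => // _; lia.
subst y'.
exists (swap i0 a Z f); split=> // [|i t]; first exact: same_sum_swap.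
have [->|ni0] := eqVneq i i0; first by have := H0 t; have := Hp t; lia.
have [->|nia] := eqVneq i a; first by have := Ha t; have := Hq t; lia.
by rewrite (eq_cnt (Hi _ _ _)) // H.
Qed.

Definition perm_weight (s : {perm T}) (e : T * T) : nat := s e.1 == e.2.

(** The new partner [a'] is [a] or the auxiliary colour [b], and only [i0], [a] and [b] change: this
    is what confines the change of resolutions to three colours. *)
Lemma near_step a y1 y f : near a y1 y f -> ~ f i0 =1 F ->
  (forall x, exists i, f i x = F x) ->
  exists f' a' y1' y' b, [/\ near a' y1' y' f', same_sum f' f,
    forall i, i != i0 -> i != a -> i != a' -> i != b -> f' i =1 f i,
    a' = a \/ a' = b &
    #|[set x | f' i0 x != F x]| < #|[set x | f i0 x != F x]| ].
Proof.
move=> nf nF suppF.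
(* A missed value [y] comes with a point where [i0] is wrong; if nothing is missed, [y] may be
   chosen as the target value of any wrong point. *)
wlog [x3 Fx3 nx3] : y1 y nf / exists2 x, F x = y & f i0 x <> y.
  move=> wl; have [yy|ny] := eqVneq y1 y.
    have [x fx] : exists x, f i0 x != F x.
      apply/existsP; apply: contraT => /existsPn nx; case: nF => x.
      by apply/eqP; rewrite -[_ == _]negbK nx.
    apply: (wl (F x) (F x)); last by exists x => //; apply/eqP.
    by case: nf => ai0 H0 Ha H; split=> // t; [have := H0 t|have := Ha t]; rewrite yy; lia.
  apply: (wl y1 y) => //; exists ((F^-1)%g y); rewrite ?permKV // => fy.
  case: nf => _ /(_ y) + _ _; rewrite eqxx eq_sym (negPf ny) /cnt.
  by rewrite (bigD1 ((F^-1)%g y)) //= fy eqxx; lia.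
have [ai0 H0 Ha H] := nf; have [b fb] := suppF x3.
rewrite Fx3 in fb.
have bi0 : i0 != b by apply: contra_notN nx3 => /eqP ->.
(* Colour [b] has the target value at [x3] and trades it for the value [y3] of [i0]. *)
pose y3 := f i0 x3; pose g := swap i0 b [set x3] f.
have [G0 Gb Gi] := swap1 x3 f bi0.
have y3y : y3 != y by apply/eqP.
have gf : same_sum g f by apply: same_sum_swap.
have agr h : h i0 =1 g i0 -> #|[set x | h i0 x != F x]| < #|[set x | f i0 x != F x]|.
  move=> hg; apply: proper_card; apply/properP; split.
    apply/subsetP => x; rewrite !inE hg /g /swap inE tpermL.
    by case: (eqVneq x x3) => [->|_] //; rewrite fb Fx3 eqxx.
  exists x3; rewrite !inE ?Fx3 //.
  by rewrite hg /g /swap inE eqxx tpermL fb eqxx.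
rewrite fb -/y3 -/g in G0 Gb.
have g0 t : cnt (g i0) t + (t == y3) = 1 + (t == y1).
  by have := G0 t; have := H0 t; rewrite ![_ == t]eq_sym; lia.
have [ba|ba] := eqVneq b a.
  exists g, a, y1, y3, b; split=> //; last exact: agr; last by left.
    split=> // [t|i i1 i2 t]; first by have := Gb t; have := Ha t; rewrite ba ![_ == t]eq_sym; lia.
    by rewrite (eq_cnt (Gi _ _ _)) ?ba // H.
  by move=> i i1 i2 _ _; apply: Gi; rewrite ?ba.
have gb t : cnt (g b) t + (t == y) = 1 + (t == y3).
  by have := Gb t; rewrite H // 1?eq_sym // ![_ == t]eq_sym; lia.
have ga t : cnt (g a) t + (t == y1) = 1 + (t == y).
  by rewrite (eq_cnt (Gi _ _ _)) // eq_sym.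
have gi i t : i != i0 -> i != a -> i != b -> cnt (g i) t = 1.
  by move=> i1 i2 i3; rewrite (eq_cnt (Gi _ _ _)) // H.
have [yy|ny] := eqVneq y1 y.
  exists g, b, y1, y3, b; split=> //; last exact: agr; last by right.
    split=> // [|t|i i1 i2 t]; first by rewrite eq_sym.
      by have := gb t; rewrite yy.
    by have [->|ia] := eqVneq i a; [have := ga t; rewrite yy; lia|exact: gi].
  by move=> i i1 i2 _ i4; apply: Gi.
(* Relative to permutations, [i0] now gains [y1] and loses [y3], [a] gains [y] and loses [y1], [b]
   gains [y3] and loses [y]. A trail of [a] and [b] from [y] ends at [y1], which repairs [a], or at
   [y3], which repairs [b]. *)
have lt : cnt (g b) y < cnt (g a) y.
  by have := gb y; have := ga y; rewrite eqxx ![y == _]eq_sym (negPf ny) (negPf y3y); lia.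
have ab : a != b by rewrite eq_sym.
have [Z [y' [lt' Ka Kb Ki]]] := swap_trail ab lt.
set h := swap a b Z g in Ka Kb Ki.
have hf : same_sum h f by apply: same_sum_trans gf; apply: same_sum_swap.
have h0 : h i0 =1 g i0 by apply: Ki; rewrite // eq_sym.
have hi i : i != i0 -> i != a -> i != b -> h i =1 f i.
  by move=> i1 i2 i3 x; rewrite Ki //; apply: Gi; rewrite // eq_sym.
have [y1'|ny1] := eqVneq y' y1.
  exists h, b, y1, y3, b; split=> //; last exact: agr; last by right.
    split=> // [|t|t|i i1 i2 t]; first by rewrite eq_sym.
    - by rewrite (eq_cnt h0).
    - by move: (Kb t) (gb t); rewrite y1'; clear; lia.
    - have [->|ia] := eqVneq i a; first by move: (Ka t) (ga t); rewrite y1'; clear; lia.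
      by rewrite (eq_cnt (hi _ _ _ _)) // H.
  by move=> i i1 i2 _ i4; apply: hi.
have y3' : y' = y3.
  apply/eqP; move: (ga y') (gb y') lt'; rewrite (negPf ny1).
  by case: (y' == y3) => //; clear; lia.
exists h, a, y1, y3, b; split=> //; last exact: agr; last by left.
  split=> // [t|t|i i1 i2 t]; first by rewrite (eq_cnt h0).
  - by move: (Ka t) (ga t); rewrite y3'; clear; lia.
  - have [->|ib] := eqVneq i b; first by move: (Kb t) (gb t); rewrite y3'; clear; lia.
    by rewrite (eq_cnt (hi _ _ _ _)) // H.
by move=> i i1 i2 _ i4; apply: hi.
Qed.

(* Resolutions of consecutive near-colourings differ in three colours only. *)
Lemma linked_target a y1 y f r : near a y1 y f -> same_sum r f ->
  (forall i, i != i0 -> i != a -> r i =1 f i) -> (forall x, exists i, f i x = F x) ->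
  exists2 r', linked perm_weight predT 3 (codom r) (codom r') & r' i0 = F.
Proof.
have [n] := ubnP #|[set x | f i0 x != F x]|.
elim: n => // n IH in a y1 y f r *; rewrite ltnS => len nf rf ri suppF.
have [/forallP eF|neF] := boolP [forall x, f i0 x == F x].
  have {}eF x : f i0 x = F x by apply/eqP.
  have [ai0 H0 Ha H] := nf.
  have yy : y = y1.
    apply/eqP; have := H0 y; rewrite (eq_cnt eF) cnt_perm eqxx; case: eqP => //; lia.
  have finj i : injective (f i).
    apply: cnt1_inj => t; have [->|ni0] := eqVneq i i0; first by have := H0 t; rewrite yy; lia.
    by have [->|nia] := eqVneq i a; [have := Ha t; rewrite yy; lia|exact: H].
  exists (fun i => perm (finj i)); last by apply/permP => x; rewrite permE.
  apply: (linked_codom (D := [set i0; a])) => // [|i|[x u]].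
  - by rewrite cards2; case: eqP.
  - by rewrite !inE negb_or => /andP[i1 i2]; apply/permP => x; rewrite permE ri.
  - by rewrite /perm_weight /= rf; apply: eq_bigr => i _; rewrite permE.
have nF : ~ f i0 =1 F by move=> eF; case/negP: neF; apply/forallP => x; rewrite eF.
have [f' [a' [y1' [y' [b [nf' f'f f'i a'b lt]]]]]] := near_step nf nF suppF.
have [r' [r'f' r'i]] := resolve nf'.
have suppF' x : exists i, f' i x = F x.
  have [i fi] := suppF x.
  suff /existsP [j /eqP fj] : [exists j, f' j x == F x] by exists j.
  apply: contraT => /existsPn no.
  have := f'f x (F x); rewrite big1 => [|j _]; last by rewrite (negPf (no j)).
  by rewrite (bigD1 i) //= fi eqxx.
have [r'' lr'' eqF] := IH a' y1' y' f' r' (leq_trans lt len) nf' r'f' r'i suppF'.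
exists r'' => //; apply: linked_trans lr''.
apply: (linked_codom (D := [set i0; a; b])) => // [|i|[x u]].
- by rewrite -!setUA !cardsU1 cards1; do 2 case: (_ \notin _).
- rewrite !inE !negb_or -!andbA => /and3P[i1 i2 i3]; apply/permP => x.
  have ia' : i != a' by case: a'b => ->.
  by rewrite ri // r'i // f'i.
- by rewrite /perm_weight /= rf r'f' f'f.
Qed.

End Birkhoff.

(** It suffices to reach a family that contains the first member [F] of [t]; it then cancels and
    induction applies. Equal sums ensure that every value of [F] is available in some colour. *)
Lemma birkhoff_linked (T : finType) (s t : seq {perm T}) : size s = size t ->
  (forall x u, \sum_(f <- s) (f x == u) = \sum_(f <- t) (f x == u)) ->
  linked (@perm_weight T) predT 3 s t.
Proof.
elim: t s => [|F t IH] s; first by move/size0nil => -> _; apply: linked_perm.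
move=> ss cs.
suff [s' ls] : exists s', linked (@perm_weight T) predT 3 s (F :: s').
  have sls : size s = size (F :: s') /\ forall x u,
      \sum_(f <- s) (f x == u) = \sum_(f <- F :: s') (f x == u).
    elim: ls => {s' s ss cs} [a b ab|x y r _ sxy wxy _|a b c _ [? A1] _ [? A2]].
    - by split=> [|x u]; [exact: perm_size|exact: perm_big].
    - rewrite !size_cat sxy; split=> // z u; rewrite !big_cat /=; congr (_ + _).
      exact: (wxy (z, u)).
    - by split=> [|x u]; [congruence|rewrite A1].
  case: sls => sz cs'; apply: linked_trans ls _; apply: linked_cons; apply: IH.
    by move: ss; rewrite sz /= => -[].
  by move=> x u; have := cs' x u; rewrite cs !big_cons => /addnI.
pose r (i : 'I_(size s)) := nth 1%g s i.
have sr : codom r = s.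
  transitivity (mkseq (nth 1%g s) (size s)); last exact: mkseq_nth.
  by rewrite codomE /mkseq -val_enum_ord -map_comp.
have cr x u : \sum_i (r i x == u) = \sum_(f <- s) (f x == u).
  transitivity (\sum_(f <- codom r) (f x == u)); last by rewrite sr.
  by rewrite big_map big_enum.
have suppF x : exists i, r i x = F x.
  suff /existsP [j /eqP fj] : [exists j, r j x == F x] by exists j.
  apply: contraT => /existsPn no.
  have := cr x (F x); rewrite cs big_cons eqxx big1 => [|j _]; first lia.
  by rewrite (negPf (no j)).
have s0 : 0 < size s by rewrite ss.
pose i0 := Ordinal s0.
suff [r' lr r'0] : exists2 r', linked (@perm_weight T) predT 3 (codom r) (codom r') & r' i0 = F.
  exists (rem F (codom r')); have := lr; rewrite sr => /linked_trans; apply.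
  by apply: linked_perm; apply: perm_to_rem; rewrite -r'0 codom_f.
have [/forallP eF|/forallPn [x nx]] := boolP [forall x, r i0 x == F x].
  by exists r; [apply: linked_perm|apply/permP => x; apply/eqP].
(* The walk starts from permutations, so any colour other than [i0] may serve as partner; one that
   agrees with [F] at [x], where [i0] does not, differs from [i0]. *)
have [a ra] := suppF x.
have ai0 : a != i0 by apply: contraNneq nx => <-; apply/eqP.
apply: (@linked_target _ _ i0 F a x x (fun i => r i)) => //.
by split=> // *; rewrite cnt_perm.
Qed.

(** * Thetas in subcubic graphs *)

Section Theta.
Variable T : finType.
Implicit Types (r : rel T) (C : seq T) (W : {set T}).

Record theta_by r (u v : T) (s : 'I_3 -> seq T) : Prop := ThetaBy {
  theta_path : forall j, path r u (rcons (s j) v);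
  theta_uniq : forall j, uniq (u :: rcons (s j) v);
  theta_odd : forall j, odd (size (s j));
  theta_disj : forall j k x, j != k -> x \in s j -> x \notin s k }.

(* The branch vertices of an odd subdivision of K_{2,3} are the ends of three
   internally disjoint paths of even length. *)
Definition odd_theta r := exists u v (s : 'I_3 -> seq T), theta_by r u v s.

Lemma odd_theta_sub r r' : subrel r r' -> odd_theta r -> odd_theta r'.
Proof.
move=> rr' [u [v [s [sp su so sd]]]]; exists u, v, s; split=> // j.
exact: sub_path (sp j).
Qed.

Section Bipartite.
Variables (r : rel T) (A : {set T}).
Hypotheses (rsym : symmetric r) (rbip : forall x y, r x y -> (x \in A) != (y \in A)).

Let N x := [set y | r x y].

Lemma bip_irr x : r x x = false.
Proof. by apply/negP => /rbip; rewrite eqxx. Qed.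

Lemma bip_path u p : path r u p -> (last u p \in A) = (u \in A) (+) odd (size p).
Proof.
elim: p u => [|x p IH] u /=; first by rewrite addbF.
by case/andP=> /rbip + /IH ->; case: (u \in A); case: (x \in A); case: odd.
Qed.

Lemma bip_odd u v s : path r u (rcons s v) -> (u \in A) = (v \in A) -> odd (size s).
Proof. by move/bip_path; rewrite last_rcons size_rcons => -> /=; case: (u \in A); case: odd. Qed.

Lemma rev_path_rcons u v s : path r u (rcons s v) -> path r v (rcons (rev s) u).
Proof.
move=> p; rewrite -rev_cons -[v](last_rcons u s) -(belast_rcons u s v) rev_path.
by rewrite (@eq_path _ _ r).
Qed.

(** The two arcs of the cycle between [u] and [v] and the ear [s] are internally disjoint; their
    lengths are even because [u] and [v] are on the same side. *)
Lemma cycle_ear_theta C u v (s : seq T) : cycle r C -> uniq C -> u \in C -> v \in C -> u != v ->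
  (u \in A) = (v \in A) -> path r u (rcons s v) -> uniq s ->
  (forall x, x \in s -> x \notin C) -> odd_theta r.
Proof.
move=> cC uC uinC vinC uv uvA ps us sC.
have [i C' rotC] := rot_to uinC.
have memC x : (x \in C) = (x \in u :: C') by rewrite -rotC mem_rot.
move: cC uC; rewrite -(rot_cycle i) -(rot_uniq i) rotC.
move: vinC; rewrite memC inE eq_sym (negPf uv) /= => vC'.
case/splitPr: vC' memC rotC => p1 p2 memC _ /= cC uC.
have p1p : path r u (rcons p1 v).
  by move: cC; rewrite rcons_cat -cat_rcons cat_path => /andP[].
have p2p : path r v (rcons p2 u).
  by move: cC; rewrite rcons_cat -cat_rcons cat_path last_rcons => /andP[].
have := rev_path_rcons p2p => p2p'.
have uC' : uniq (u :: v :: p1 ++ p2).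
  by rewrite (perm_uniq (s2 := u :: p1 ++ v :: p2)) // perm_cons -cat1s perm_catCA.
pose S (j : 'I_3) := nth [::] [:: p1; rev p2; s] j.
have Sp j : path r u (rcons (S j) v) by case: j => [[|[|[|]]]].
suff Su j : uniq (u :: rcons (S j) v).
  exists u, v, S; split=> // [j|]; first exact: bip_odd (Sp j) uvA.
  have d12 x : x \in p1 -> x \notin p2.
    by move: uC'; rewrite /= cat_uniq => /and3P[_ _ /and3P[_ /hasPn h _]] xp; apply/negP => /h; rewrite xp.
  have d1s x : x \in p1 -> x \notin s.
    by move=> xp; apply/negP => /sC; rewrite memC !inE mem_cat xp orbT.
  have d2s x : x \in p2 -> x \notin s.
    by move=> xp; apply/negP => /sC; rewrite memC !inE mem_cat inE xp !orbT.
  case=> [[|[|[|]]]] // ?; case=> [[|[|[|]]]] // ? x //= _; rewrite ?mem_rev.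
  - exact: d12.
  - exact: d1s.
  - by move=> h; apply/negP => /d12; rewrite h.
  - exact: d2s.
  - by move=> h; apply/negP => /d1s; rewrite h.
  - by move=> h; apply/negP => /d2s; rewrite h.
rewrite /S; case: j => [[|[|[|]]]] //= _.
- rewrite mem_rcons rcons_uniq inE (negPf uv) /=.
  by move: uC'; rewrite /= !inE !negb_or !mem_cat !negb_or cat_uniq => /and5P[/and3P[_ -> _] /andP[-> _] -> _ _].
- rewrite mem_rcons rcons_uniq inE (negPf uv) /= !mem_rev rev_uniq.
  by move: uC'; rewrite /= !inE !negb_or !mem_cat !negb_or cat_uniq => /and5P[/and3P[_ _ ->] /andP[_ ->] _ _ ->].
- rewrite mem_rcons rcons_uniq inE (negPf uv) /= us andbT.
  by apply/andP; split; [apply/negP => /sC|apply/negP => /sC]; rewrite memC !inE ?mem_cat ?inE eqxx ?orbT.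
Qed.

Definition is_cycle C := [&& cycle r C, uniq C & 2 < size C].

(** A path in [W] is extended at its head; once it is stuck, the head has a neighbour on the path
    other than its predecessor, which closes a cycle. *)
Lemma mindeg_cycle W x : x \in W -> (forall y, y \in W -> 1 < #|N y :&: W|) ->
  exists2 C, is_cycle C & {subset C <= W}.
Proof.
move=> xW degW.
suff H n y p : #|T| <= n + size p -> path r y p -> uniq (y :: p) -> all (mem W) (y :: p) ->
    exists2 C, is_cycle C & {subset C <= W}.
  by apply: (H #|T| x [::]); rewrite /= ?addn0 ?xW.
elim: n y p => [|n IH] y p sz pp up aW.
  have : size (y :: p) <= #|T| by rewrite -(card_uniqP up) max_card.
  by rewrite leqNgt ltnS sz.
have yW : y \in W by case/andP: aW.
have [/existsP [z /and3P[yz zW zp]]|no] := boolP [exists z, [&& r y z, z \in W & z \notin y :: p]].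
  apply: (IH z (y :: p)); rewrite /= ?addnS //.
  - by rewrite rsym yz.
  - by move: zp up; rewrite /= => -> ->.
  - by rewrite zW.
(* For an empty path the predecessor defaults to [y] itself, which is no neighbour of [y]. *)
have [z] : exists z, z \in N y :&: W :\ head y p.
  apply/set0Pn; rewrite -card_gt0; have := degW _ yW; rewrite (cardsD1 (head y p)).
  by case: (_ \in _) => /=; lia.
rewrite !inE => /and3P[zh yz zW].
have zp : z \in p.
  have := no; rewrite negb_exists => /forallP /(_ z); rewrite yz zW inE negbK.
  by case: eqP => // zy; move: yz; rewrite zy bip_irr.
case/splitPr: zp zh pp up aW {sz no} => p1 p2 zh pp up aW.
exists (y :: p1 ++ [:: z]).
  apply/and3P; split.
  - rewrite /= -cats1 -catA /= cat_path /= cat_path /= in pp *.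
    by case/and3P: pp => -> -> _; rewrite rsym yz.
  - by move: up; rewrite /= !mem_cat !cat_uniq /= !inE !negb_or andbT => /and4P[/and3P[-> -> _] -> /andP[-> _] _].
  - rewrite /= size_cat addn1 !ltnS lt0n size_eq0.
    by apply: contraNneq zh => ->; rewrite /= eqxx.
move=> t; rewrite !inE mem_cat inE => ht; have /allP := aW; apply.
by rewrite !inE mem_cat inE; case/or3P: ht => ->; rewrite ?orbT.
Qed.

(** A forest on [k > 0] vertices has degree sum at most [2 * k - 2], so one unit of slack is
    allowed. Removing a vertex of degree at most one preserves the inequality, and it fails for a
    single vertex. *)
Lemma dense_cycle W : 0 < #|W| -> 2 * #|W| <= (\sum_(x in W) #|N x :&: W|).+1 ->
  exists2 C, is_cycle C & {subset C <= W}.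
Proof.
have [n] := ubnP #|W|; elim: n W => // n IH W; rewrite ltnS => Wn /card_gt0P [x xW] sumW.
have [/forall_inP degW|/forall_inPn [y yW]] := boolP [forall y in W, 1 < #|N y :&: W|].
  exact: mindeg_cycle xW degW.
rewrite -leqNgt => degy.
have cW := cardsD1 y W; rewrite yW in cW.
have sE : \sum_(t in W) #|N t :&: W| = #|N y :&: W| + (\sum_(t in W :\ y) #|N t :&: (W :\ y)| + #|N y :&: W|).
  rewrite (bigD1 y) //=; congr (_ + _).
  rewrite (eq_bigl (mem (W :\ y))) /=; last by move=> t; rewrite !inE andbC.
  rewrite (eq_bigr (fun t => #|N t :&: (W :\ y)| + (y \in N t))); last first.
    move=> t _; rewrite (cardsD1 y) addnC inE yW andbT; congr (_ + _).
    by congr #|pred_of_set _|; rewrite setIDA.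
  rewrite big_split /=; congr (_ + _); rewrite -sum1_card [in LHS]big_mkcond [RHS]big_mkcond /=.
  apply: eq_bigr => t _; rewrite !inE rsym.
  by case: eqVneq => [->|_] /=; rewrite ?bip_irr //; case: (r y t); case: (t \in W).
have [W0|W0] := posnP #|W :\ y|.
  move: sumW; rewrite (bigD1 y) //= big1; last first.
    move=> t /andP[tW ty]; move/eqP: W0; rewrite cards_eq0 => /eqP W0.
    by have : t \in W :\ y; [rewrite !inE ty|rewrite W0 inE].
  rewrite cW W0; have : N y :&: W = set0.
    apply/setP => t; rewrite !inE; case: (eqVneq t y) => [->|ty]; first by rewrite bip_irr.
    move: W0 => /eqP; rewrite cards_eq0 => /eqP /setP /(_ t); rewrite !inE ty /= => ->.
    by rewrite andbF.
  by move=> ->; rewrite cards0.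
have [||C cC sC] := IH (W :\ y) _ W0.
- by move: cW Wn; lia.
- by move: sumW cW degy; rewrite sE; lia.
- by exists C => // t /sC; rewrite inE => /andP[].
Qed.

Lemma cycle_nbrs C x : is_cycle C -> x \in C ->
  exists y z y' z', [/\ [/\ y \in C, z \in C, y' \in C & z' \in C],
    [/\ r x y, r y y', r x z & r z z'], y != z, y' != x & z' != x].
Proof.
case/and3P=> cC uC sC xC; have [i C' rotC] := rot_to xC.
have memC t : (t \in C) = (t \in x :: C') by rewrite -rotC mem_rot.
move: cC uC sC; rewrite -(rot_cycle i) -(rot_uniq i) -(size_rot i) rotC.
case: C' memC rotC => [|y C'] //= memC _; case/lastP: C' memC => [|C' z] //= memC.
rewrite -!rcons_cons !rcons_path !last_rcons /= => /andP[xy /andP[/andP[yC1 yC2] zx]].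
rewrite !inE !mem_rcons !inE !negb_or rcons_uniq -!andbA => /and5P[xy' xz' xC' yz'].
case/and3P=> yC' zC' uC' _.
exists y, z, (head z C'), (last y C'); split=> //.
- split; rewrite memC !inE ?mem_rcons ?inE ?eqxx ?orbT //.
    by case: (C') => [|t ?]; rewrite /= ?inE eqxx ?orbT.
  by case/lastP: (C') => [|? t] /=; rewrite ?last_rcons ?mem_rcons ?inE eqxx ?orbT.
- split=> //; [|by rewrite rsym|by rewrite rsym].
  by case: (C') yC1 yC2 => [|t ?] //= /andP[].
- by case: (C') xC' => [|t ?] /=; rewrite 1?eq_sym // inE negb_or eq_sym => /andP[].
- by case/lastP: (C') xC' => [|? t] /=; rewrite 1?eq_sym // last_rcons mem_rcons inE negb_or eq_sym => /andP[].
Qed.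

Lemma cycle_deg C x : is_cycle C -> x \in C -> 1 < #|N x :&: [set y in C]|.
Proof.
move=> cC xC; have [y [z [_ [_ [[yC zC _ _] [xy _ xz _] yz _ _]]]]] := cycle_nbrs cC xC.
have <- : #|[set y; z]| = 2 by rewrite cards2 yz.
by apply/subset_leq_card/subsetP => t; rewrite !inE => /orP[] /eqP ->; apply/andP.
Qed.


Hypotheses (deg_le3 : forall x, #|N x| <= 3) (deg_ge2 : forall x y, r x y -> 1 < #|N x|).
Hypothesis deg2_indep : forall x y, r x y -> 4 < #|N x| + #|N y|.

Let avoid C : rel T := [rel x y | [&& r x y, x \notin C & y \notin C]].

Let comp C o := [set x | connect (avoid C) o x].

Lemma avoid_sym C : symmetric (avoid C).
Proof. by move=> x y; rewrite /avoid /= rsym; case: (r y x) => //=; rewrite andbC. Qed.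

Lemma comp_notin C o x : o \notin C -> x \in comp C o -> x \notin C.
Proof.
move=> oC; rewrite inE => /connectP [p pp ->].
by case/lastP: p pp => [|p y] //=; rewrite rcons_path last_rcons => /andP[_ /and3P[]].
Qed.

Lemma comp_next C o x y : o \notin C -> x \in comp C o -> r x y -> y \notin C -> y \in comp C o.
Proof.
move=> oC xo rxy yC; have xC := comp_notin oC xo; rewrite !inE in xo *.
by apply: connect_trans xo (connect1 _); rewrite /avoid /= rxy xC.
Qed.

(** A path through the component joins the two attachments and is an ear of the cycle. *)
Lemma comp_attach_theta C o a b a' b' : is_cycle C -> o \notin C -> a \in C -> b \in C -> a != b ->
  (a \in A) = (b \in A) -> a' \in comp C o -> b' \in comp C o -> r a' a -> r b' b -> odd_theta r.
Proof.
case/and3P=> cC uC _ oC aC bC ab abA a'o b'o ra rb.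
have a'C := comp_notin oC a'o.
have /connectP [p pp pb] : connect (avoid C) a' b'.
  rewrite !inE in a'o b'o; apply: connect_trans b'o.
  by rewrite (sym_connect_sym (avoid_sym C)).
case/shortenP: pp pb => {}p pp up _ pb.
apply: (cycle_ear_theta cC uC aC bC ab abA (s := a' :: p)) => //.
  rewrite /= rsym ra rcons_path -pb rb andbT; apply: sub_path pp => x y.
  by case/and3P.
move=> x xp; apply: (comp_notin oC); rewrite inE.
rewrite inE in a'o; apply: connect_trans a'o _.
exact: path_connect xp.
Qed.

Lemma connect_nbr x y : connect r x y -> x != y -> exists z, r y z.
Proof.
case/connectP => p; case/lastP: p => [|p z] /=; first by move=> _ ->; rewrite eqxx.
by rewrite rcons_path last_rcons => /andP[_ h] -> _; exists (last x p); rewrite rsym.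
Qed.

Lemma card_nbrs x W W' : (forall y, r x y -> (y \in W) (+) (y \in W')) ->
  #|N x| = #|N x :&: W| + #|N x :&: W'|.
Proof.
move=> h; rewrite -cardsUI [X in _ + X]eq_card0 ?addn0 => [|y].
  apply: eq_card => y; rewrite !inE; case: (boolP (r x y)) => //= /h.
  by case: (y \in W); case: (y \in W').
by rewrite !inE; case: (boolP (r x y)) => //= /h; case: (y \in W); case: (y \in W').
Qed.

(* A larger component of the complement of a cycle: O and its attachment a are
   removed, and what remains is still dense enough to contain a cycle. *)
Lemma larger_comp C o c : is_cycle C -> o \notin C -> c \in C -> connect r o c ->
  odd_theta r \/ exists C' c', [/\ is_cycle C', o \notin C', c' \in C', connect r o c' &
    #|comp C o| < #|comp C' o|].
Proof.
move=> cC oC cinC oc; set O := comp C o.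
have oO : o \in O by rewrite inE connect0.
have OC x : x \in O -> x \notin C by apply: comp_notin.
have [a [a' [aC a'O ra]]] : exists a a', [/\ a \in C, a' \in O & r a' a].
  suff /exists_inP [a aC /exists_inP[a' a'O ra]] : [exists a in C, exists a' in O, r a' a] by exists a, a'.
  apply: contraT => /exists_inPn no; have : c \in O.
    have /connectP [p pp ->] := oc; elim/last_ind: p pp => // p x IH.
    rewrite rcons_path last_rcons => /andP[/IH pO rx].
    case: (boolP (x \in C)) => xC; last exact: comp_next pO rx xC.
    by case/negP: (no _ xC); apply/exists_inP; exists (last o p).
  by move/OC; rewrite cinC.
have att_theta b b' : b \in C -> b != a -> (b \in A) = (a \in A) -> b' \in O -> r b' b -> odd_theta r.
  by move=> bC ba bA b'O rb; apply: (comp_attach_theta cC oC bC aC ba bA b'O a'O rb ra).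
have oa x : x \in O -> connect r o x.
  by rewrite inE; apply: connect_sub => y z /and3P[ryz _ _]; apply: connect1.
have aA x : r a x -> (x \in A) = ~~ (a \in A) by move/rbip; case: (a \in A); case: (x \in A).
have bipN x y : r x y -> (y \in A) = ~~ (x \in A) by move/rbip; case: (x \in A); case: (y \in A).
(* Both cycle neighbours of [a] are on the side opposite to [a]; if both were attached to [O] there
   would be a theta. So one of them, [p], is not, and [p'] is the next vertex beyond it. *)
have [th|[p [p' [[pC p'C] [rap rpp'] p'a noatt]]]] : odd_theta r \/ exists p p',
    [/\ p \in C /\ p' \in C, r a p /\ r p p', p' != a & forall x, x \in O -> ~~ r x p].
  have [y [z [y' [z' [[yC zC y'C z'C] [ay yy' az zz'] yz y'a z'a]]]]] := cycle_nbrs cC aC.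
  have [/exists_inP [y1 y1O ry]|noy] := boolP [exists x in O, r x y]; last first.
    by right; exists y, y'; split=> // x xO; apply: contra noy => rx; apply/exists_inP; exists x.
  have [/exists_inP [z1 z1O rz]|noz] := boolP [exists x in O, r x z]; last first.
    by right; exists z, z'; split=> // x xO; apply: contra noz => rx; apply/exists_inP; exists x.
  by left; apply: (comp_attach_theta cC oC yC zC yz _ y1O z1O ry rz); rewrite (aA _ ay) (aA _ az).
  by left.
(* The vertex [p'] is on the side of [a], which is an attachment already. *)
have [/exists_inP [x xO rxp']|noatt'] := boolP [exists x in O, r x p'].
  by left; apply: (att_theta p' x) => //; rewrite (bipN p) // (bipN a) // negbK.
right; pose W := [set x | [&& connect r o x, x != a & x \notin O]].
have pa : p != a by apply: contraTneq rap => ->; rewrite bip_irr.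
have pW : p \in W.
  rewrite inE pa /=; apply/andP; split; last by apply: contraL pC => /OC.
  by rewrite (connect_trans (oa _ a'O)) // (connect_trans (connect1 ra)) // connect1.
have p'W : p' \in W.
  rewrite inE p'a /=; apply/andP; split; last by apply: contraL p'C => /OC.
  by move: pW; rewrite inE => /andP[op _]; rewrite (connect_trans op) // connect1.
(* One of the adjacent [p] and [p'] has degree three, and neither is attached to [O]: this vertex
   [q] gives the surplus of one in the count below. *)
have [q [qW q3 qO]] : exists q, [/\ q \in W, #|N q| = 3 & N q :&: O = set0].
  have empty s : (forall x, x \in O -> ~~ r x s) -> N s :&: O = set0.
    move=> ns; apply/setP => x; rewrite !inE rsym; apply/negbTE; rewrite negb_and orbC -implybE.
    by apply/implyP => xO; apply: ns; rewrite inE.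
  have i5 := deg2_indep rpp'; have [p2|p3] := leqP #|N p| 2.
    exists p'; split=> //; first by move: i5 p2 (deg_le3 p'); clear; lia.
    by apply: empty => x xO; apply: contra noatt' => rx; apply/exists_inP; exists x.
  exists p; split=> //; last exact: empty.
  by move: p3 (deg_le3 p); clear; lia.
have degC x : x \in C -> 2 + #|N x :&: O| <= #|N x|.
  move=> xC; have := cycle_deg cC xC; rewrite -(leq_add2r #|N x :&: O|) => /leq_trans; apply.
  rewrite -cardsUI [X in _ + X]eq_card0 ?addn0; last first.
    by move=> y; rewrite !inE; apply/negP => /andP[/andP[_ yC] /andP[_ yO]]; have := OC y; rewrite inE yO yC => /(_ isT).
  by apply/subset_leq_card/subsetP => y; rewrite !inE => /orP[] /andP[].
have NWO x : x \in W -> #|N x| = #|N x :&: W| + #|N x :&: (a |: O)|.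
  rewrite inE => /and3P[ox _ _]; apply: card_nbrs => y rxy.
  rewrite !(inE, in_setU1) (connect_trans ox (connect1 rxy)) /=.
  by case: (y == a); case: (connect _ _ _).
have NaO x : #|N x :&: (a |: O)| <= r x a + #|N x :&: O|.
  rewrite setIUr; apply: leq_trans (leq_card_setU _ _) _; rewrite leq_add2r.
  case: (boolP (r x a)) => rxa; first by rewrite (leq_trans (subset_leq_card (subsetIr _ _))) ?cards1.
  by rewrite leqn0 cards_eq0 -subset0; apply/subsetP => y; rewrite !inE => /andP[+ /eqP ya]; rewrite ya (negPf rxa).
(* Only vertices of [C] can have neighbours in [O] without belonging to it, and these have two
   further neighbours on the cycle. *)
have degW x : x \in W -> 2 + (x == q) <= #|N x :&: W| + r x a.
  move=> xW; have := NWO x xW; have := NaO x.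
  case: (eqVneq x q) => [->|xq]; first by rewrite qO cards0 q3; clear; lia.
  suff : 2 + #|N x :&: O| <= #|N x| by clear; lia.
  have [/degC //|xC] := boolP (x \in C).
  have -> : N x :&: O = set0.
    apply/setP => y; rewrite [in RHS]inE; apply/negP; rewrite inE => /andP[]; rewrite inE => rxy yO.
    move: xW; rewrite inE => /and3P[_ _ /negP]; apply; apply: comp_next yO _ xC => //.
    by rewrite rsym.
  rewrite cards0; move: xW; rewrite inE => /and3P[ox _ xO].
  have [|z] := connect_nbr ox; first by apply: contraNneq xO => <-.
  by move/deg_ge2.
have [||C' cC' C'W] := @dense_cycle W.
- by apply/card_gt0P; exists q.
- have sW : \sum_(x in W) (2 + (x == q)) = 2 * #|W| + 1.
    rewrite big_split /= sum_nat_const mulnC; congr (_ + _).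
    by rewrite (bigD1 q) //= eqxx big1 // => x /andP[_ /negPf ->].
  (* The neighbour [a'] of [a] lies in [O], outside [W], which leaves at most two. *)
  have sa : \sum_(x in W) (r x a : nat) <= 2.
    rewrite -ltnS; apply: leq_trans (deg_le3 a); rewrite -sum1_card.
    rewrite [ltnRHS](bigD1 a') ?inE 1?rsym //= add1n ltnS.
    rewrite big_mkcond [leqRHS]big_mkcond; apply: leq_sum => x _; rewrite !inE rsym.
    case: (eqVneq x a') => [->|]; first by rewrite inE in a'O; rewrite a'O !andbF.
    by rewrite andbT; case: (r a x) => //; case: ifP.
  have : \sum_(x in W) (2 + (x == q)) <= \sum_(x in W) (#|N x :&: W| + r x a) by apply: leq_sum.
  by move: sa; rewrite sW big_split /=; clear; lia.
have C'O x : x \in O -> x \notin C' by move=> xO; apply/negP => /C'W; rewrite inE xO !andbF.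
have aC' : a \notin C' by apply/negP => /C'W; rewrite inE eqxx andbF.
have [c' c'C'] : exists c', c' \in C'.
  by case/and3P: cC' => _ _; case: (C') => // c' ? _; exists c'; rewrite inE eqxx.
exists C', c'; split=> //; first exact: C'O.
  by have := C'W _ c'C'; rewrite inE => /andP[].
(* The new cycle avoids [O] and [a], so the component of [o] now contains [O] and [a]. *)
have sub x : x \in O -> connect (avoid C') o x.
  rewrite inE => /connectP [s ps ->]; apply/connectP; exists s => //.
  have sO : all (mem O) (o :: s).
    by apply/allP => y ys; rewrite /= inE; apply: path_connect ys.
  apply: sub_in_path sO ps => y z yO zO /and3P[ryz _ _].
  by rewrite /avoid /= ryz !C'O.
apply: proper_card; apply/properP; split; first by apply/subsetP => x /sub; rewrite inE.
exists a; last by apply: contraL aC => /OC.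
rewrite inE (connect_trans (sub _ a'O)) // connect1 // /avoid /= ra aC' andbT.
exact: C'O.
Qed.

(** It suffices to find a vertex [a] whose removal leaves two neighbours to every other vertex of
    its component: this yields a cycle avoiding [a], and then the component of [a] in the complement
    of the cycle cannot grow forever. *)
Lemma mindeg_theta x y : r x y -> odd_theta r.
Proof.
move=> rxy.
suff [a [ra [b rab]]] : exists a, (forall z, connect r a z -> z != a -> 1 < #|N z :&: [set t | connect r a t & t != a]|)
    /\ exists b, r a b.
  have ba : b != a by apply: contraTneq rab => ->; rewrite bip_irr.
  have [|z|C cC CW] := @mindeg_cycle [set t | connect r a t & t != a] b.
  - by rewrite inE connect1.
  - by rewrite inE => /andP[]; apply: ra.
  have [c cinC] : exists c, c \in C.
    by case/and3P: cC => _ _; case: (C) => // c ? _; exists c; rewrite inE eqxx.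
  have aC : a \notin C by apply/negP => /CW; rewrite inE eqxx andbF.
  have ac : connect r a c by have := CW _ cinC; rewrite inE => /andP[].
  have [n lt] : exists n, #|T| < n + #|comp C a| by exists #|T|.+1; rewrite ltnS leq_addr.
  elim: n C cC {CW} c cinC aC ac lt => [|n IH] C cC c cinC aC ac lt.
    by move: lt; rewrite add0n ltnNge max_card.
  have [//|[C' [c' [cC' aC' c'C' ac' lt']]]] := larger_comp cC aC cinC ac.
  by apply: (IH C' cC' c') => //; apply: leq_trans lt _; rewrite addSnnS leq_add2l.
have nb a z : connect r a z -> z != a -> #|N z| = #|N z :&: [set t | connect r a t & t != a]| + r z a.
  move=> az za; rewrite (@card_nbrs z [set t | connect r a t & t != a] [set a]) => [|t rzt].
    congr (_ + _); case: (boolP (r z a)) => rza.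
      by rewrite (_ : _ :&: _ = [set a]) ?cards1 //; apply/setIidPr; rewrite sub1set inE.
    by apply/eqP; rewrite cards_eq0 -subset0; apply/subsetP => t; rewrite !inE => /andP[+ /eqP ta]; rewrite ta (negPf rza).
  by rewrite !inE (connect_trans az (connect1 rzt)) /= addNb addbb.
(* A vertex of degree two will do, since its neighbours have degree three; in its absence all other
   vertices of the component have degree three and [x] will do. *)
have [/existsP [a /andP[xa a2]]|no] := boolP [exists a, connect r x a && (#|N a| == 2)].
  exists a; split; last first.
    have [t] : exists t, t \in N a by apply/set0Pn; rewrite -card_gt0 (eqP a2).
    by rewrite inE => rat; exists t.
  move=> z az za; have := nb _ _ az za; case: (boolP (r z a)) => rza.
    by have := deg2_indep rza; rewrite (eqP a2); clear; lia.
  have [|t /deg_ge2] := connect_nbr az; first by rewrite eq_sym.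
  by clear; lia.
exists x; split; last by exists y.
move=> z xz zx; have := nb _ _ xz zx.
have [|t /deg_ge2 z2] := connect_nbr xz; first by rewrite eq_sym.
have : #|N z| != 2.
  by have := no; rewrite negb_exists => /forallP /(_ z); rewrite xz.
by move: z2; case: (r z x); clear; lia.
Qed.

End Bipartite.
End Theta.

(** * Kempe changes *)

Section Refine.
Variables (T : finType) (r r' : rel T) (A : {set T}) (x y a b : T).
Hypotheses (rsym : symmetric r) (rxa : r x a) (rab : r a b) (rby : r b y) (ab : a != b).
Hypothesis r'r : forall s t, r' s t -> [|| r s t, (s == x) && (t == y) | (s == y) && (t == x)].
Hypothesis r'ab : forall s t, r' s t -> (s \notin [:: a; b]) && (t \notin [:: a; b]).
Hypothesis r'bip : forall s t, r' s t -> (s \in A) != (t \in A).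
Hypothesis xyA : (x \in A) != (y \in A).

Lemma path_notin_refine g p : (x \notin g :: p) || (y \notin g :: p) -> path r' g p -> path r g p.
Proof.
move=> H; apply: (@sub_in_path _ (mem (g :: p))); last by apply/allP.
move=> s t; rewrite /= => sp tp /r'r /or3P[] // /andP[/eqP E1 /eqP E2]; subst s t;
by move: H; rewrite /= in sp tp; rewrite sp tp.
Qed.

Lemma edge_refine g h p : r' g h -> ~~ r g h -> path r' h p -> uniq (g :: h :: p) ->
  exists a' b', [/\ [:: a'; b'] = [:: a; b] \/ [:: a'; b'] = [:: b; a], [/\ r g a', r a' b' & r b' h],
    path r h p & (x \in g :: h :: p) && (y \in g :: h :: p)].
Proof.
move=> r'gh nr pp up; have /or3P[/(negP nr) //||] := r'r r'gh.
  move=> /andP[/eqP E1 /eqP E2]; subst g h; exists a, b; rewrite rxa rab rby !inE !eqxx !orbT.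
  split=> //; first by left.
  by apply: path_notin_refine pp; move: up; rewrite /= => /andP[->].
move=> /andP[/eqP E1 /eqP E2]; subst g h; exists b, a; rewrite (rsym y b) (rsym b a) (rsym a x) rxa rab rby !inE !eqxx !orbT.
split=> //; first by right.
by apply: path_notin_refine pp; move: up; rewrite /= => /andP[-> _]; rewrite orbT.
Qed.

(** A simple path uses the edge [xy] at most once; replacing it by the detour through [a] and [b]
    adds two inner vertices and keeps the parity. *)
Lemma path_refine s g v : path r' g (rcons s v) -> uniq (g :: rcons s v) ->
  exists s', [/\ path r g (rcons s' v), uniq (g :: rcons s' v),
    {subset s' <= [:: a, b & s]}, odd (size s') = odd (size s)
    & (x \notin g :: rcons s v) || (y \notin g :: rcons s v) -> s' = s].
Proof.
have notab q p t : path r' q p -> t \in q :: p -> 0 < size p -> t \notin [:: a; b].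
  elim: p q => // z [|w p] IH q /= /andP[/r'ab /andP[qn zn] pp].
    by rewrite (in_cons q) => /orP[/eqP -> //|]; rewrite mem_seq1 => /eqP ->.
  by rewrite (in_cons q) => /orP[/eqP -> //|tp] _; apply: (IH z).
elim: s g => [|h s IH] g.
  move=> pp up; have /andP[r'gv _] : r' g v && true by case/andP: pp => ->.
  have [rgv|nr] := boolP (r g v); first by exists [::]; split; rewrite //= rgv.
  have [//|a' [b' [E [r1 r2 r3] _ /andP[xin yin]]]] := edge_refine r'gv nr _ up.
  exists [:: a'; b']; split=> //=; first by rewrite r1 r2 r3.
  - have /andP[gn vn] := r'ab r'gv; move: up gn vn; rewrite /= !inE !negb_or !andbT.
    move=> -> /andP[ga gb] /andP[va vb]; have ba : b != a by rewrite eq_sym.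
    by case: E => -[-> ->]; rewrite ga gb ?ab ?ba (eq_sym a v) (eq_sym b v) va vb.
  - by move=> t; rewrite !inE; case: E => -[-> ->] /orP[] ->; rewrite ?orbT.
  - by move: xin yin; rewrite /= => -> ->.
move=> pp up; have [r'gh pp' up'] : [/\ r' g h, path r' h (rcons s v) & uniq (h :: rcons s v)].
  by case/andP: pp; case/andP: up.
have [gn hn] : g \notin [:: a; b] /\ h \notin [:: a; b] by apply/andP/r'ab.
have [rgh|nr] := boolP (r g h).
  have [s' [ps' us' ss' os' es']] := IH h pp' up'.
  exists (h :: s'); split.
  - by rewrite /= rgh.
  - rewrite rcons_cons cons_uniq us' andbT; apply/negP => gs.
    move: up; rewrite rcons_cons cons_uniq => /andP[/negP + _]; apply.
    move: gs; rewrite !inE !mem_rcons !inE => /or3P[->|->|/ss'] //; rewrite ?orbT //.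
    by rewrite !inE orbA => /orP[gab|->]; rewrite ?orbT //; move: gn; rewrite !inE gab.
  - move=> t; rewrite inE => /orP[/eqP ->|/ss']; first by rewrite !inE eqxx !orbT.
    by rewrite !inE => /or3P[] ->; rewrite ?orbT.
  - by rewrite /= os'.
  - move=> xy; rewrite es' //; move: xy; rewrite /= !(in_cons g) !negb_or.
    by case/orP=> /andP[_ ->]; rewrite ?orbT.
have [a' [b' [E [r1 r2 r3] ph /andP[xin yin]]]] := edge_refine r'gh nr pp' up.
exists [:: a', b', h & s]; split.
- by rewrite /= r1 r2 r3.
- have anot : a \notin g :: h :: rcons s v.
    by apply/negP => /(notab _ _ _ pp) /(_ isT); rewrite inE eqxx.
  have bnot : b \notin g :: h :: rcons s v.
    by apply/negP => /(notab _ _ _ pp) /(_ isT); rewrite !inE eqxx orbT.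
  move: up anot bnot; rewrite !rcons_cons !cons_uniq.
  rewrite !(in_cons g) !(in_cons a') !(in_cons b') !negb_or => /and3P[/andP[gh ->] -> ->].
  have ba : b != a by rewrite eq_sym.
  by case: E => -[-> ->] /andP[ag ->] /andP[bg ->]; rewrite gh ?ab ?ba (eq_sym g a) (eq_sym g b) ag bg.
- by move=> t; case: E => -[-> ->]; rewrite !inE => /or4P[] ->; rewrite ?orbT.
- by rewrite /= negbK.
- by move: xin yin; rewrite /= => -> ->.
Qed.

(** At most one of the three paths contains both [x] and [y], so [a] and [b] enter a single path and
    disjointness is preserved. *)
Lemma odd_theta_refine : odd_theta r' -> odd_theta r.
Proof.
case=> u [v [s [sp su so sd]]].
have uvA : (u \in A) = (v \in A).
  by have := bip_path r'bip (sp ord0); rewrite last_rcons size_rcons /= so addbF.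
have /fin_all_exists [s' Hs'] j := path_refine (sp j) (su j).
have s'p j : path r u (rcons (s' j) v) by case: (Hs' j).
have s'u j : uniq (u :: rcons (s' j) v) by case: (Hs' j).
have nab j t : t \in s j -> t \notin [:: a; b].
  have aux l w : path r' w l -> t \in l -> t \notin [:: a; b].
    elim: l w => //= w l IH u' /andP[/r'ab /andP[_ wn] pl].
    by rewrite in_cons => /orP[/eqP -> //|]; apply: IH pl.
  by move=> tj; apply: aux (sp j) _; rewrite mem_rcons inE tj orbT.
(* x and y lie on opposite sides, hence are not both branch vertices. *)
have inner j : s' j = s j \/ (exists2 t, t \in s j & forall k, t \in u :: rcons (s k) v -> k = j) /\
    (forall k, k != j -> s' k = s k).
  have [/andP[xj yj]|] := boolP ((x \in u :: rcons (s j) v) && (y \in u :: rcons (s j) v)); last first.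
    by rewrite negb_and; left; case: (Hs' j) => _ _ _ _; apply.
  right; have [t tj txy] : exists2 t, t \in s j & (t == x) || (t == y).
    move: xj yj; rewrite !inE !mem_rcons !inE => /or3P[/eqP xu|/eqP xv|xs]; last first.
    - by move=> _; exists x; rewrite ?eqxx.
    - case/or3P=> [/eqP yu|/eqP yv|ys]; last by exists y; rewrite ?eqxx ?orbT.
        by move: xyA; rewrite xv yu uvA eqxx.
      by move: xyA; rewrite xv yv eqxx.
    case/or3P=> [/eqP yu|/eqP yv|ys]; last by exists y; rewrite ?eqxx ?orbT.
      by move: xyA; rewrite xu yu eqxx.
    by move: xyA; rewrite xu yv uvA eqxx.
  have tk k : t \in u :: rcons (s k) v -> k = j.
    rewrite inE mem_rcons inE; have := su j.
    rewrite cons_uniq mem_rcons inE rcons_uniq negb_or => /andP[/andP[_ us] /andP[vs _]].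
    case/or3P=> [/eqP tu|/eqP tv|tsk].
    - by rewrite -tu tj in us.
    - by rewrite -tv tj in vs.
    - by apply/eqP; apply: contraT; rewrite eq_sym => /sd /(_ tj); rewrite tsk.
  split; first by exists t.
  move=> k kj; case: (Hs' k) => _ _ _ _; apply; rewrite -negb_and; apply/negP => /andP[xk yk].
  by case/negP: kj; apply/eqP/tk; case/orP: txy => /eqP ->.
exists u, v, s'; split=> // [j|j k t jk tj]; first by case: (Hs' j) => _ _ _ ->.
have key l m : l != m -> s' l = s l -> t \in s' l -> t \notin s' m.
  move=> lm -> tl; apply/negP; case: (Hs' m) => _ _ sm _ _ /sm.
  by move: (nab _ _ tl) (sd _ _ _ lm tl); rewrite !inE !negb_or => /andP[/negPf -> /negPf ->] /negPf ->.
case: (inner j) => [ej|[_ /(_ k)]]; first exact: key tj.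
rewrite eq_sym => /(_ jk) ek; apply/negP => tk.
by have := key k j _ ek tk; rewrite eq_sym jk tj => /(_ isT).
Qed.
End Refine.

(** * Kempe changes of triples of involutions, and the addition of an edge *)

Section Kempe.
Variable T : finType.
Local Notation I := 'I_3.
Implicit Types (c d h : I -> T -> T) (p q i j k : I) (Z : {set T}).

(* A proper 3-edge-colouring is a triple of involutions: c i t is the other end
   of the edge of colour i at t, and t itself if there is none. *)
Definition invol c := forall i, involutive (c i).
(** On the diagonal this is the number of colours absent at [t], that is, three minus its degree. *)
Definition mult c t u : nat := \sum_i (c i t == u).
Definition supp c : rel T := fun t u => (t != u) && [exists i, c i t == u].
Definition closed c p Z := forall t, t \in Z -> c p t \in Z.

(** For involutions, a set closed under both colours is a union of Kempe chains. The target is given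
    pointwise, which avoids extensionality. *)
Inductive kempe : (I -> T -> T) -> (I -> T -> T) -> Prop :=
| kempe_swap p q Z c d of closed c p Z & closed c q Z
    & (forall i t, d i t = swap p q Z c i t) : kempe c d
| kempe_trans c d h of kempe c d & kempe d h : kempe c h.

Lemma kempe_eq c d : (forall i t, c i t = d i t) -> kempe c d.
Proof.
move=> cd; apply: (@kempe_swap ord0 ord0 set0) => [t|t|i t]; rewrite ?inE //.
by rewrite /swap inE cd.
Qed.

Lemma closed_invol c p Z t : invol c -> closed c p Z -> (c p t \in Z) = (t \in Z).
Proof. by move=> ic cz; apply/idP/idP => [/cz|/cz //]; rewrite ic. Qed.

Lemma kempe_invol c d : kempe c d -> invol c -> invol d.
Proof.
elim=> {c d} [p q Z c d cp cq E|c d h _ IH1 _ IH2] ic; last exact/IH2/IH1.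
move=> i t; rewrite !E /swap.
have cl k : (k == p) || (k == q) -> (c k t \in Z) = (t \in Z).
  by case/orP=> /eqP ->; apply: closed_invol.
case: tpermP => [->|->|/eqP ip /eqP iq]; first 2 last.
- by rewrite !if_same ic.
- by case tZ: (t \in Z); rewrite cl ?eqxx ?orbT // tZ ic.
- by case tZ: (t \in Z); rewrite cl ?eqxx ?orbT // tZ ic.
Qed.

Lemma kempe_sum c d : kempe c d -> same_sum c d.
Proof.
elim=> {c d} [p q Z c d _ _ E|c d h _ IH1 _ IH2]; last exact: same_sum_trans IH1 IH2.
by move=> t u; rewrite -(same_sum_swap p q Z); apply: eq_bigr => i _; rewrite E.
Qed.

Lemma ord3_third p q : p != q -> exists r, perm_eq (index_enum I) [:: p; q; r].
Proof.
move=> pq; have [r] : exists r, r \in ~: [set p; q].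
  by apply/set0Pn; rewrite -card_gt0 cardsCs setCK cards2 pq card_ord.
rewrite !inE negb_or => /andP[rp rq]; exists r.
apply: uniq_perm; rewrite ?index_enum_uniq //=; first by rewrite !inE negb_or pq eq_sym rp eq_sym rq.
have u3 : uniq [:: p; q; r] by rewrite /= !inE negb_or pq eq_sym rp eq_sym rq.
move=> k; rewrite mem_index_enum; apply/esym.
have /subset_cardP eq3 : #|[:: p; q; r]| = #|I| by rewrite (card_uniqP u3) card_ord.
by have /eq3 -> : [:: p; q; r] \subset I by apply/subsetP.
Qed.

Lemma sum3 p q r (F : I -> nat) : perm_eq (index_enum I) [:: p; q; r] ->
  \sum_k F k = F p + F q + F r.
Proof. by move=> pe; rewrite (perm_big _ pe) unlock /= addn0 addnA. Qed.

Lemma all3 p q r k : perm_eq (index_enum I) [:: p; q; r] -> [|| k == p, k == q | k == r].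
Proof. by move/perm_mem/(_ k); rewrite mem_index_enum !inE => <-. Qed.

Lemma uniq3 p q r : perm_eq (index_enum I) [:: p; q; r] -> [/\ p != q, p != r & q != r].
Proof.
move/perm_uniq; rewrite index_enum_uniq /= !inE negb_or andbT.
by move=> /esym /andP[/andP[-> ->] ->].
Qed.

Lemma mult_le3 c t u : mult c t u <= 3.
Proof.
apply: (@leq_trans (\sum_(i < 3) 1)); last by rewrite sum1_card card_ord.
by apply: leq_sum => i _; case: eqP.
Qed.

Lemma mult_gt0 c t u : (0 < mult c t u) = [exists i, c i t == u].
Proof.
apply/idP/existsP => [|[i /eqP E]]; last by rewrite /mult (bigD1 i) //= E eqxx.
rewrite lt0n => ne; apply/existsP; apply: contraR ne => /existsPn no.
by rewrite /mult big1 // => i _; rewrite (negPf (no i)).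
Qed.

Lemma supp_sum c d : same_sum c d -> supp c =2 supp d.
Proof. by move=> cd t u; rewrite /supp -!mult_gt0 /mult cd. Qed.

Lemma mult_sym c t u : invol c -> mult c t u = mult c u t.
Proof. by move=> ic; apply: eq_bigr => i _; rewrite (can2_eq (ic i) (ic i)) eq_sym. Qed.

(** A vertex fixed by both colours is a Kempe chain by itself, so its membership in [Z] is free. *)
Lemma swap_toggle p q Z c t0 : c p t0 = t0 -> c q t0 = t0 ->
  forall i t, swap p q [set t | (t \in Z) (+) (t == t0)] c i t = swap p q Z c i t.
Proof.
move=> cp cq i t; rewrite /swap inE; case: (eqVneq t t0) => [->|_]; last by rewrite addbF.
have E : c (tperm p q i) t0 = c i t0 by case: tpermP => [->|->|//]; rewrite cp cq.
by rewrite addbT; case: (t0 \in Z); rewrite /= E.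
Qed.

Lemma closed_toggle p Z c t0 : invol c -> closed c p Z -> c p t0 = t0 ->
  closed c p [set t | (t \in Z) (+) (t == t0)].
Proof.
move=> ic cZ cp t; rewrite !inE; case: (eqVneq t t0) => [->|nt]; first by rewrite cp eqxx.
rewrite addbF => /cZ ->; case: eqP => // E; case/eqP: nt.
by rewrite -(ic p t) E cp.
Qed.

Section Join.
Variables (w z : T).
Hypothesis wz : w != z.

Definition join i h : I -> T -> T :=
  fun k t => if k == i then (if t == w then z else if t == z then w else h k t) else h k t.

(** With both ends in [Z] the new edge is recoloured along with the rest of [Z]; with neither it
    keeps its colour. *)
Lemma join_swap p q Z h i : closed h p Z -> closed h q Z -> (w \in Z) = (z \in Z) ->
  h i w = w -> h i z = z ->
  exists j, [/\ swap p q Z h j w = w, swap p q Z h j z = z & kempe (join i h) (join j (swap p q Z h))].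
Proof.
move=> hp hq wzZ hw hz; exists (if w \in Z then tperm p q i else i); split.
- by rewrite /swap; case: (w \in Z); rewrite ?tpermK.
- by rewrite /swap -wzZ; case: (w \in Z); rewrite ?tpermK.
have cl k : closed h k Z -> closed (join i h) k Z.
  move=> hk t tZ; rewrite /join; case: ifP => _; last exact: hk.
  case: eqP => [E|_]; first by rewrite -wzZ -E.
  by case: eqP => [E|_]; [rewrite wzZ -E|apply: hk].
apply: (@kempe_swap p q Z); [exact: cl|exact: cl|move=> k t].
rewrite /join /swap.
have kE : (tperm p q k == i) = (k == tperm p q i) by rewrite (can2_eq (tpermK p q) (tpermK p q)).
case: (eqVneq t w) => [->|tw]; first by case: (w \in Z); rewrite ?kE.
case: (eqVneq t z) => [->|tz]; first by rewrite wzZ; case: (z \in Z); rewrite ?kE.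
by rewrite !if_same.
Qed.

(** The two colours meet the ends only in the new edge, so its ends form a Kempe chain. *)
Lemma join_color h i j : h i w = w -> h i z = z -> h j w = w -> h j z = z ->
  kempe (join i h) (join j h).
Proof.
move=> iw iz jw jz; have [->|ij] := eqVneq i j; first exact: kempe_eq.
have cl k : k \in [:: i; j] -> closed (join i h) k [set w; z].
  move=> kij t tin; rewrite /join; case: eqP => [_|ki].
    case: (eqVneq t w) tin => [_ _|tw]; first by rewrite !inE eqxx orbT.
    by rewrite !inE (negPf tw) => /eqP ->; rewrite eqxx eqxx.
  move: kij tin; rewrite !inE => /orP[/eqP /ki //|/eqP ->] /orP[] /eqP ->.
    by rewrite jw eqxx.
  by rewrite jz eqxx orbT.
apply: (@kempe_swap i j [set w; z]) => [||k t]; [by apply: cl; rewrite inE eqxx|by apply: cl; rewrite !inE eqxx orbT|].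
rewrite /swap /join !inE.
have kE : (tperm i j k == i) = (k == j) by rewrite (can2_eq (tpermK i j) (tpermK i j)) tpermL.
have E t0 : h i t0 = t0 -> h j t0 = t0 -> h (tperm i j k) t0 = h k t0.
  by move=> h1 h2; case: tpermP => [->|->|//]; rewrite h1 h2.
case: (eqVneq t w) => [->|tw] /=; first by rewrite kE E.
case: (eqVneq t z) => [->|tz] /=; first by rewrite kE E.
by rewrite !if_same.
Qed.

(* If one end of the new edge is fixed by both colours the Kempe set can be
   made to contain both or none of w, z; otherwise the third colour is free at
   both ends since the degrees of w and z sum up to at most four. *)
Lemma join_lift h h' : kempe h h' -> forall i, invol h -> 4 <= mult h w w + mult h z z ->
  h i w = w -> h i z = z -> exists j, [/\ h' j w = w, h' j z = z & kempe (join i h) (join j h')].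
Proof.
elim=> {h h'} [p q Z h h' hp hq E|c d h cd IH1 dh IH2] i ih mh hw hz; last first.
  have [j [dw dz K1]] := IH1 i ih mh hw hz.
  have [||||j' [h1 h2 K2]] := IH2 j => //; first exact: kempe_invol ih.
    by rewrite /mult -!(kempe_sum cd).
  by exists j'; split=> //; apply: kempe_trans K2.
have fin Z' i0 : (forall k t, swap p q Z' h k t = swap p q Z h k t) -> kempe (join i h) (join i0 h) ->
    (exists j, [/\ swap p q Z' h j w = w, swap p q Z' h j z = z & kempe (join i0 h) (join j (swap p q Z' h))]) ->
    exists j, [/\ h' j w = w, h' j z = z & kempe (join i h) (join j h')].
  move=> Z'Z K0 [j [h1 h2 K]]; exists j; rewrite !E -!Z'Z; split=> //.
  apply: kempe_trans (kempe_trans K0 K) _.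
  by apply: kempe_eq => k t; rewrite /join E Z'Z.
have [eZ|nZ] := eqVneq (w \in Z) (z \in Z).
  by apply: (fin Z i) => //; [exact: kempe_eq|exact: join_swap].
have tog t0 : h p t0 = t0 -> h q t0 = t0 -> t0 \in [:: w; z] ->
    exists j, [/\ h' j w = w, h' j z = z & kempe (join i h) (join j h')].
  move=> pt qt t0wz; apply: (fin _ i); first exact: swap_toggle pt qt.
    exact: kempe_eq.
  apply: join_swap => //; [exact: closed_toggle|exact: closed_toggle|].
  move: t0wz nZ; rewrite !inE => /orP[] /eqP ->; rewrite eqxx ?(eq_sym z) (negPf wz).
    by case: (w \in Z); case: (z \in Z).
  by case: (w \in Z); case: (z \in Z).
have dir i0 : kempe (join i h) (join i0 h) -> h i0 w = w -> h i0 z = z -> i0 != p -> i0 != q ->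
    exists j, [/\ h' j w = w, h' j z = z & kempe (join i h) (join j h')].
  move=> K i0w i0z i0p i0q; have fix0 : tperm p q i0 = i0 by rewrite tpermD // eq_sym.
  have s0 t : swap p q Z h i0 t = h i0 t by rewrite /swap fix0 if_same.
  exists i0; rewrite !E !s0; split=> //; apply: kempe_trans K _.
  have nj k : k != i0 -> join i0 h k = h k by rewrite /join => /negPf ->.
  apply: (@kempe_swap p q Z); rewrite /closed ?nj // 1?eq_sym // => k t.
  rewrite /join /swap E /swap.
  have [->|ki0] := eqVneq k i0; first by rewrite fix0 !if_same eqxx.
  case: (t \in Z) => //; last by rewrite (negPf ki0).
  by rewrite (can2_eq (tpermK p q) (tpermK p q)) fix0 (negPf ki0).
have [/andP[ip iq]|] := boolP ((i != p) && (i != q)); first by apply: (dir i) => //; exact: kempe_eq.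
rewrite negb_and !negbK => npq.
wlog ip : p q Z E hp hq nZ tog dir npq {fin} / i = p => [wl|].
  case/orP: (npq) => /eqP ip; first exact: (wl p q Z).
  have E' k t : h' k t = swap q p Z h k t by rewrite E /swap tpermC.
  apply: (wl q p Z) => // [t0 qt pt|i0 K i0w i0z i0q i0p|]; first exact: tog.
    exact: (dir i0).
  by rewrite orbC.
subst i; have [qw|qw] := eqVneq (h q w) w; first by apply: (tog w); rewrite ?inE ?eqxx.
have [qz|qz] := eqVneq (h q z) z; first by apply: (tog z); rewrite ?inE ?eqxx ?orbT.
have pq : p != q by apply: contraNneq qw => <-; rewrite hw.
have [r pqr] := ord3_third pq; have [_ pr qr] := uniq3 pqr.
(* At least four of the six places at [w] and [z] are free; colour [q] occupies one at each end, so
   colour [r] is free at both. *)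
have [rw rz] : h r w = w /\ h r z = z.
  move: mh; rewrite /mult !(sum3 _ pqr) hw hz (negPf qw) (negPf qz) !eqxx.
  by case: (eqVneq (h r w) w) => [->|_]; case: (eqVneq (h r z) z) => [->|_].
by apply: (dir r); rewrite 1?eq_sym //; exact: join_color.
Qed.

End Join.
End Kempe.

(** * Removing a light edge or the parallel edges at a pendant vertex *)

Section Reductions.
Variable T : finType.
Local Notation I := 'I_3.
Implicit Types (c d h : I -> T -> T) (p q r i j k : I) (Z : {set T}).

(** For a colouring, this is three times the number of vertices minus the degree sum; it increases
    as edges are removed and drives the induction. *)
Definition fixed c := \sum_t mult c t t.

Lemma leq_fixed c d t0 : (forall t, mult c t t <= mult d t t) -> mult c t0 t0 < mult d t0 t0 ->
  fixed c < fixed d.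
Proof.
move=> le lt; rewrite /fixed (bigD1 t0) //= [ltnRHS](bigD1 t0) //= -addSn.
by apply: leq_add => //; apply: leq_sum.
Qed.

Section Edge.
Variables (w z : T) (i : I).
Hypothesis wz : w != z.

Definition cut c : I -> T -> T := fun k t => if (k == i) && ((t == w) || (t == z)) then t else c k t.

Variable c : I -> T -> T.
Hypotheses (ic : invol c) (cw : c i w = z).

Let cz : c i z = w. Proof. by rewrite -cw ic. Qed.

Lemma join_cut k t : join w z i (cut c) k t = c k t.
Proof.
rewrite /join /cut; case: (eqVneq k i) => [->|//] /=.
case: (eqVneq t w) => [->|tw]; first by rewrite cw.
by case: (eqVneq t z) => [->|tz]; rewrite ?cz.
Qed.

Lemma cut_invol : invol (cut c).
Proof.
move=> k t; rewrite /cut; case: (eqVneq k i) => [->|_] /=; last exact: ic.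
case: (boolP ((t == w) || (t == z))) => [->//|].
rewrite negb_or => /andP[tw tz]; rewrite ifN ?ic // negb_or.
by rewrite !(can2_eq (ic i) (ic i)) cw cz tw tz.
Qed.

Lemma mult_cut t u : mult (cut c) t u + ((t == w) && (u == z)) + ((t == z) && (u == w)) =
  mult c t u + (((t == w) || (t == z)) && (t == u)).
Proof.
rewrite /mult (bigD1 i) //= [in RHS](bigD1 i) //=.
rewrite (eq_bigr (fun k => c k t == u : nat)) => [|k /negPf ki]; last by rewrite /cut ki.
move: (\sum_(k < 3 | _) _) => s; rewrite /cut eqxx /= ![u == _]eq_sym.
case: (eqVneq t w) => [->|tw] /=; first by rewrite cw (negPf wz); lia.
by case: (eqVneq t z) => [->|tz] /=; rewrite ?cz; lia.
Qed.

Lemma supp_cut : subrel (supp (cut c)) (supp c).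
Proof.
move=> t u /andP[tu /existsP [k /eqP E]]; rewrite /supp tu /=; apply/existsP; exists k.
by move: E; rewrite /cut; case: ifP => // _ E; [rewrite E eqxx in tu|apply/eqP].
Qed.

End Edge.

(** One copy of the edge is removed from both colourings; after the Kempe changes of the rest are
    lifted, its colour is adjusted by [join_color]. *)
Lemma reduce_edge c d w z : invol c -> invol d -> same_sum c d -> supp c w z ->
  2 <= mult c w w + mult c z z ->
  (forall c' d', invol c' -> invol d' -> same_sum c' d' -> fixed c < fixed c' ->
     subrel (supp c') (supp c) -> kempe c' d') -> kempe c d.
Proof.
move=> ic id cd swz deg IH; have := swz; rewrite (supp_sum cd).
case/andP: (swz) => wz /existsP [i /eqP cw] /andP[_ /existsP [j /eqP dw]].
pose c' := cut w z i c; pose d' := cut w z j d.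
have ic' : invol c' by apply: cut_invol.
have mc := mult_cut wz ic cw; have md := mult_cut wz id dw.
have zw : z != w by rewrite eq_sym.
have K : kempe c' d'.
  apply: IH => //; [exact: cut_invol|move=> t u| |exact: supp_cut].
    have := mc t u; have := md t u; rewrite /mult -(cd t u) -/c' -/d'; clear; lia.
  apply: (@leq_fixed _ _ w) => [t|].
    have := mc t t; rewrite -/c' eqxx.
    case: (eqVneq t w) => [->|tw] /=; first by rewrite (negPf wz); clear; lia.
    by case: (eqVneq t z) => [->|tz] /=; rewrite ?(negPf zw); clear; lia.
  by have := mc w w; rewrite eqxx (negPf wz) /= -/c'; clear; lia.
have fix0 k e : cut w z k e k w = w by rewrite /cut !eqxx.
have fix1 k e : cut w z k e k z = z by rewrite /cut !eqxx orbT.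
(* Removing the edge frees one more colour at each end, which turns the bound 2 into 4. *)
have [|k [hw hz Kk]] := join_lift wz K (i := i) ic' _ (fix0 i c) (fix1 i c).
  have := mc w w; have := mc z z; rewrite !eqxx (negPf wz) (negPf zw) orbT /=.
  by move: deg; rewrite -/c'; clear; lia.
apply: (@kempe_trans _ _ (join w z i c')).
  by apply: kempe_eq => k' t; rewrite join_cut.
have K2 : kempe (join w z k d') (join w z j d') := join_color hw hz (fix0 j d) (fix1 j d).
apply: kempe_trans Kk (kempe_trans K2 _).
by apply: kempe_eq => k' t; rewrite join_cut.
Qed.

Section Pendant.
Variables (a b : T).
Hypothesis ab : a != b.

Definition isolate c : I -> T -> T :=
  fun k t => if ((t == a) || (t == b)) && (c k a == b) then t else c k t.

(** Meant for [b] of degree three: after [isolate] the colours absent at [b] are exactly those of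
    the removed edges, so they can be recovered. *)
Definition glue h : I -> T -> T :=
  fun k t => if h k b == b then (if t == a then b else if t == b then a else h k t) else h k t.

Lemma mult_isolate c t u : invol c ->
  mult (isolate c) t u + ((t == a) && (u == b) || (t == b) && (u == a)) * mult c a b =
  mult c t u + (((t == a) || (t == b)) && (t == u)) * mult c a b.
Proof.
move=> ic; rewrite /mult !big_distrr /= -!big_split /=; apply: eq_bigr => k _.
rewrite /isolate; case: (eqVneq (c k a) b) => [E|_]; last by rewrite !muln0 andbF.
have E' : c k b = a by rewrite -E ic.
rewrite ![u == _]eq_sym !muln1 andbT.
case: (eqVneq t a) => [->|ta] /=; first by rewrite E (negPf ab) orbF addnC.
by case: (eqVneq t b) => [->|tb] /=; rewrite ?E' // addnC.
Qed.

Lemma isolate_invol c : invol c -> invol (isolate c).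
Proof.
move=> ic k t; rewrite /isolate; case: (eqVneq (c k a) b) => [E|_]; last by rewrite !andbF ic.
have E' : c k b = a by rewrite -E ic.
case: (boolP ((t == a) || (t == b))) => [/= ->//|]; rewrite /= negb_or => /andP[ta tb].
by rewrite ifN ?ic // andbT negb_or !(can2_eq (ic k) (ic k)) E E' ta tb.
Qed.

Lemma supp_isolate c : subrel (supp (isolate c)) (supp c).
Proof.
move=> t u /andP[tu /existsP [k /eqP E]]; rewrite /supp tu /=; apply/existsP; exists k.
by move: E; rewrite /isolate; case: ifP => // _ E; [rewrite E eqxx in tu|apply/eqP].
Qed.

(** Since [a] is isolated in [h], its membership in a Kempe set can be made to agree with that of
    [b]; the restored edges then move along with the set. *)
Lemma glue_lift h h' : kempe h h' -> invol h -> (forall k, h k a = a) -> kempe (glue h) (glue h').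
Proof.
elim=> {h h'} [p q Z h h' hp hq E|c d h cd IH1 dh IH2] ih ha; last first.
  apply: kempe_trans (IH1 ih ha) (IH2 (kempe_invol cd ih) _).
  move=> k; suff /eqP : mult d a a == 3.
    move=> d3; apply/eqP; apply: contraT => /negPf nk.
    suff : mult d a a < 3 by rewrite d3.
    apply: (@leq_ltn_trans (\sum_(i < 3 | i != k) 1)).
      by rewrite /mult (bigD1 k) //= nk; apply: leq_sum => i _; case: eqP.
    by rewrite sum1_card cardC1 card_ord.
  rewrite /mult -(kempe_sum cd a a) (eq_bigr (fun=> 1)) ?sum1_card ?card_ord // => i _.
  by rewrite ha eqxx.
wlog aZ : Z hp hq E / (a \in Z) = (b \in Z) => [wl|].
  have [//|nZ] := eqVneq (a \in Z) (b \in Z); first exact: (wl Z).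
  apply: (wl [set t | (t \in Z) (+) (t == a)]); [exact: closed_toggle|exact: closed_toggle| |].
    by move=> i t; rewrite swap_toggle.
  rewrite !inE eqxx (eq_sym b) (negPf ab) addbF addbT; move: nZ.
  by case: (a \in Z); case: (b \in Z).
have cl k : closed h k Z -> closed (glue h) k Z.
  move=> hk t tZ; rewrite /glue; case: ifP => _; last exact: hk.
  case: (eqVneq t a) => [ta|_]; first by rewrite -aZ -ta.
  by case: (eqVneq t b) => [tb|_]; [rewrite aZ -tb|apply: hk].
apply: (@kempe_swap _ p q Z); [exact: cl|exact: cl|move=> k t].
rewrite /glue !E /swap; case: (eqVneq t a) => [->|ta]; first by rewrite aZ.
by case: (eqVneq t b) => [->//|tb]; rewrite !if_same.
Qed.

(** All edges at [a] lead to [b], where all three colours occur, so the colouring is determined by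
    its restriction to the other edges. *)
Lemma reduce_pendant c d : invol c -> invol d -> same_sum c d ->
  0 < mult c a b -> mult c b b = 0 -> mult c a b + mult c a a = 3 ->
  (forall c' d', invol c' -> invol d' -> same_sum c' d' -> fixed c < fixed c' ->
     subrel (supp c') (supp c) -> kempe c' d') -> kempe c d.
Proof.
move=> ic id cd cab cbb caa IH.
have ba : b != a by rewrite eq_sym.
have only e k : mult e a b + mult e a a = 3 -> (e k a == b) || (e k a == a).
  move=> e3; apply: contraT; rewrite negb_or => /andP[/negPf k1 /negPf k2].
  suff : mult e a b + mult e a a < 3 by rewrite e3.
  apply: (@leq_ltn_trans (\sum_(i < 3 | i != k) 1)); last by rewrite sum1_card cardC1 card_ord.
  rewrite /mult -big_split (bigD1 k) //= k1 k2; apply: leq_sum => i _.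
  by case: (eqVneq (e i a) b) => [->|_]; rewrite ?(negPf ba) //; case: eqP.
have isoa e k : mult e a b + mult e a a = 3 -> isolate e k a = a.
  by move=> /(only _ k); rewrite /isolate eqxx /=; case: eqP => //= _ /eqP.
have glueE e k t : invol e -> mult e b b = 0 -> mult e a b + mult e a a = 3 -> glue (isolate e) k t = e k t.
  move=> ie ebb e3; rewrite /glue /isolate eqxx orbT /=.
  case: (eqVneq (e k a) b) => [E|nb].
    have E' : e k b = a by rewrite -E ie.
    rewrite eqxx andbT; case: (eqVneq t a) => [->|ta]; first by rewrite E.
    by case: (eqVneq t b) => [->|tb]; rewrite ?E'.
  rewrite !andbF ifN //; apply/negP => ekb.
  by have := mult_gt0 e b b; rewrite ebb; move/esym/existsP; case; exists k.
have K : kempe (isolate c) (isolate d).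
  apply: IH; [exact: isolate_invol|exact: isolate_invol|move=> t u| |exact: supp_isolate].
    have := mult_isolate t u ic; have := mult_isolate t u id.
    by rewrite /mult -(cd t u) -(cd a b); clear; lia.
  apply: (@leq_fixed _ _ b) => [t|].
    have := mult_isolate t t ic; rewrite !eqxx.
    case: (eqVneq t a) => [->|ta] /=; first by rewrite (negPf ab) /=; clear; lia.
    by case: (eqVneq t b) => [->|tb] /=; clear; lia.
  by have := mult_isolate b b ic; rewrite !eqxx (negPf ba) orbT cbb /=; move: cab; clear; lia.
have d3 : mult d a b + mult d a a = 3 by rewrite /mult -(cd a b) -(cd a a).
have dbb : mult d b b = 0 by rewrite /mult -(cd b b).
apply: (@kempe_trans _ _ (glue (isolate c))); first by apply: kempe_eq => k t; rewrite glueE.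
apply: (@kempe_trans _ _ (glue (isolate d))); last by apply: kempe_eq => k t; rewrite glueE.
by apply: glue_lift => //; [exact: isolate_invol|move=> k; exact: isoa].
Qed.

End Pendant.
End Reductions.

(** * Contracting a double edge *)

Section Contraction.
Variable T : finType.
Local Notation I := 'I_3.
Implicit Types (c d h : I -> T -> T) (p q r i j k : I) (Z : {set T}).

Section Fuse.
Variables (a b x y : T).
Hypothesis abxy : uniq [:: a; b; x; y].

(* A path x - a = b - y whose middle edge is double becomes the edge xy. *)
Definition contract c : I -> T -> T :=
  fun k t => if (t == a) || (t == b) then t
    else if c k t == a then c k b else if c k t == b then c k a else c k t.

Definition fuse r h : I -> T -> T :=
  fun k t => if t == a then (if k == r then x else b)
    else if t == b then (if k == r then y else a)
    else if (k == r) && (t == x) then a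
    else if (k == r) && (t == y) then b else h k t.

(** The surroundings of a double edge with both ends of degree three: [r] is the colour leaving it,
    towards [x] and [y]. *)
Definition necklace r c := [/\ invol c, c r a = x, c r b = y & forall k, k != r -> c k a = b].

Let neqs : [/\ [/\ a != b, a != x & a != y], [/\ b != x, b != y & x != y],
  [/\ b != a, x != a & y != a] & [/\ x != b, y != b & y != x]].
Proof.
move: abxy; rewrite /= !inE !negb_or -!andbA andbT => /and5P[-> -> -> -> /andP[-> xy]].
by rewrite xy; split; split=> //; rewrite eq_sym //; move: abxy;
   rewrite /= !inE !negb_or -!andbA andbT => /and5P[? ? ? ? /andP[? ?]].
Qed.

Lemma contractE r c k t : necklace r c -> t != a -> t != b ->
  contract c k t = if (k == r) && (t == x) then y else if (k == r) && (t == y) then x else c k t.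
Proof.
case=> ic ca cb ck ta tb; have [[ab ax ay] [bx by_ xy] [ba xa ya] [xb yb yx]] := neqs.
have cx : c r x = a by rewrite -ca ic.
have cy : c r y = b by rewrite -cb ic.
rewrite /contract (negPf ta) (negPf tb) /=.
have [->|kr] /= := eqVneq k r.
  case: (eqVneq t x) => [->|tx]; first by rewrite cx eqxx cb.
  case: (eqVneq t y) => [->|ty]; first by rewrite cy (negPf ba) eqxx ca.
  by rewrite !(can2_eq (ic r) (ic r)) ca cb (negPf tx) (negPf ty).
have ca' := ck _ kr; have cb' : c k b = a by rewrite -ca' ic.
by rewrite !(can2_eq (ic k) (ic k)) ca' cb' (negPf ta) (negPf tb).
Qed.

Lemma contract_a c k : contract c k a = a. Proof. by rewrite /contract eqxx. Qed.
Lemma contract_b c k : contract c k b = b. Proof. by rewrite /contract eqxx orbT. Qed.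

Lemma contract_x r c : necklace r c -> contract c r x = y.
Proof.
by move=> nc; have [[ab ax ay] [bx by_ xy] [ba xa ya] [xb yb yx]] := neqs; rewrite (contractE r nc) // !eqxx.
Qed.

Lemma contract_invol r c : necklace r c -> invol (contract c).
Proof.
move=> nc k t; have [ic ca cb ck] := nc; have [[ab ax ay] [bx by_ xy] [ba xa ya] [xb yb yx]] := neqs.
case: (eqVneq t a) => [->|ta]; first by rewrite !contract_a.
case: (eqVneq t b) => [->|tb]; first by rewrite !contract_b.
rewrite (contractE k nc ta tb); have [->|kr] /= := eqVneq k r.
  case: (eqVneq t x) => [->|tx]; first by rewrite (contractE r nc) // eqxx (negPf yx) eqxx.
  case: (eqVneq t y) => [->|ty]; first by rewrite (contractE r nc) // !eqxx.
  have E u v : c r u = v -> t != u -> c r t != v.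
    by move=> <- tu; rewrite (inj_eq (can_inj (ic r))).
  have [na nb] : c r t != a /\ c r t != b.
    by split; [apply: (E x _ _ tx); rewrite -ca ic|apply: (E y _ _ ty); rewrite -cb ic].
  by rewrite (contractE r nc na nb) eqxx (negPf (E a x ca ta)) (negPf (E b y cb tb)) /= ic.
have ca' := ck _ kr; have cb' : c k b = a by rewrite -ca' ic.
rewrite (contractE k nc) ?(negPf kr) ?ic //.
  by rewrite -cb' (inj_eq (can_inj (ic k))).
by rewrite -ca' (inj_eq (can_inj (ic k))).
Qed.

Lemma mult_contract r c t u : necklace r c -> t != a -> t != b ->
  mult (contract c) t u + ((t == x) && (u == a)) + ((t == y) && (u == b)) =
  mult c t u + ((t == x) && (u == y)) + ((t == y) && (u == x)).
Proof.
move=> nc ta tb; have [ic ca cb ck] := nc.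
have [[ab ax ay] [bx by_ xy] [ba xa ya] [xb yb yx]] := neqs.
have cx : c r x = a by rewrite -ca ic.
have cy : c r y = b by rewrite -cb ic.
rewrite /mult (bigD1 r) //= [in RHS](bigD1 r) //= (contractE r nc) // eqxx /=.
rewrite (eq_bigr (fun k => c k t == u : nat)) => [|k /negPf kr]; last by rewrite (contractE k nc) // kr.
move: (\sum_(k < 3 | _) _) => s; rewrite ![u == _]eq_sym.
case: (eqVneq t x) => [->|tx] /=; first by rewrite cx (negPf xy); clear; lia.
by case: (eqVneq t y) => [->|ty] /=; rewrite ?cy; clear; lia.
Qed.

Lemma fuse_contract r c k t : necklace r c -> fuse r (contract c) k t = c k t.
Proof.
move=> nc; have [ic ca cb ck] := nc.
have [[ab ax ay] [bx by_ xy] [ba xa ya] [xb yb yx]] := neqs.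
have cx : c r x = a by rewrite -ca ic.
have cy : c r y = b by rewrite -cb ic.
rewrite /fuse; case: (eqVneq t a) => [->|ta]; first by case: (eqVneq k r) => [->|/ck ->].
case: (eqVneq t b) => [->|tb]; first by case: (eqVneq k r) => [->|/ck <-]; rewrite ?ic.
rewrite (contractE k nc) //; case: (eqVneq k r) => [->|] //=.
case: (eqVneq t x) => [->|tx] //; case: (eqVneq t y) => [->|ty] //.
Qed.

Lemma supp_contract r c s t : necklace r c -> supp (contract c) s t ->
  [|| supp c s t, (s == x) && (t == y) | (s == y) && (t == x)].
Proof.
move=> nc /andP[st /existsP[k /eqP E]].
have sa : s != a by apply: contraNneq st => sa; rewrite -E sa contract_a.
have sb : s != b by apply: contraNneq st => sb; rewrite -E sb contract_b.
move: E; rewrite (contractE k nc sa sb); case: ifP => [/andP[_ sx] yt|_]; first by rewrite sx -yt eqxx orbT.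
case: ifP => [/andP[_ sy] xt|_ E]; first by rewrite sy -xt eqxx !orbT.
by rewrite /supp st /=; apply/orP; left; apply/existsP; exists k; apply/eqP.
Qed.

Lemma supp_contract_notin r c s t : necklace r c -> supp (contract c) s t ->
  (s \notin [:: a; b]) && (t \notin [:: a; b]).
Proof.
move=> nc /andP[st /existsP[k /eqP E]]; have ik := contract_invol nc.
have sa : s != a by apply: contraNneq st => sa; rewrite -E sa contract_a.
have sb : s != b by apply: contraNneq st => sb; rewrite -E sb contract_b.
have Et : contract c k t = s by rewrite -E ik.
have ta : t != a by apply: contraNneq sa => ta; rewrite -Et ta contract_a.
have tb : t != b by apply: contraNneq sb => tb; rewrite -Et tb contract_b.
by rewrite !inE !negb_or sa sb ta tb.
Qed.

(** If both colours join [x] and [y], the four vertices are closed under both after fusing, and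
    exchanging the colours there moves the subdivision to the other parallel edge. *)
Lemma fuse_color h r r' : h r x = y -> h r y = x -> h r' x = y -> h r' y = x ->
  kempe (fuse r h) (fuse r' h).
Proof.
move=> rx ry r'x r'y; have [->|rr'] := eqVneq r r'; first exact: kempe_eq.
have [[ab ax ay] [bx by_ xy] [ba xa ya] [xb yb yx]] := neqs.
pose Z := [set a; b; x; y].
have inZ t : (t \in Z) = [|| t == a, t == b, t == x | t == y] by rewrite !inE !orbA.
have kE k : (tperm r r' k == r) = (k == r').
  by rewrite (can2_eq (tpermK r r') (tpermK r r')) tpermL.
have E k t : h r t = h r' t -> h (tperm r r' k) t = h k t.
  by move=> e; case: tpermP => [->|->|//].
apply: (@kempe_swap _ r r' Z) => [t|t|k t].
- rewrite !inZ /fuse !eqxx /= => /or4P[] /eqP ->; rewrite ?(negPf ba) ?(negPf xa) ?(negPf xb) ?(negPf ya) ?(negPf yb) ?(negPf yx) !eqxx ?orbT //.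
- rewrite !inZ /fuse (eq_sym r') (negPf rr') /= => /or4P[] /eqP ->;
    by rewrite ?(negPf ba) ?(negPf xa) ?(negPf xb) ?(negPf ya) ?(negPf yb) ?r'x ?r'y !eqxx ?orbT.
rewrite /swap; case: ifP; rewrite inZ; last first.
  by move/negbT; rewrite !negb_or => /and4P[/negPf ta /negPf tb /negPf tx /negPf ty];
     rewrite /fuse ta tb tx ty !andbF.
rewrite /fuse kE => /or4P[] /eqP ->.
- by rewrite eqxx.
- by rewrite (negPf ba) eqxx.
- by rewrite (negPf xa) (negPf xb) eqxx (negPf xy) !andbT !andbF E // rx r'x.
- by rewrite (negPf ya) (negPf yb) eqxx (negPf yx) !andbT !andbF E // ry r'y.
Qed.

Lemma fuse_lift h h' : kempe h h' -> forall r, invol h -> (forall k, h k a = a) ->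
  (forall k, h k b = b) -> h r x = y -> exists r', h' r' x = y /\ kempe (fuse r h) (fuse r' h').
Proof.
have [[ab ax ay] [bx by_ xy] [ba xa ya] [xb yb yx]] := neqs.
elim=> {h h'} [p q Z h h' hp hq E|c d h cd IH1 dh IH2] r ih ha hb hx; last first.
  have [r1 [dx K1]] := IH1 r ih ha hb hx.
  have fixd t : (forall k, c k t = t) -> forall k, d k t = t.
    move=> ct k; apply/eqP; apply: contraT => nk.
    have : 0 < mult d t (d k t) by rewrite mult_gt0; apply/existsP; exists k.
    rewrite /mult -(kempe_sum cd) big1 // => i _.
    by rewrite ct eq_sym (negPf nk).
  have [r2 [hx2 K2]] := IH2 r1 (kempe_invol cd ih) (fixd _ ha) (fixd _ hb) dx.
  by exists r2; split=> //; apply: kempe_trans K2.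
pose rpq := (r == p) || (r == q).
(* The isolated [a] and [b] join the Kempe set exactly when it recolours the edge [xy], whose two
   ends are then both in it. *)
pose Z' := [set t | if (t == a) || (t == b) then (x \in Z) && rpq else t \in Z].
have hy : h r y = x by rewrite -hx ih.
have xyZ : rpq -> (x \in Z) = (y \in Z).
  by rewrite -hx => /orP[] /eqP ->; rewrite closed_invol.
have xZ' : (x \in Z') = (x \in Z) by rewrite inE (negPf xa) (negPf xb).
have yZ' : (y \in Z') = (y \in Z) by rewrite inE (negPf ya) (negPf yb).
have aZ' : (a \in Z') = (x \in Z) && rpq by rewrite inE eqxx.
have bZ' : (b \in Z') = (x \in Z) && rpq by rewrite inE eqxx orbT.
have tZ' t : t != a -> t != b -> (t \in Z') = (t \in Z) by rewrite inE => /negPf -> /negPf ->.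
have cl k : (k == p) || (k == q) -> closed h k Z -> closed (fuse r h) k Z'.
  move=> kpq hk t; rewrite /fuse; have [->|ta] := eqVneq t a.
    rewrite aZ'; have [_ /andP[xZ _]|kr] := eqVneq k r; first by rewrite xZ'.
    by rewrite bZ'.
  have [->|tb] := eqVneq t b.
    rewrite bZ'; have [_ /andP[xZ rp]|kr] := eqVneq k r; first by rewrite yZ' -xyZ.
    by rewrite aZ'.
  rewrite tZ' // => tZ; case: ifP => [/andP[/eqP kr /eqP tx]|_].
    by rewrite aZ' -tx tZ /rpq -kr.
  case: ifP => [/andP[/eqP kr /eqP ty]|_].
    by have rp : rpq by [rewrite /rpq -kr]; rewrite bZ' xyZ // -ty tZ.
  rewrite tZ' ?hk //; first by rewrite -(ha k) (inj_eq (can_inj (ih k))).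
  by rewrite -(hb k) (inj_eq (can_inj (ih k))).
pose r' := if x \in Z then tperm p q r else r.
have fixr : rpq = false -> tperm p q r = r.
  by move/negbT; rewrite negb_or => /andP[rp rq]; rewrite tpermD // eq_sym.
have key t k : t \in [:: a; b; x; y] -> ((if t \in Z' then tperm p q k else k) == r) = (k == r').
  move=> tin; have H (e : bool) : (rpq -> e = (x \in Z)) -> ((if e then tperm p q k else k) == r) = (k == r').
    rewrite /r'; case rp : rpq => H; last first.
      rewrite (fixr rp) if_same; case: e {H} => //.
      by rewrite (can2_eq (tpermK p q) (tpermK p q)) fixr.
    by rewrite H //; case: (x \in Z); rewrite // (can2_eq (tpermK p q) (tpermK p q)).
  apply: H => rp; move: tin; rewrite !in_cons in_nil orbF => /or4P[] /eqP ->; rewrite ?aZ' ?bZ' ?rp ?andbT ?xZ' ?yZ' //.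
  by rewrite xyZ.
exists r'; split.
  rewrite E /swap /r'; case: (x \in Z); rewrite ?tpermK //.
apply: (@kempe_swap _ p q Z'); [by apply: cl; rewrite ?eqxx|by apply: cl; rewrite ?eqxx ?orbT|move=> k t].
rewrite [RHS]/swap /fuse.
have [ka kb kx ky] : [/\ a \in [:: a; b; x; y], b \in [:: a; b; x; y], x \in [:: a; b; x; y]
    & y \in [:: a; b; x; y]] by rewrite !inE !eqxx !orbT.
have [->|ta] := eqVneq t a; first by rewrite key.
have [->|tb] := eqVneq t b; first by rewrite key.
have [->|tx] := eqVneq t x; first by rewrite key // (negPf xy) !andbF E /swap xZ'.
have [->|ty] := eqVneq t y; first by rewrite key // !andbF E /swap yZ'.
by rewrite !andbF E /swap tZ'.
Qed.

End Fuse.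

Lemma necklace_of_mult (A : {set T}) c a b : a != b -> invol c -> mult c a b = 2 -> mult c a a = 0 ->
  mult c b b = 0 -> (forall t u, supp c t u -> (t \in A) != (u \in A)) ->
  exists x y r, necklace a b x y r c /\ uniq [:: a; b; x; y].
Proof.
move=> ab ic mab maa mbb bip.
have [r /negPf rab] : exists r, c r a != b.
  apply/existsP; apply: contraT => /existsPn nor; suff : mult c a b = 3 by rewrite mab.
  rewrite /mult (eq_bigr (fun=> 1)) ?sum1_card ?card_ord // => i _.
  by have := nor i; rewrite negbK => ->.
have others k : k != r -> c k a = b.
  move=> kr; apply/eqP; apply: contraT => /negPf nk.
  have [s krs] := ord3_third kr; move: mab; rewrite /mult (sum3 _ krs) rab nk.
  by case: (_ == _).
have no_fix k t : mult c t t = 0 -> c k t != t.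
  move=> mt; apply/eqP => E; have := mult_gt0 c t t; rewrite mt => /esym /existsP; case.
  by exists k; apply/eqP.
have ax : a != c r a by rewrite eq_sym no_fix.
have by_ : b != c r b by rewrite eq_sym no_fix.
have ay : a != c r b by apply: contraFneq rab => ->; rewrite ic.
have xy : c r a != c r b by rewrite (inj_eq (can_inj (ic r))).
exists (c r a), (c r b), r; split; first by split.
by rewrite /= !inE !negb_or ab ax ay by_ xy eq_sym rab.
Qed.

(** The neighbours of [a] and [b] can be read off from the multiplicities, which both colourings
    share. *)
Lemma necklace_ends a b x y x' y' r r' c d : necklace a b x y r c -> necklace a b x' y' r' d ->
  uniq [:: a; b; x'; y'] -> same_sum c d -> x' = x /\ y' = y.
Proof.
move=> [ic cx cy cn] [_ dx dy _] u4 cd.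
have ends t u : d r' t = u -> exists k, c k t = u.
  move=> E; suff /existsP [k /eqP ck] : [exists k, c k t == u] by exists k.
  by rewrite -mult_gt0 /mult cd; have := mult_gt0 d t u; rewrite /mult => ->; apply/existsP; exists r'; rewrite E.
have [[k kx] [l ly]] := (ends _ _ dx, ends _ _ dy).
move: u4; rewrite /= !inE !negb_or => /and4P[/and3P[_ _ ay] /andP[bx _] _ _]; split.
  have [E|/cn E] := eqVneq k r; first by rewrite -kx E cx.
  by move: bx; rewrite -kx E eqxx.
have [E|/cn E] := eqVneq l r; first by rewrite -ly E cy.
by move: ay; rewrite -ly -E ic eqxx.
Qed.

Lemma necklace_supp a b x y r c : uniq [:: a; b; x; y] -> necklace a b x y r c ->
  [/\ supp c x a, supp c a b & supp c b y].
Proof.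
rewrite /= !inE !negb_or => /and4P[/and3P[ab ax ay] /andP[bx by_] xy _] [ic cx cy cn].
have [k kr] : exists k, k != r.
  by exists (if r == ord0 then ord_max else ord0); case: (eqVneq r ord0) => [->//|]; rewrite eq_sym.
split; apply/andP; split; rewrite // 1?eq_sym //; apply/existsP.
- by exists r; rewrite -cx ic.
- by exists k; rewrite cn.
- by exists r; rewrite cy.
Qed.

Lemma necklace_bip (A : {set T}) a b x y r c : uniq [:: a; b; x; y] -> necklace a b x y r c ->
  (forall t u, supp c t u -> (t \in A) != (u \in A)) -> (x \in A) != (y \in A).
Proof.
move=> u4 nc bip; have [/bip + /bip + /bip] := necklace_supp u4 nc.
by case: (x \in A); case: (y \in A); case: (a \in A); case: (b \in A).
Qed.

Lemma sum_mult c t : \sum_u mult c t u = 3.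
Proof.
rewrite exchange_big /= (eq_bigr (fun=> 1)) ?sum1_card ?card_ord // => i _.
by rewrite (bigD1 (c i t)) //= eqxx big1 // => u; rewrite eq_sym => /negPf ->.
Qed.

Lemma mult_pair c t u : t != u -> mult c t t + mult c t u <= 3.
Proof.
by move=> tu; rewrite -(sum_mult c t) (bigD1 t) //= leq_add2l (bigD1 u) 1?eq_sym //= leq_addr.
Qed.

(* By Lemma mindeg_theta a coloured graph to which none of the three
   reductions applies contains an odd theta. *)
Lemma kempe_of_no_theta (A : {set T}) c d : invol c -> invol d -> same_sum c d ->
  (forall t u, supp c t u -> (t \in A) != (u \in A)) -> ~ odd_theta (supp c) -> kempe c d.
Proof.
have fixed_le (e : I -> T -> T) : fixed e <= 3 * #|T|.
  apply: (@leq_trans (\sum_(t : T) 3)); last by rewrite sum_nat_const mulnC.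
  by apply: leq_sum => t _; apply: mult_le3.
have [n] := ubnP (3 * #|T| - fixed c).
elim: n c d => // n IH c d; rewrite ltnS => lt ic id cd bip noth.
have IH' c' d' : invol c' -> invol d' -> same_sum c' d' -> fixed c < fixed c' ->
    (forall t u, supp c' t u -> (t \in A) != (u \in A)) -> ~ odd_theta (supp c') -> kempe c' d'.
  move=> ic' id' cd' ltf; apply: IH => //.
  by move: lt ltf (fixed_le c'); clear; lia.
have IHs c' d' : invol c' -> invol d' -> same_sum c' d' -> fixed c < fixed c' ->
    subrel (supp c') (supp c) -> kempe c' d'.
  move=> ic' id' cd' ltf sub; apply: IH' => // [t u /sub /bip //|].
  by move/(odd_theta_sub sub).
have ssym : symmetric (supp c).
  move=> t u; rewrite /supp eq_sym; congr (_ && _); apply: eq_existsb => i.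
  by rewrite (can2_eq (ic i) (ic i)) eq_sym.
have [/existsP [w /existsP [z /andP[swz deg]]]|nolow] :=
  boolP [exists w, exists z, supp c w z && (1 < mult c w w + mult c z z)].
  exact: reduce_edge swz deg IHs.
(* From here on the ends of every edge miss at most one colour together: their degrees sum up to at
   least five. *)
have {}nolow w z : supp c w z -> mult c w w + mult c z z <= 1.
  move=> s; rewrite leqNgt; apply: contra nolow => m; apply/existsP; exists w.
  by apply/existsP; exists z; rewrite s.
have [/existsP [a /existsP [b /andP[ab mab]]]|nodbl] :=
  boolP [exists a, exists b, (a != b) && (1 < mult c a b)].
  have sab : supp c a b.
    by rewrite /supp ab -mult_gt0 ltnW.
  have low := nolow _ _ sab.
  have [aab bba] : mult c a a + mult c a b <= 3 /\ mult c b b + mult c b a <= 3.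
    by split; [apply: mult_pair|apply: mult_pair; rewrite eq_sym].
  have mba := mult_sym a b ic.
  have [pend|npend] := boolP ((mult c b b == 0) && (mult c a b + mult c a a == 3)).
    case/andP: pend => /eqP bb0 /eqP ab3.
    by apply: (reduce_pendant ab ic id cd) => //; exact: ltnW.
  have [pend|npend'] := boolP ((mult c a a == 0) && (mult c b a + mult c b b == 3)).
    case/andP: pend => /eqP aa0 /eqP ba3.
    apply: (reduce_pendant (a := b) (b := a) _ ic id cd) => //; first by rewrite eq_sym.
    by rewrite -mba ltnW.
  (* A triple edge, or a double edge with a colour absent at an end, falls under the pendant case;
     both ends now have exactly one further edge. *)
  have /and3P[/eqP aa0 /eqP bb0 /eqP ab2] : [&& mult c a a == 0, mult c b b == 0 & mult c a b == 2].
    by move: npend npend' low aab bba mab; rewrite -mba; clear; lia.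
  have [x [y [r [nc u4]]]] := necklace_of_mult ab ic ab2 aa0 bb0 bip.
  have bip' t u : supp d t u -> (t \in A) != (u \in A) by rewrite -(supp_sum cd); apply: bip.
  have multd t u : mult d t u = mult c t u by rewrite /mult cd.
  have [x' [y' [r' [nd u4']]]] := necklace_of_mult ab id (etrans (multd _ _) ab2) (etrans (multd _ _) aa0)
    (etrans (multd _ _) bb0) bip'.
  have [xE yE] : x' = x /\ y' = y.
    exact: (necklace_ends nc nd u4' cd).
  subst x' y'; have [_ dx dy dn] := nd; have [_ cx cy cn] := nc.
  have Kc : kempe (contract a b c) (contract a b d).
    apply: IH'; [exact: (contract_invol u4 nc)|exact: (contract_invol u4 nd)|move=> t u| | |].
    - have [->|ta] := eqVneq t a; first by apply: eq_bigr => i _; rewrite !contract_a.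
      have [->|tb] := eqVneq t b; first by apply: eq_bigr => i _; rewrite !contract_b.
      have := mult_contract u4 u nc ta tb; have := mult_contract u4 u nd ta tb.
      by rewrite multd /mult; clear; lia.
    - have ca3 e : mult (contract a b e) a a = 3.
        by rewrite /mult (eq_bigr (fun=> 1)) ?sum1_card ?card_ord // => i _; rewrite contract_a eqxx.
      have cb3 e : mult (contract a b e) b b = 3.
        by rewrite /mult (eq_bigr (fun=> 1)) ?sum1_card ?card_ord // => i _; rewrite contract_b eqxx.
      apply: (@leq_fixed _ _ _ a) => [t|]; last by rewrite ca3 aa0.
      have [->|ta] := eqVneq t a; first by rewrite ca3 aa0.
      have [->|tb] := eqVneq t b; first by rewrite cb3 bb0.
      by have := mult_contract u4 t nc ta tb; rewrite (negPf ta) (negPf tb) !andbF; clear; lia.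
    - move=> t u /(supp_contract u4 nc) /or3P[/bip //||] /andP[/eqP -> /eqP ->].
        exact: (necklace_bip u4 nc bip).
      by rewrite eq_sym; exact: (necklace_bip u4 nc bip).
    - have [rxa rab rby] := necklace_supp u4 nc.
      move=> th; apply: noth.
      apply: (@odd_theta_refine _ (supp c) (supp (contract a b c)) A x y a b) => //.
      + by move=> s t; apply: supp_contract nc.
      + by move=> s t; apply: supp_contract_notin nc.
      + move=> t u /(supp_contract u4 nc) /or3P[/bip //||] /andP[/eqP -> /eqP ->].
          exact: (necklace_bip u4 nc bip).
        by rewrite eq_sym; exact: (necklace_bip u4 nc bip).
      + exact: (necklace_bip u4 nc bip).
  have [r2 [r2x K2]] := fuse_lift u4 Kc (contract_invol u4 nc) (contract_a a b c) (contract_b a b c) (contract_x u4 nc).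
  have id' := contract_invol u4 nd; have d'x := contract_x u4 nd.
  apply: (@kempe_trans _ _ (fuse a b x y r (contract a b c))).
    by apply: kempe_eq => k t; rewrite fuse_contract.
  (* The lifted changes leave the subdivided edge in colour [r2], whereas [d] has it in [r']; both
     colours join [x] and [y] in the contraction of [d]. *)
  apply: kempe_trans K2 (@kempe_trans _ _ (fuse a b x y r' (contract a b d)) _ _ _).
    by apply: fuse_color => //; [rewrite -r2x id'|rewrite -d'x id'].
  by apply: kempe_eq => k t; rewrite fuse_contract.
have {}nodbl a b : a != b -> mult c a b <= 1.
  move=> ab; rewrite leqNgt; apply: contra nodbl => m; apply/existsP; exists a.
  by apply/existsP; exists b; rewrite ab.
have degE t : #|[set u | supp c t u]| + mult c t t = 3.
  have := sum_mult c t.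
  rewrite (bigD1 t) //= addnC => <-; congr (_ + _).
  rewrite -sum1_card [LHS]big_mkcond [RHS]big_mkcond /=; apply: eq_bigr => u _.
  rewrite inE /supp eq_sym -mult_gt0; case: (eqVneq u t) => //= ut.
  by have := nodbl t u; rewrite eq_sym => /(_ ut); case: mult => [|[]].
have [/existsP [w /existsP [z swz]]|noedge] := boolP [exists w, exists z, supp c w z].
  (* No parallel edges remain, so degrees count neighbours; two degrees of at most three with sum at
     least five satisfy the degree conditions. *)
  case: noth; apply: (mindeg_theta ssym bip _ _ _ swz) => [t|t u|t u].
  - by have := degE t; clear; lia.
  - by move=> /nolow; have := degE t; have := degE u; clear; lia.
  - by move=> /nolow; have := degE t; have := degE u; clear; lia.
apply: kempe_eq => i t.
have nos e : invol e -> same_sum c e -> e i t = t.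
  move=> ie ce; apply/eqP; apply: contraT => ne.
  case/negP: noedge; apply/existsP; exists t; apply/existsP; exists (e i t).
  by rewrite (supp_sum ce) /supp eq_sym ne; apply/existsP; exists i.
by rewrite !nos.
Qed.
End Contraction.

(** * Matchings as involutions *)

Section Matchings.
Variables (T : finType) (G : graph T) (A : {set T}).
Hypothesis bipA : forall x y, adj G x y -> (x \in A) != (y \in A).
Implicit Types (M N : {set {set T}}) (e : {set T}).

Lemma adj_sym : symmetric (adj G).
Proof. by move=> x y; rewrite /adj /= setUC. Qed.

Lemma adj_neq x y : adj G x y -> x != y.
Proof. by move/bipA; apply: contraNneq => ->. Qed.

Lemma edgeP e : e \in edges G -> exists x y, [/\ e = [set x; y], x \in A, y \notin A & adj G x y].
Proof.
move=> eG; have /andP[_ /cards2P [x [y [_ E]]]] := forall_inP (edges_wf G) e eG.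
have xy : adj G x y by rewrite /adj /= -E.
have := bipA xy; case: (boolP (x \in A)) => xA; case: (boolP (y \in A)) => yA // _.
  by exists x, y.
by exists y, x; rewrite adj_sym; split=> //; rewrite setUC.
Qed.

Lemma matching_edge M e : matching G M -> e \in M -> e \in edges G.
Proof. by case/andP=> /subsetP sM _; apply: sM. Qed.

Lemma matching_disjoint M e e' x : matching G M -> e \in M -> e' \in M ->
  x \in e -> x \in e' -> e = e'.
Proof.
case/andP=> _ /trivIsetP tM eM e'M xe xe'; apply/eqP; apply: contraT => ee'.
by have /disjoint_setI0/setP/(_ x) := tM _ _ eM e'M ee'; rewrite !inE xe xe'.
Qed.

Lemma set2_inj (x y z : T) : [set x; y] = [set x; z] -> y = z.
Proof.
move=> E; have: y \in [set x; z] by rewrite -E !inE eqxx orbT.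
have: z \in [set x; y] by rewrite E !inE eqxx orbT.
by rewrite !inE => /orP[] /eqP -> // /orP[] /eqP ->.
Qed.

Definition mate M t : T := if [pick u | (t != u) && ([set t; u] \in M)] is Some u then u else t.

(** Only the values on [A] are read, so a permutation supported by the graph there gives a matching
    without being an involution. *)
Definition mset (f : T -> T) : {set {set T}} := [set [set t; f t] | t in [set t in A | f t != t]].

Lemma mateE M t u : matching G M -> t != u -> (mate M t == u) = ([set t; u] \in M).
Proof.
move=> mM tu; rewrite /mate; case: pickP => [v /andP[tv vM]|no]; last first.
  by rewrite (negPf tu); have := no u; rewrite tu /= => ->.
apply/eqP/idP => [<- //|uM]; apply: (@set2_inj t).
by apply: (@matching_disjoint M _ _ t mM vM uM); rewrite !inE eqxx.
Qed.

Lemma mateK M : matching G M -> involutive (mate M).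
Proof.
move=> mM t; have [E|nt] := eqVneq (mate M t) t; first by rewrite !E.
by apply/eqP; rewrite (mateE mM nt) setUC -(mateE mM) 1?eq_sym.
Qed.

Lemma mate_adj M t : matching G M -> mate M t != t -> adj G t (mate M t).
Proof.
rewrite eq_sym => mM nt; rewrite /adj /=; apply: (matching_edge mM).
by rewrite -(mateE mM nt).
Qed.

Definition supported (f : T -> T) := forall t, t \in A -> f t != t -> adj G t (f t).

Lemma supported_notin f t : supported f -> t \in A -> f t != t -> f t \notin A.
Proof. by move=> sf tA /(sf _ tA) /bipA; rewrite tA; case: (_ \in _). Qed.

Lemma mem_mset f t u : supported f -> t \in A -> u \notin A -> ([set t; u] \in mset f) = (f t == u).
Proof.
move=> sf tA uA; apply/imsetP/eqP => [[x]|fu]; last first.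
  by exists t; rewrite ?fu // inE tA fu; apply: contraNneq uA => ->.
rewrite inE => /andP[xA fx] E; have fxA := supported_notin sf xA fx.
have xt : x = t.
  have : x \in [set t; u] by rewrite E !inE eqxx.
  by rewrite !inE => /orP[/eqP //|/eqP xu]; rewrite -xu xA in uA.
by rewrite xt in E *; rewrite (set2_inj E).
Qed.

Lemma mset_matching f : injective f -> supported f -> matching G (mset f).
Proof.
move=> fi sf; apply/andP; split.
  by apply/subsetP => _ /imsetP [t /[!inE] /andP[tA ft] ->]; exact: sf.
apply/trivIsetP => _ _ /imsetP [t /[!inE] /andP[tA ft] ->] /imsetP [t' /[!inE] /andP[t'A ft'] ->] ne.
have tt' : t != t' by apply: contraNneq ne => ->.
rewrite -setI_eq0; apply/eqP/setP => z; rewrite !inE; apply/negbTE/negP.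
have fA := supported_notin sf tA ft; have fA' := supported_notin sf t'A ft'.
case/andP=> /orP[] /eqP -> /orP[]; rewrite ?(negPf tt') //.
- by apply/negP; apply: contraNneq fA' => <-.
- by apply/negP; apply: contraNneq fA => ->.
- by rewrite (inj_eq fi) (negPf tt').
Qed.

Lemma mate_supported M : matching G M -> supported (mate M).
Proof. by move=> mM t _; apply: mate_adj. Qed.

Lemma mset_mate M : matching G M -> mset (mate M) = M.
Proof.
move=> mM; have smM : matching G (mset (mate M)).
  by apply: mset_matching (mate_supported mM); apply: can_inj (mateK mM).
apply/setP => e; apply/idP/idP => eM.
  have [x [y [E xA yA xy]]] := edgeP (matching_edge smM eM); subst e.
  move: eM; rewrite mem_mset //; last exact: mate_supported.
  by rewrite mateE // adj_neq.
have [x [y [E xA yA xy]]] := edgeP (matching_edge mM eM); subst e.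
rewrite mem_mset //; last exact: mate_supported.
by rewrite mateE // adj_neq.
Qed.

Lemma eq_mset f g : f =1 g -> mset f = mset g.
Proof.
move=> fg; rewrite /mset; have -> : [set t in A | f t != t] = [set t in A | g t != t].
  by apply/setP => t; rewrite !inE fg.
by apply: eq_imset => t; rewrite fg.
Qed.

Definition edge_weight M e : nat := e \in M.

Lemma sum_edge_weight_mset (J K : Type) (s : seq J) (t : seq K) (F : J -> T -> T) (H : K -> T -> T) e :
  (forall j, supported (F j)) -> (forall k, supported (H k)) ->
  (forall j, injective (F j)) -> (forall k, injective (H k)) ->
  (forall x u, \sum_(j <- s) (F j x == u) = \sum_(k <- t) (H k x == u)) ->
  \sum_(j <- s) edge_weight (mset (F j)) e = \sum_(k <- t) edge_weight (mset (H k)) e.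
Proof.
move=> sF sH iF iH FH; have [/edgeP [x [y [-> xA yA _]]]|eG] := boolP (e \in edges G).
  transitivity (\sum_(j <- s) (F j x == y)); first by apply: eq_bigr => j _; rewrite /edge_weight mem_mset.
  by rewrite FH; apply: eq_bigr => k _; rewrite /edge_weight mem_mset.
rewrite !big1 // => j _; rewrite /edge_weight; case: (boolP (e \in _)) => // he; case/negP: eG.
  exact: matching_edge (mset_matching (iH j) (sH j)) he.
exact: matching_edge (mset_matching (iF j) (sF j)) he.
Qed.

Definition mate_perm M : {perm T} := odflt (1%g : {perm T}) (insub [ffun t => mate M t]).

Lemma mate_permE M : matching G M -> mate_perm M =1 mate M.
Proof.
move=> mM t; rewrite /mate_perm; case: insubP => [p _ pE|/negP []] /=.
  by rewrite -pvalE pE ffunE.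
by apply/injectiveP => x y; rewrite !ffunE; apply: can_inj (mateK mM) _ _.
Qed.

(* The value x itself encodes the absence of an edge at x, so its multiplicity
   is determined by the others. *)
Lemma mate_sum (s t : seq {set {set T}}) : size s = size t -> all (matching G) s -> all (matching G) t ->
  (forall e, \sum_(M <- s) edge_weight M e = \sum_(M <- t) edge_weight M e) ->
  forall x u, \sum_(M <- s) (mate M x == u) = \sum_(M <- t) (mate M x == u).
Proof.
move=> st ms mt wst x u.
have off s' : all (matching G) s' -> forall v, v != x ->
    \sum_(M <- s') (mate M x == v) = \sum_(M <- s') edge_weight M [set x; v].
  move=> /allP ms' v vx; apply: eq_big_seq => M /ms' mM; rewrite mateE //.
  by rewrite eq_sym.
have tot s' : \sum_v \sum_(M <- s') (mate M x == v) = size s'.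
  rewrite exchange_big /= (eq_bigr (fun=> 1)) ?sum1_size // => M _.
  by rewrite (bigD1 (mate M x)) //= eqxx big1 // => v; rewrite eq_sym => /negPf ->.
have [->|ux] := eqVneq u x; last by rewrite !off.
have := tot t; rewrite -st -(tot s) (bigD1 x) //= [RHS](bigD1 x) //=.
rewrite [X in _ + X = _](eq_bigr (fun v => \sum_(M <- s) (mate M x == v))); last first.
  by move=> v vx; rewrite !off.
by move/addIn.
Qed.

Lemma linked_mset (l l' : seq {perm T}) : linked (@perm_weight T) predT 3 l l' ->
  (forall p : {perm T}, p \in l -> supported p) ->
  (forall p : {perm T}, p \in l' -> supported p) /\
  linked edge_weight (matching G) 3 (map (fun p : {perm T} => mset p) l) (map (fun p : {perm T} => mset p) l').
Proof.
elim=> {l l'} [l l' ll'|x y r sx sy wxy _|l l' l2 _ IH1 _ IH2] sl.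
- split; first by move=> p; rewrite -(perm_mem ll'); apply: sl.
  by apply: linked_perm; apply: perm_map.
(* Support is inherited through the sums: a value taken at [t] by a new member is taken there by an
   old one. *)
- have sy' (p : {perm T}) : p \in y -> supported p.
    move=> py t tA pt.
    have [q qx qt] : exists2 q : {perm T}, q \in x & q t == p t.
      apply/hasP; apply: contraT => /hasPn no; have := wxy (t, p t).
      rewrite big_seq big1 => [|q /no /negPf]; last by rewrite /perm_weight /= => ->.
      by rewrite (big_rem p) //= /perm_weight /= eqxx.
    by have := sl q; rewrite mem_cat qx => /(_ isT t tA); rewrite (eqP qt); apply.
  split.
    by move=> p; rewrite mem_cat => /orP[/sy' //|pr]; apply: sl; rewrite mem_cat pr orbT.
  rewrite !map_cat; apply: linked_move; rewrite ?size_map //; last first.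
    apply/allP => _ /mapP [p py ->]; apply: mset_matching (sy' p py); exact: perm_inj.
  have sx' (p : {perm T}) : p \in x -> supported p.
    by move=> px; apply: sl; rewrite mem_cat px.
  move=> e; rewrite !big_map.
  (* Indexing by position makes support available for every index, as [sum_edge_weight_mset]
     demands. *)
  have aux (z : seq {perm T}) : (forall p : {perm T}, p \in z -> supported p) -> 
      \sum_(p <- z) edge_weight (mset p) e = \sum_(i < size z) edge_weight (mset (nth 1%g z i)) e.
    by move=> _; rewrite (big_nth 1%g) big_mkord.
  rewrite !aux //; apply: (@sum_edge_weight_mset _ _ _ _ (fun i : 'I_(size x) => nth 1%g x i)
    (fun i : 'I_(size y) => nth 1%g y i)) => [j|k|j|k|t u].
  - by apply: sx'; rewrite mem_nth.
  - by apply: sy'; rewrite mem_nth.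
  - exact: perm_inj.
  - exact: perm_inj.
  have := wxy (t, u); rewrite !(big_nth 1%g) !big_mkord; exact.
- by have [sl' K1] := IH1 sl; have [sl2 K2] := IH2 sl'; split=> //; apply: linked_trans K2.
Qed.

Lemma matchings_linked3 (s t : seq {set {set T}}) : size s = size t -> all (matching G) s -> all (matching G) t ->
  (forall e, \sum_(M <- s) edge_weight M e = \sum_(M <- t) edge_weight M e) ->
  linked edge_weight (matching G) 3 s t.
Proof.
move=> st ms mt wst.
have mK s' : all (matching G) s' -> map (fun p : {perm T} => mset p) (map mate_perm s') = s'.
  move=> /allP ms'; rewrite -map_comp -[RHS]map_id; apply/eq_in_map => M /ms' mM /=.
  by rewrite (eq_mset (mate_permE mM)) mset_mate.
rewrite -(mK s ms) -(mK t mt); apply: proj2; apply: linked_mset.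
  apply: birkhoff_linked; rewrite ?size_map // => x u; rewrite !big_map.
  have eqp s' : all (matching G) s' -> \sum_(M <- s') (mate_perm M x == u) = \sum_(M <- s') (mate M x == u).
    by move=> /allP ms'; apply: eq_big_seq => M /ms' mM; rewrite mate_permE.
  by rewrite !eqp //; apply: mate_sum.
move=> _ /mapP [M /(allP ms) mM ->] x xA; rewrite mate_permE //; exact: mate_supported.
Qed.

Lemma kempe_linked c d : kempe c d -> invol c -> (forall i, supported (c i)) ->
  (forall i, supported (d i)) /\
  linked edge_weight (matching G) 2 (codom (fun i => mset (c i))) (codom (fun i => mset (d i))).
Proof.
elim=> {c d} [p q Z c d cp cq E|c d h cd IH1 _ IH2] ic sc; last first.
  have [sd K1] := IH1 ic sc; have [sh K2] := IH2 (kempe_invol cd ic) sd.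
  by split=> //; apply: linked_trans K2.
have id : invol d by apply: kempe_invol ic; apply: kempe_swap cp cq E.
have sd i : supported (d i) by move=> t tA; rewrite E /swap; case: ifP => _; apply: sc.
split=> //; apply: (linked_codom (D := [set p; q])) => [|i|e|i].
- by rewrite cards2; case: (p != q).
- rewrite !inE negb_or => /andP[ip iq]; apply: eq_mset => t.
  by rewrite E /swap tpermD 1?eq_sym // if_same.
- apply: sum_edge_weight_mset => // [i|i|]; [exact: can_inj (ic i)|exact: can_inj (id i)|].
  by move=> x u; rewrite -(same_sum_swap p q Z c); apply: eq_bigr => i _; rewrite E.
- by apply: mset_matching (sd i); apply: can_inj (id i).
Qed.

Lemma linked_all k (s t : seq {set {set T}}) : linked edge_weight (matching G) k s t -> all (matching G) s -> all (matching G) t.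
Proof.
elim=> {s t} [s t st|x y r _ _ _ my|s t u _ IH1 _ IH2] ms; last exact/IH2/IH1.
  by rewrite -(perm_all _ st).
by move: ms; rewrite !all_cat my => /andP[].
Qed.

Lemma triple_linked2 (x y : seq {set {set T}}) : ~ odd_theta (adj G) -> size x = 3 -> size y = 3 ->
  all (matching G) x -> all (matching G) y ->
  (forall e, \sum_(M <- x) edge_weight M e = \sum_(M <- y) edge_weight M e) ->
  linked edge_weight (matching G) 2 x y.
Proof.
move=> noth sx sy mx my wxy.
pose c (z : seq {set {set T}}) (i : 'I_3) := mate (nth set0 z i).
have mz z i : size z = 3 -> all (matching G) z -> matching G (nth set0 z (i : 'I_3)).
  by move=> sz /all_nthP; apply; rewrite sz.
have cdE z : size z = 3 -> all (matching G) z -> codom (fun i => mset (c z i)) = z.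
  move=> sz az; transitivity (mkseq (nth set0 z) 3); last by rewrite -sz mkseq_nth.
  rewrite codomE /mkseq -val_enum_ord -map_comp; apply: eq_map => i /=.
  by rewrite mset_mate // mz.
have ic z : size z = 3 -> all (matching G) z -> invol (c z).
  by move=> sz az i; apply: mateK; apply: mz.
rewrite -(cdE x sx mx) -(cdE y sy my); apply: proj2; apply: kempe_linked; last 2 first.
- exact: ic.
- by move=> i; apply: mate_supported; apply: mz.
have sub t u : supp (c x) t u -> adj G t u.
  by case/andP=> tu /existsP [i /eqP E]; rewrite -E; apply: mate_adj; rewrite ?mz // -/(c x i) E eq_sym.
apply: (@kempe_of_no_theta _ A); [exact: ic|exact: ic| |by move=> t u /sub /bipA|].
  move=> t u; have := mate_sum (etrans sx (esym sy)) mx my wxy t u.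
  by rewrite !(big_nth set0) sx sy !big_mkord.
by move/(odd_theta_sub sub).
Qed.

(** The moves of the linkage in degree three are refined one at a time: those on three matchings by
    Kempe changes, while smaller ones are kept. *)
Lemma matchings_linked2 (s t : seq {set {set T}}) : ~ odd_theta (adj G) ->
  size s = size t -> all (matching G) s -> all (matching G) t ->
  (forall e, \sum_(M <- s) edge_weight M e = \sum_(M <- t) edge_weight M e) ->
  linked edge_weight (matching G) 2 s t.
Proof.
move=> noth st ms mt wst; have L := matchings_linked3 st ms mt wst.
elim: L ms => {s t st mt wst} [s t st|x y r sx sy wxy my|s t u st IH1 _ IH2] ms.
- exact: linked_perm.
- move: sx; rewrite leq_eqVlt ltnS => /orP[/eqP sx|sx]; last exact: linked_move.
  apply: linked_catr; apply: triple_linked2 => //; first by rewrite sy.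
  by move: ms; rewrite all_cat => /andP[].
- by apply: linked_trans (IH1 ms) (IH2 (linked_all st ms)).
Qed.

End Matchings.

(** * Odd subdivisions and blocks *)

Section PathEdges.
Variables (T : finType) (G : graph T).
Implicit Types (x y : T) (l : seq T).

Lemma path_edges_cons x y l : path_edges x (y :: l) = [set x; y] |: path_edges y l.
Proof. by apply/setP => e; rewrite /path_edges !inE. Qed.

Lemma path_edges_subset x l : (path_edges x l \subset edges G) = path (adj G) x l.
Proof.
elim: l x => [|y l IH] x /=; last by rewrite path_edges_cons subUset sub1set IH.
by apply/subsetP => e; rewrite /path_edges inE.
Qed.

Lemma path_edges_verts x l e : e \in path_edges x l -> e \subset x :: l.
Proof.
elim: l x => [|y l IH] x; first by rewrite /path_edges inE.
rewrite path_edges_cons 2!inE => /orP[/eqP ->|/IH /subsetP H].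
  by apply/subsetP => z; rewrite !inE => /orP[] ->; rewrite ?orbT.
by apply/subsetP => z /H zl; rewrite in_cons zl orbT.
Qed.

Lemma adj_verts x y : adj G x y -> x \in verts G /\ y \in verts G.
Proof.
move=> xy; have /andP[/subsetP s _] := forall_inP (edges_wf G) _ xy.
by split; apply: s; rewrite !inE eqxx ?orbT.
Qed.

Lemma path_verts x l y : path (adj G) x l -> y \in l -> y \in verts G.
Proof.
elim: l x => //= z l IH x /andP[/adj_verts [_ zG] pl].
by rewrite inE => /orP[/eqP -> //|]; apply: IH pl.
Qed.

End PathEdges.

Lemma subgraph_trans (T : finType) (G1 G2 G3 : graph T) : subgraph G1 G2 -> subgraph G2 G3 -> subgraph G1 G3.
Proof. by move=> [v1 e1] [v2 e2]; split; [exact: subset_trans v1 v2|exact: subset_trans e1 e2]. Qed.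

Lemma subgraph_adj (T : finType) (H G : graph T) : subgraph H G -> subrel (adj H) (adj G).
Proof. by case=> _ /subsetP s x y; apply: s. Qed.

Lemma adj_complete_bipartite m n (i : 'I_m) (j : 'I_n) :
  adj (complete_bipartite m n) (inl i) (inr j) /\ adj (complete_bipartite m n) (inr j) (inl i).
Proof.
have h : adj (complete_bipartite m n) (inl i) (inr j) by apply/imset2P; exists i j.
by split=> //; rewrite /adj /= setUC.
Qed.

Lemma complete_bipartite_adj m n (a b : 'I_m + 'I_n) : adj (complete_bipartite m n) a b ->
  match a, b with inl _, inr _ | inr _, inl _ => true | _, _ => false end.
Proof.
case/imset2P=> i j _ _ /setP E; have := E a; have := E b; have := E (inl i); have := E (inr j).
by case: a b {E} => a [b|b] //; rewrite !inE /= ?eqxx ?orbT ?orbF.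
Qed.

Section ThetaSubdivision.
Variables (T : finType) (G : graph T).

(** The branch vertices are the images of the side of size two. Two subdivided edges of odd length
    that meet at the image of a vertex of degree two form a path of even length. *)
Lemma theta_of_subdivision : has_odd_subdivision (complete_bipartite 2 3) G -> odd_theta (adj G).
Proof.
case=> H' [sub [phi [p [inj rev_p uniq_p odd_p new_p disj_p _ edges_p]]]].
set K := complete_bipartite 2 3 in inj rev_p uniq_p odd_p new_p disj_p edges_p *.
have phiI : injective phi by move=> x y; apply: inj; rewrite inE.
have pphi a b x : adj K a b -> phi x \notin p a b.
  move=> ab; apply/negP => h; have := disjointFr (new_p _ _ ab) h.
  by rewrite imset_f ?inE.
have pp a b a' b' x : adj K a b -> adj K a' b' -> [set a; b] != [set a'; b'] ->
    x \in p a b -> x \notin p a' b'.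
  move=> ab ab' ne xp; apply/negP => xp'.
  by rewrite (disjointFr (disj_p _ _ _ _ ab ab' ne) xp) in xp'.
have path_p a b : adj K a b -> path (adj G) (phi a) (rcons (p a b) (phi b)).
  move=> ab; apply: sub_path (subgraph_adj sub) _ _ _; rewrite -path_edges_subset edges_p.
  exact: (bigcup_sup (a, b)).
pose l i : 'I_2 + 'I_3 := inl i; pose w j : 'I_2 + 'I_3 := inr j.
have lw i j : adj K (l i) (w j) by case: (adj_complete_bipartite i j).
have wl i j : adj K (w j) (l i) by case: (adj_complete_bipartite i j).
pose s j := p (l ord0) (w j) ++ phi (w j) :: p (w j) (l ord_max).
have ne_set (x y z t : 'I_2 + 'I_3) : (x != z) && (x != t) || (y != z) && (y != t) -> [set x; y] != [set z; t].
  move=> h; apply/eqP => /setP E; have := E x; have := E y; rewrite !inE !eqxx orbT /=.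
  by case/orP: h => /andP[/negPf -> /negPf ->].
exists (phi (l ord0)), (phi (l ord_max)), s; split=> [j|j|j|j k x jk].
- by rewrite /s rcons_cat rcons_cons -cat_rcons cat_path last_rcons !path_p.
- rewrite cons_uniq rcons_uniq mem_rcons inE (inj_eq phiI) /= !mem_cat !inE !negb_or.
  rewrite !(inj_eq phiI) /= !pphi //= cat_uniq /= !uniq_p //= !pphi //= ?andbT.
  rewrite negb_or pphi //; apply/hasPn => x xp; apply: pp xp => //.
  by apply: ne_set; rewrite orbC.
- by rewrite /s size_cat /= oddD /=; have := odd_p _ _ (lw ord0 j); have := odd_p _ _ (wl ord_max j); rewrite /= => -> /negPf ->.
have wn i i' : [set l i; w j] != [set l i'; w k] by apply: ne_set; rewrite /= jk orbT.
have wn' i i' : [set l i; w j] != [set w k; l i'] by rewrite (setUC [set w k]).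
have wn2 i i' : [set w j; l i] != [set l i'; w k] by rewrite (setUC [set w j]).
have wn3 i i' : [set w j; l i] != [set w k; l i'] by rewrite (setUC [set w j]) wn'.
rewrite /s !mem_cat !inE !negb_or => /or3P[xp|/eqP ->|xp].
- rewrite !(pp _ _ _ _ _ _ _ _ xp) // andbT; apply: contraTneq xp => ->.
  exact: pphi.
- by rewrite !pphi // (inj_eq phiI) /= jk.
- rewrite !(pp _ _ _ _ _ _ _ _ xp) // andbT; apply: contraTneq xp => ->.
  exact: pphi.
Qed.

(* The middle vertex of each of the three paths is placed next to u. *)
Lemma subdivision_of_theta : odd_theta (adj G) -> has_odd_subdivision (complete_bipartite 2 3) G.
Proof.
case=> u [v [s [sp su so sd]]]; set K := complete_bipartite 2 3.
have sE j : s j = head u (s j) :: behead (s j) by case: (s j) (so j).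
pose phi (a : 'I_2 + 'I_3) := match a with inl i => if i == ord0 then u else v | inr j => head u (s j) end.
pose p (a b : 'I_2 + 'I_3) := match a, b with
  | inl i, inr j => if i == ord0 then [::] else rev (behead (s j))
  | inr j, inl i => if i == ord0 then [::] else behead (s j)
  | _, _ => [::] end.
have uv : u != v.
  by have := su ord0; rewrite cons_uniq mem_rcons inE negb_or => /andP[/andP[]].
have us j : u \notin s j.
  by have := su j; rewrite cons_uniq mem_rcons inE negb_or => /andP[/andP[]].
have vs j : v \notin s j.
  by have := su j; rewrite cons_uniq rcons_uniq => /andP[_ /andP[]].
have us' j : uniq (s j).
  by have := su j; rewrite cons_uniq rcons_uniq => /and3P[].
have hs j : head u (s j) \in s j by rewrite sE inE eqxx.
have bs j x : x \in behead (s j) -> x \in s j by move=> xb; rewrite sE inE xb orbT.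
have hb j : head u (s j) \notin behead (s j) by have := us' j; rewrite {1}sE => /andP[].
have adjs : symmetric (adj G) by move=> x y; rewrite /adj /= setUC.
have I2 (i : 'I_2) : (i == ord0) = false -> i = ord_max.
  by move=> /eqP i0; apply/val_inj; case: i i0 => [[|[|i]] hi] //= i0; case: i0; apply: val_inj.
have p_mem a b x : x \in p a b -> exists j, x \in behead (s j) /\ [set a; b] = [set inl ord_max; inr j].
  case: a b => [i|j] [i'|j'] //=; case: ifP => // /I2 ->; rewrite ?mem_rev => xs.
    by exists j'.
  by exists j; split=> //; rewrite setUC.
have p_path a b : adj K a b -> path (adj G) (phi a) (rcons (p a b) (phi b)).
  have p1 j : adj G u (head u (s j)) && path (adj G) (head u (s j)) (rcons (behead (s j)) v).
    by have := sp j; rewrite {1}sE.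
  move/complete_bipartite_adj; case: a b => [i|j] [i'|j'] //= _; case: ifP => _ /=.
  - by case/andP: (p1 j') => ->.
  - rewrite rev_path_rcons //; last by case/andP: (p1 j').
  - by rewrite adjs; case/andP: (p1 j) => ->.
  - by case/andP: (p1 j).
pose V := phi @: verts K :|: \bigcup_(e | adj K e.1 e.2) [set:: p e.1 e.2].
pose E := \bigcup_(e | adj K e.1 e.2) path_edges (phi e.1) (rcons (p e.1 e.2) (phi e.2)).
have EG : E \subset edges G.
  by apply/bigcupsP => e eK; rewrite path_edges_subset p_path.
have wf : [forall f in E, (f \subset V) && (#|f| == 2)].
  apply/forall_inP => f fE; have /andP[_ ->] := forall_inP (edges_wf G) f (subsetP EG f fE).
  rewrite andbT; case/bigcupP: fE => e eK /path_edges_verts /subsetP sub.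
  apply/subsetP => x /sub; rewrite inE mem_rcons inE => /or3P[/eqP ->|/eqP ->|xp].
  - by rewrite inE imset_f // inE.
  - by rewrite inE imset_f // inE.
  - by rewrite inE; apply/orP; right; apply/bigcupP; exists e; rewrite // inE.
have phi_verts a : phi a \in verts G.
  have [b ab] : exists b, adj K b a.
    case: a => [i|j]; first by exists (inr ord0); case: (adj_complete_bipartite i (ord0 : 'I_3)).
    by exists (inl ord0); case: (adj_complete_bipartite (ord0 : 'I_2) j).
  by apply: path_verts (p_path _ _ ab) _; rewrite mem_rcons inE eqxx.
exists (Graph wf); split.
  split=> //=; rewrite subUset; apply/andP; split.
    by apply/subsetP => _ /imsetP [a _ ->].
  apply/bigcupsP => e eK; apply/subsetP => x; rewrite inE => xp.
  by apply: path_verts (p_path _ _ eK) _; rewrite mem_rcons inE xp orbT.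
exists phi, p; split=> //.
- move=> a b _ _; case: a b => [i|j] [i'|k] /=.
  + case: (boolP (i == ord0)) => [/eqP ->|/negbTE/I2 ->].
      by case: ifP => [/eqP ->//|_ E']; rewrite E' eqxx in uv.
    by case: ifP => [_ E'|/I2 -> //]; rewrite E' eqxx in uv.
  + by case: ifP => _ E'; [have := us k|have := vs k]; rewrite E' hs.
  + by case: ifP => _ E'; [have := us j|have := vs j]; rewrite -E' hs.
  + have [->//|jk E'] := eqVneq j k.
    by have := sd _ _ _ jk (hs j); rewrite E' hs.
- by move=> a b; case: a b => [i|j] [i'|j'] //= _; case: ifP; rewrite ?revK.
- have um j : uniq (behead (s j)) by have := us' j; rewrite {1}sE => /andP[].
  by move=> a b _; case: a b => [i|j] [i'|j'] //=; case: ifP => // _; rewrite rev_uniq.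
- have om j : odd (size (behead (s j))).+1 by have := so j; rewrite {1}sE.
  by move=> a b _; case: a b => [i|j] [i'|j'] //=; case: ifP => // _; rewrite ?size_rev; apply: om.
- move=> a b _; rewrite disjoint_has; apply/hasPn => x /p_mem [j [xs _]].
  apply/negP => /imsetP [c _ xc].
  have xsj := bs _ _ xs; move: xc; case: c => [i|k] /=.
    by case: ifP => _ E'; move: xsj; rewrite E'; apply/negP.
  move=> E'; have [jk|jk] := eqVneq j k; first by move: xs; rewrite E' jk; apply/negP.
  by have := sd _ _ _ jk xsj; rewrite E' hs.
move=> a b a' b' ab ab' ne; rewrite disjoint_has; apply/hasPn => x /p_mem [j [xs ej]].
apply/negP => /p_mem [k [xs' ek]].
have jk : j = k by apply/eqP; apply: contraT => /sd /(_ (bs _ _ xs)); rewrite bs.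
by case/negP: ne; rewrite ej ek jk.
Qed.

End ThetaSubdivision.

(** * The subgraph formed by a theta *)

Section ThetaGraph.
Variables (T : finType) (G : graph T) (u v : T) (s : 'I_3 -> seq T).
Hypothesis th : theta_by (adj G) u v s.

Let V := u |: \bigcup_j [set:: rcons (s j) v].
Let E := \bigcup_j path_edges u (rcons (s j) v).

Fact theta_graph_wf : [forall f in E, (f \subset V) && (#|f| == 2)].
Proof.
apply/forall_inP => f /bigcupP [j _ fj].
have fG : f \in edges G.
  by move: fj; apply/subsetP; rewrite path_edges_subset; apply: theta_path th j.
have /andP[_ ->] := forall_inP (edges_wf G) f fG; rewrite andbT.
apply/subsetP => x /(subsetP (path_edges_verts fj)); rewrite inE => xs.
rewrite !inE; case/orP: xs => [->//|xs]; apply/orP; right; apply/bigcupP; exists j => //.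
by rewrite inE.
Qed.

Definition theta_graph : graph T := Graph theta_graph_wf.

Lemma theta_graph_sub : subgraph theta_graph G.
Proof.
split; last by apply/bigcupsP => j _; rewrite path_edges_subset; apply: theta_path th j.
apply/subsetP => x; rewrite !inE => /orP[/eqP ->|/bigcupP [j _]].
  have := theta_path th ord0; case: (s ord0) => [|y l] /= /andP[] /adj_verts [] //.
by rewrite inE; apply: path_verts (theta_path th j).
Qed.

Lemma theta_graph_path j : path (adj theta_graph) u (rcons (s j) v).
Proof. by rewrite -path_edges_subset; apply: (bigcup_sup j). Qed.

Lemma theta_graph_theta : odd_theta (adj theta_graph).
Proof.
exists u, v, s; split; [exact: theta_graph_path|exact: theta_uniq th|exact: theta_odd th|exact: theta_disj th].
Qed.

Lemma theta_graph_verts t : t \in verts theta_graph ->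
  t = u \/ exists j l1 l2, rcons (s j) v = l1 ++ t :: l2.
Proof.
rewrite !inE => /orP[/eqP ->|/bigcupP [j _]]; first by left.
by rewrite inE => tj; right; exists j; case/splitPr: tj => l1 l2; exists l1, l2.
Qed.

Let av (x : T) : rel T := [rel y z | [&& adj theta_graph y z, y != x & z != x]].

Lemma av_path x y l : path (adj theta_graph) y l -> x \notin y :: l -> path (av x) y l.
Proof.
move=> pl xl; apply: (@sub_in_path _ (mem (y :: l))) pl; last by apply/allP.
by move=> a b al bl ab; rewrite /av /= ab /=; apply/andP; split; [apply: contraNneq xl => <-|apply: contraNneq xl => <-].
Qed.

Lemma av_sym x : connect_sym (av x).
Proof.
apply: sym_connect_sym => y z; rewrite /av /= /adj /= setUC.
by case: (_ \in _) => //=; rewrite andbC.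
Qed.

(* The remaining vertices reach u or v along their own path, and if both u and
   v remain then so does one of the three paths between them. *)
Lemma theta_hub x : exists h, forall t, t \in verts theta_graph -> t != x -> connect (av x) h t.
Proof.
have to_u t l1 l2 j : rcons (s j) v = l1 ++ t :: l2 -> x \notin u :: l1 -> t != x -> connect (av x) u t.
  move=> e xl tx; have p1 : path (adj theta_graph) u (rcons l1 t).
    by have := theta_graph_path j; rewrite e -cat_rcons cat_path => /andP[].
  apply/connectP; exists (rcons l1 t); last by rewrite last_rcons.
  by apply: av_path => //; rewrite -rcons_cons mem_rcons inE negb_or eq_sym tx.
have to_v t l1 l2 j : rcons (s j) v = l1 ++ t :: l2 -> x \notin t :: l2 -> connect (av x) t v.
  move=> e xl; apply/connectP; exists l2.
    by apply: av_path => //; have := theta_graph_path j; rewrite e -cat_rcons cat_path last_rcons => /andP[].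
  by have := congr1 (last u) e; rewrite last_rcons last_cat.
have un j : uniq (u :: rcons (s j) v) := theta_uniq th j.
have [xu|xu] := eqVneq x u.
  exists v; move=> t /theta_graph_verts [->|[j [l1 [l2 e]]]]; first by rewrite xu eqxx.
  move=> tx; rewrite av_sym; apply: (to_v _ _ _ _ e); rewrite xu.
  by have := un j; rewrite cons_uniq e mem_cat negb_or => /andP[/andP[]].
exists u; move=> t /theta_graph_verts [->|[j [l1 [l2 e]]]] tx; first exact: connect0.
have [xv|xv] := eqVneq x v.
  apply: (to_u _ _ _ _ e _ tx); rewrite inE negb_or xu /= xv; apply/negP => vl1.
  have vl : v \in t :: l2.
    by have := congr1 (last u) e; rewrite last_rcons last_cat /= => ->; apply: mem_last.
  have := un j; rewrite cons_uniq e cat_uniq => /andP[_ /and3P[_ /hasPn h _]].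
  by have := h _ vl; rewrite /= vl1.
have uv : connect (av x) u v.
  have [j0 xj0] : exists j0, x \notin s j0.
    have [x0|] := boolP (x \in s ord0); last by exists ord0.
    by exists ord_max; apply: (theta_disj th _ x0).
  apply: (to_u v (s j0) [::] j0); rewrite ?cats1 // 1?eq_sym //.
  by rewrite inE negb_or xu.
have [xl1|xl1] := boolP (x \in l1); last by apply: (to_u _ _ _ _ e _ tx); rewrite inE negb_or xu.
apply: connect_trans uv _; rewrite av_sym; apply: (to_v _ _ _ _ e); apply/negP => xl2.
have := un j; rewrite cons_uniq e cat_uniq => /andP[_ /and3P[_ /hasPn h _]].
by have := h _ xl2; rewrite /= xl1.
Qed.

Lemma theta_graph_nonseparable : nonseparable theta_graph.
Proof.
have adjs : connect_sym (adj theta_graph).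
  by apply: sym_connect_sym => y z; rewrite /adj /= setUC.
split; first split.
- by apply/set0Pn; exists u; rewrite !inE eqxx.
- have hub t : t \in verts theta_graph -> connect (adj theta_graph) u t.
    case/theta_graph_verts => [->|[j [l1 [l2 e]]]]; first exact: connect0.
    apply/connectP; exists (rcons l1 t); last by rewrite last_rcons.
    by have := theta_graph_path j; rewrite e -cat_rcons cat_path => /andP[].
  case=> y [z [yV zV /negP]]; apply; apply: connect_trans (hub z zV).
  by rewrite adjs hub.
move=> x [_ [y [z []]]]; rewrite !in_setD1 => /andP[yx yV] /andP[zx zV] /negP; apply.
have [h hub] := theta_hub x.
have sub : subrel (connect (av x)) (connect (adj (del_vertex theta_graph x))).
  apply: connect_sub => a b /and3P[ab ax bx]; apply: connect1.
  by move: ab; rewrite /adj /= in_set => ->; rewrite !inE negb_or ![x == _]eq_sym ax bx.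
by apply: sub; apply: connect_trans (hub z zV zx); rewrite av_sym hub.
Qed.

End ThetaGraph.

(** A subgraph with as many vertices and edges is the whole graph, so each proper enlargement raises
    the sum of both numbers and the process stops. *)
Lemma block_exists (T : finType) (G H : graph T) : subgraph H G -> nonseparable H ->
  exists B, block B G /\ subgraph H B.
Proof.
pose size_ (K : graph T) := #|verts K| + #|edges K|.
have [n] := ubnP (size_ G - size_ H); elim: n H => // n IH H; rewrite ltnS => lt HG nH.
have [[K [KG nK HK nKH]]|nob] := pselect (exists K, [/\ subgraph K G, nonseparable K, subgraph H K & ~ subgraph K H]).
  have le K1 K2 : subgraph K1 K2 -> size_ K1 <= size_ K2.
    by case=> v e; apply: leq_add; apply: subset_leq_card.
  have [|B [bB KB]] := IH K _ KG nK; last by exists B; split=> //; apply: subgraph_trans KB.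
  have [vHK eHK] := HK.
  suff : size_ H < size_ K by have := le _ _ KG; move: lt; rewrite /size_; clear; lia.
  rewrite ltnNge; apply/negP => KHle; apply: nKH.
  have := subset_leq_card vHK; have := subset_leq_card eHK; move: KHle; rewrite /size_ => k1 k2 k3.
  have /eqP vE : verts H == verts K by rewrite eqEcard vHK; move: k1 k2 k3; clear; lia.
  have /eqP eE : edges H == edges K by rewrite eqEcard eHK; move: k1 k2 k3; clear; lia.
  by split; rewrite ?vE ?eE.
exists H; split=> //; split=> // K KG nK HK; apply: contrapT => nKH.
by apply: nob; exists K.
Qed.

(** * The cubic fibre of a theta *)

Section Obstruction.
Variables (T : finType) (G : graph T) (u v : T) (s : 'I_3 -> seq T).
Hypothesis th : theta_by (adj G) u v s.
Implicit Types (j k c d : 'I_3) (i : nat) (e : {set T}).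

(** Path [j] has [m j] edges, an even number; its vertices and its edges are numbered from [u], both
    starting at 0. *)
Let m (j : 'I_3) := (size (s j)).+1.
Let z (j : 'I_3) i := nth v (u :: rcons (s j) v) i.
Let eps (j : 'I_3) i := [set z j i; z j i.+1].

Let z0 j : z j 0 = u. Proof. by []. Qed.

Let zm j : z j (m j) = v.
Proof. by rewrite /z /m /= nth_rcons ltnn eqxx. Qed.

Let m_even j : ~~ odd (m j). Proof. by rewrite /m /= negbK (theta_odd th). Qed.

Let m_gt1 j : 1 < m j.
Proof. by have := m_even j; rewrite /m; case: (size (s j)). Qed.

Let zI j i i' : i <= m j -> i' <= m j -> z j i = z j i' -> i = i'.
Proof.
move=> hi hi' /eqP; rewrite /z nth_uniq ?(theta_uniq th) //= ?size_rcons ?ltnS //.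
by move/eqP.
Qed.

Let z_inner j i : 0 < i -> i < m j -> z j i \in s j.
Proof.
case: i => // i _; rewrite /m ltnS => hi.
by rewrite /z /= nth_rcons hi mem_nth.
Qed.

Let z_neq j k i i' : j != k -> i <= m j -> i' <= m k -> z j i = z k i' ->
  (i == 0) && (i' == 0) || (i == m j) && (i' == m k).
Proof.
move=> jk hi hi' e.
have us l : u \notin s l.
  by have := theta_uniq th l; rewrite cons_uniq mem_rcons inE negb_or => /andP[/andP[]].
have vs l : v \notin s l.
  by have := theta_uniq th l; rewrite cons_uniq rcons_uniq => /andP[_ /andP[]].
have uv : u != v.
  by have := theta_uniq th j; rewrite cons_uniq mem_rcons inE negb_or => /andP[/andP[]].
have inner l l' h h' : l != l' -> h <= m l -> h' <= m l' -> z l h = z l' h' -> (h == 0) || (h == m l).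
  move=> ll' hh hh' E; apply: contraT; rewrite negb_or => /andP[h0 hm].
  have zl : z l h \in s l by apply: z_inner; rewrite ?lt0n // ltn_neqAle hm.
  have [h'0|h'0] := eqVneq h' 0; first by move: zl; rewrite E h'0 z0 (negPf (us l)).
  have [h'm|h'm] := eqVneq h' (m l'); first by move: zl; rewrite E h'm zm (negPf (vs l)).
  have := theta_disj th ll' zl; rewrite E z_inner ?lt0n //.
  by rewrite ltn_neqAle h'm.
have := inner _ _ _ _ jk hi hi' e; have := inner _ _ _ _ _ hi' hi (esym e); rewrite eq_sym jk => /(_ isT).
move=> /orP[] /eqP h2 /orP[] /eqP h1; move: e; rewrite h1 h2 ?z0 ?zm ?eqxx ?orbT // => e.
  by rewrite e eqxx in uv.
by rewrite e eqxx in uv.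
Qed.

Let eps_edge j i : i < m j -> eps j i \in edges G.
Proof.
move=> hi; have /(pathP v) := theta_path th j => /(_ i); rewrite size_rcons => /(_ hi).
by rewrite /eps /z /=.
Qed.

Let epsI j k i i' : i < m j -> i' < m k -> eps j i = eps k i' -> j = k /\ i = i'.
Proof.
move=> hi hi' e.
have h1 : z j i \in eps k i' by rewrite -e !inE eqxx.
have h2 : z j i.+1 \in eps k i' by rewrite -e !inE eqxx orbT.
move: h1 h2; rewrite !inE => h1 h2; have [jk|jk] := eqVneq j k.
  subst k; split=> //.
  have k1 : i = i' \/ i = i'.+1.
    by case/orP: h1 => /eqP /zI E; [left|right]; apply: E => //; exact: ltnW.
  have k2 : i.+1 = i' \/ i.+1 = i'.+1.
    by case/orP: h2 => /eqP /zI E; [left|right]; apply: E => //; exact: ltnW.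
  by move: k1 k2; clear; lia.
have k1 : (i == 0).
  case/orP: h1 => /eqP /(z_neq jk) E; have := E (ltnW hi); rewrite (ltn_eqF hi) /= orbF.
    by move=> /(_ (ltnW hi')) /andP[].
  by move=> /(_ hi'); rewrite andbF.
have k2 : (i.+1 == m j).
  by case/orP: h2 => /eqP /(z_neq jk) E; [have := E hi (ltnW hi')|have := E hi hi'] => /= /andP[].
by have := m_gt1 j; rewrite -(eqP k2) (eqP k1).
Qed.

Section Colouring.
Variable f : 'I_3 -> 'I_3.
Hypotheses (f_inj : injective f) (f_neq : forall j, f j != j).

(* In a proper colouring the first edge of path j, of multiplicity one, has
   colour j, and along the rest of the path the colour f j on an edge of
   multiplicity one alternates with the two other colours. *)
Definition col c j i := if i == 0 then c == j else if odd i then c == f j else c != f j.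

Definition theta_matching c : {set {set T}} :=
  [set e | [exists j, has (fun i => col c j i && (e == eps j i)) (iota 0 (m j))]].

Lemma theta_matchingP c e :
  reflect (exists j i, [/\ i < m j, col c j i & e = eps j i]) (e \in theta_matching c).
Proof.
rewrite inE; apply: (iffP existsP) => [[j /hasP [i hi /andP[ci /eqP ->]]]|[j [i [hi ci ->]]]]; exists j.
  by move: hi; rewrite mem_iota add0n => hi; exists i.
by apply/hasP; exists i; rewrite ?mem_iota // ci eqxx.
Qed.

Lemma mem_theta_matching c j i : i < m j -> (eps j i \in theta_matching c) = col c j i.
Proof.
move=> hi; apply/theta_matchingP/idP => [[k [i' [hi' ci' /(epsI hi hi') [-> ->]]]]//|ci].
by exists j, i.
Qed.

Lemma colS c j i : ~~ (col c j i && col c j i.+1).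
Proof.
rewrite /col; case: i => [|i] /=.
  by apply/negP => /andP[/eqP -> /eqP E]; have := f_neq j; rewrite -E eqxx.
by case: (odd i); rewrite /= ?andbN // andNb.
Qed.

Lemma colE c j i : 0 < i -> col c j i = if odd i then c == f j else c != f j.
Proof. by rewrite /col lt0n => /negPf ->. Qed.

Lemma eps_share j k i i' : i < m j -> i' < m k -> ~~ [disjoint eps j i & eps k i'] ->
  [\/ j = k /\ i = i', j = k /\ (i' = i.+1 \/ i = i'.+1), i = 0 /\ i' = 0 | i.+1 = m j /\ i'.+1 = m k].
Proof.
move=> hi hi' /pred0Pn [x /andP[]]; rewrite !inE => xe xe'.
have [a [b [ha hb e]]] : exists a b, [/\ a = i \/ a = i.+1, b = i' \/ b = i'.+1 & z j a = z k b].
  case/orP: xe => /eqP e1; case/orP: xe' => /eqP e2.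
  - by exists i, i'; split; [left|left|rewrite -e1].
  - by exists i, i'.+1; split; [left|right|rewrite -e1].
  - by exists i.+1, i'; split; [right|left|rewrite -e1].
  - by exists i.+1, i'.+1; split; [right|right|rewrite -e1].
have ha' : a <= m j by case: ha => ->; rewrite ?(ltnW hi).
have hb' : b <= m k by case: hb => ->; rewrite ?(ltnW hi').
have [jk|jk] := eqVneq j k.
  subst k; have ab := zI ha' hb' e; have : i = i' \/ i' = i.+1 \/ i = i'.+1 by move: ha hb ab; clear; lia.
  by case=> [->|]; [apply: Or41|move=> h; apply: Or42].
case/orP: (z_neq jk ha' hb' e) => /andP[/eqP a0 /eqP b0].
  by apply: Or43; move: ha hb a0 b0; clear; lia.
by apply: Or44; move: ha hb a0 b0 hi hi'; clear; lia.
Qed.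

(** Consecutive edges of a path share no colour. At [u] the first edges have the distinct colours
    [j]; at [v] the last edges have odd index, since the lengths are even, hence the colours [f j],
    distinct by injectivity. *)
Lemma theta_matching_matching c : matching G (theta_matching c).
Proof.
apply/andP; split.
  by apply/subsetP => e /theta_matchingP [j [i [hi _ ->]]]; apply: eps_edge.
apply/trivIsetP => e e' /theta_matchingP [j [i [hi ci ->]]] /theta_matchingP [k [i' [hi' ci' ->]]] ne.
apply: contraT => /(eps_share hi hi') [[jk ii]|[jk [ii|ii]]|[i0 i0']|[im im']].
- by rewrite jk ii eqxx in ne.
- by subst k i'; have := colS c j i; rewrite ci ci'.
- by subst k i; have := colS c j i'; rewrite ci ci'.
- subst i i'; move: ci ci'; rewrite /col /= => /eqP jc /eqP kc.
  by rewrite -jc -kc eqxx in ne.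
have oi : odd i by have := m_even j; rewrite -im /= negbK.
have oi' : odd i' by have := m_even k; rewrite -im' /= negbK.
move: ci ci'; rewrite !colE ?odd_gt0 // oi oi' => /eqP jc /eqP kc.
have jk : j = k by apply: f_inj; rewrite -jc.
by subst k; have ii : i = i' by [apply: succn_inj; rewrite im im']; rewrite ii eqxx in ne.
Qed.

(** The multiplicities do not involve [f], so different choices of [f] give families with the same
    sum. *)
Lemma theta_matching_sum_eps j i : i < m j ->
  \sum_c edge_weight (theta_matching c) (eps j i) = if (i == 0) || odd i then 1 else 2.
Proof.
move=> hi; rewrite (eq_bigr (fun c => col c j i : nat)) => [|c _]; last first.
  by rewrite /edge_weight mem_theta_matching.
have one k : \sum_c (c == k) = 1 by rewrite (bigD1 k) //= eqxx big1 // => c /negPf ->.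
have two k : \sum_c (c != k) = 2.
  apply/eqP; rewrite -(eqn_add2l 1) -{1}(one k) -big_split /=.
  by rewrite (eq_bigr (fun=> 1)) ?sum1_card ?card_ord // => c _; case: (c == k).
by rewrite /col; case: (i == 0) => //=; case: (odd i).
Qed.

Lemma theta_matching_sum0 e : (forall j i, i < m j -> e != eps j i) ->
  \sum_c edge_weight (theta_matching c) e = 0.
Proof.
move=> ne; rewrite big1 // => c _; rewrite /edge_weight; apply/eqP; rewrite eqb0.
by apply/theta_matchingP => -[j [i [hi _ E]]]; have := ne j i hi; rewrite E eqxx.
Qed.

(* The edges lying in exactly one of two colours form a path. *)
Lemma theta_matching_unique c d N1 N2 : c != d -> (forall j, f (f (f j)) = j) ->
  matching G N1 -> matching G N2 ->
  (forall e, edge_weight N1 e + edge_weight N2 e = edge_weight (theta_matching c) e + edge_weight (theta_matching d) e) ->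
  N1 = theta_matching c /\ N2 = theta_matching d \/ N1 = theta_matching d /\ N2 = theta_matching c.
Proof.
move=> cd f3 m1 m2 sumN.
set Mc := theta_matching c in sumN *; set Md := theta_matching d in sumN *.
(* This says that [N1] deviates from [Mc] at [e]; it will be constant on the edges lying in exactly
   one of [Mc] and [Md]. *)
pose D e := (e \in N1) (+) (e \in Mc).
have mc : matching G Mc := theta_matching_matching c.
have md : matching G Md := theta_matching_matching d.
pose single e := (e \in Mc) (+) (e \in Md).
(* By the sums such an edge lies in exactly one of [N1] and [N2], so two of them that meet alternate
   in both decompositions. *)
have share e e' : single e -> single e' -> e != e' -> ~~ [disjoint e & e'] -> D e = D e'.
  move=> se se' ee' nd.
  have excl N : matching G N -> ~~ ((e \in N) && (e' \in N)).
    case/andP=> _ /trivIsetP tN; apply/negP => /andP[eN e'N].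
    by case/negP: nd; apply: tN.
  have := excl _ m1; have := excl _ m2; have := excl _ mc; have := excl _ md.
  have := sumN e; have := sumN e'; move: se se'; rewrite /single /D /edge_weight.
  by do 8 (case: (_ \in _) => //=).
have [t cdt] := ord3_third cd; have [_ ct dt] := uniq3 cdt.
have singleE j i : i < m j -> single (eps j i) = if i == 0 then j != t else f j != t.
  move=> hi; rewrite /single !mem_theta_matching //.
  have col_t k : (c == k) (+) (d == k) = (k != t).
    case/or3P: (all3 k cdt) => /eqP ->; rewrite ?eqxx ?ct ?dt ?(negPf ct) ?(negPf dt) //.
      by rewrite eq_sym (negPf cd).
    by rewrite (negPf cd).
  have [->|i0] := eqVneq i 0; first by rewrite /col eqxx.
  by rewrite !colE ?lt0n // -(col_t (f j)); case: (odd i); case: (c == f j); case: (d == f j).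
(* With [t] the third colour, [k] the colour [f t] and [r] the remaining one, the path in question
   consists of the first edge of path [r], all of path [k], and path [t] from [v] back to its second
   edge. *)
have tk : t != f t by rewrite eq_sym f_neq.
have [r tkr] := ord3_third tk; have [_ tr kr] := uniq3 tkr.
have fkt : f (f t) != t by apply: contraNneq (f_neq t) => E; rewrite -{1}E f3.
have fk : f (f t) = r.
  by case/or3P: (all3 (f (f t)) tkr) => /eqP // E; [rewrite E eqxx in fkt|have := f_neq (f t); rewrite E eqxx].
have fr : f r = t by rewrite -fk f3.
move: tk tkr kr fkt fk; set k := f t => tk tkr kr fkt fk.
have nd (x : T) e e' : x \in e -> x \in e' -> ~~ [disjoint e & e'].
  by move=> xe xe'; apply/pred0Pn; exists x; rewrite /= xe.
have ne j j' i i' : i < m j -> i' < m j' -> (j != j') || (i != i') -> eps j i != eps j' i'.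
  by move=> hi hi'; apply: contraTneq => /(epsI hi hi') [-> ->]; rewrite !eqxx.
have L_lt j : (m j).-1 < m j by [].
have zl j i : z j i \in eps j i by rewrite !inE eqxx.
have zr j i : z j i.+1 \in eps j i by rewrite !inE eqxx orbT.
have singk i : i < m k -> single (eps k i).
  by move=> hi; rewrite singleE // fk (eq_sym k t) (eq_sym r t) tk tr if_same.
have singt i : 0 < i -> i < m t -> single (eps t i).
  by move=> i0 hi; rewrite singleE // eqn0Ngt i0 (eq_sym _ t) tk.
have Dk i : i < m k -> D (eps k i) = D (eps k 0).
  elim: i => // i IH hi; rewrite -IH ?(ltnW hi) //; apply: share; rewrite ?singk ?ne ?(ltnW hi) //.
    by rewrite orbC -[X in X != _]addn1 -{2}[i]addn0 eqn_add2l.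
  by apply: (nd (z k i.+1)); rewrite ?zl ?zr.
(* Path [t] is followed backwards from its last edge; its first edge, of colour [t], is excluded. *)
have Dt n : 0 < (m t).-1 - n -> D (eps t ((m t).-1 - n)) = D (eps k 0).
  elim: n => [|n IH].
    rewrite subn0 => m0; rewrite -(Dk (m k).-1) //; apply: share; rewrite ?singk ?singt ?ne ?tk //.
    by apply: (nd v); [rewrite -(zm t) zr|rewrite -(zm k) zr].
  move=> n0; have lt0 : 0 < (m t).-1 - n by move: n0; clear; lia.
  have E : (m t).-1 - n = ((m t).-1 - n.+1).+1 by move: n0; clear; lia.
  have lt1 : (m t).-1 - n < m t by move: lt0; clear; lia.
  have lt2 : (m t).-1 - n.+1 < m t by move: lt0; clear; lia.
  rewrite -(IH lt0); apply: share; rewrite ?singt ?ne //.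
    by rewrite E orbC -[X in _ != X]addn1 -{1}[_ - _]addn0 eqn_add2l.
  by apply: (nd (z t ((m t).-1 - n))); [rewrite {1}E zr|rewrite zl].
have Dall e : single e -> D e = D (eps k 0).
  move=> se; have [j [i [hi E]]] : exists j i, i < m j /\ e = eps j i.
    move: se; rewrite /single; case: (boolP (e \in Mc)) => [/theta_matchingP [j [i [hi _ ->]]] _|_].
      by exists j, i.
    by case/theta_matchingP => [j [i [hi _ ->]]]; exists j, i.
  move: se; rewrite E singleE //; case/or3P: (all3 j tkr) => /eqP jE; subst j.
  - case: (eqVneq i 0) => [_|i0 _]; first by rewrite eqxx.
    have -> : i = (m t).-1 - ((m t).-1 - i) by move: hi; clear; lia.
    by apply: Dt; move: hi i0; clear; lia.
  - by rewrite Dk.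
  - case: (eqVneq i 0) => [-> _|]; last by rewrite fr eqxx.
    apply: share; rewrite ?singk ?ne // ?singleE // ?eqxx 1?eq_sym ?tr ?kr //.
    by apply: (nd u); [rewrite -(z0 r) zl|rewrite -(z0 k) zl].
have Dconst : (forall e, single e -> D e = false) \/ (forall e, single e -> D e).
  case Dk0 : (D (eps k 0)); [right|left] => e /Dall ->; exact: Dk0.
have [D0|D1] := Dconst; [left|right].
  suff H e : (e \in N1) = (e \in Mc) /\ (e \in N2) = (e \in Md).
    by split; apply/setP => e; case: (H e).
  have := sumN e; have := D0 e; rewrite /single /D /edge_weight.
  by case: (e \in Mc); case: (e \in Md); case: (e \in N1); case: (e \in N2) => //= h; have := h isT.
suff H e : (e \in N1) = (e \in Md) /\ (e \in N2) = (e \in Mc).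
  by split; apply/setP => e; case: (H e).
have := sumN e; have := D1 e; rewrite /single /D /edge_weight.
by case: (e \in Mc); case: (e \in Md); case: (e \in N1); case: (e \in N2) => //= h; have := h isT.
Qed.

End Colouring.

(** The two families belong to the two cyclic shifts of the three colours, which have no fixed point
    and differ everywhere. *)
Lemma theta_triples : exists M N : 'I_3 -> {set {set T}},
  [/\ forall c, matching G (M c), forall c, matching G (N c),
      forall e, \sum_c edge_weight (M c) e = \sum_c edge_weight (N c) e,
      forall c d, M c != N d &
      forall c d N1 N2, c != d -> matching G N1 -> matching G N2 ->
        (forall e, edge_weight N1 e + edge_weight N2 e = edge_weight (M c) e + edge_weight (M d) e) ->
        N1 = M c /\ N2 = M d \/ N1 = M d /\ N2 = M c].
Proof.
have [f3 fn gn fg] : [/\ forall j : 'I_3, ordS (ordS (ordS j)) = j, forall j : 'I_3, ordS j != j,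
    forall j : 'I_3, ord_pred j != j & forall j : 'I_3, ord_pred j != ordS j].
  by split; case=> [[|[|[|]]] ?] //; apply/val_inj.
have fi := @ordS_inj 3; have gi := @ord_pred_inj 3.
exists (theta_matching (@ordS 3)), (theta_matching (@ord_pred 3)); split.
- by move=> c; apply: theta_matching_matching.
- by move=> c; apply: theta_matching_matching.
- move=> e; have [/existsP [j /hasP [i hi /eqP ->]]|no] :=
    boolP [exists j, has (fun i => e == eps j i) (iota 0 (m j))].
    by rewrite !theta_matching_sum_eps //; move: hi; rewrite mem_iota.
  rewrite !theta_matching_sum0 // => j i hi; apply: contraNneq no => ->;
    by apply/existsP; exists j; apply/hasP; exists i; rewrite ?mem_iota.
(* For [c = d] the second edge of a path tells the two shifts apart; otherwise the first edge of
   path [c] has colour [c] in both families and separates the two matchings. *)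
- move=> c d; apply/eqP => /setP E; have [cd|cd] := eqVneq c d.
    have := E (eps (ord_pred c) 1); rewrite !mem_theta_matching ?m_gt1 // /col /=.
    by rewrite ord_predK eqxx -cd => /esym/eqP cE; have := fg (ord_pred c); rewrite ord_predK -cE eqxx.
  by have := E (eps c 0); rewrite !mem_theta_matching // /col /= eqxx eq_sym (negPf cd).
- by move=> c d N1 N2 cd m1 m2; apply: theta_matching_unique.
Qed.

End Obstruction.

Import GRing.Theory.

(** * Toric ideals *)

Section Spans.
Local Open Scope ring_scope.
Variables (K : fieldType) (N : nat).
Implicit Types (f g p : {mpoly K[N]}) (s t : seq {mpoly K[N]}) (I : {mpoly K[N]} -> Prop).

Definition spanned s f : Prop := exists c : 'I_(size s) -> {mpoly K[N]}, f = \sum_(i < size s) c i * s`_i.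

Lemma spanned0 s : spanned s 0.
Proof. by exists (fun=> 0); rewrite big1 // => i _; rewrite mul0r. Qed.

Lemma spannedD s f g : spanned s f -> spanned s g -> spanned s (f + g).
Proof.
move=> [c ->] [d ->]; exists (fun i => c i + d i); rewrite -big_split.
by apply: eq_bigr => i _; rewrite mulrDl.
Qed.

Lemma spannedM s p f : spanned s f -> spanned s (p * f).
Proof.
move=> [c ->]; exists (fun i => p * c i); rewrite mulr_sumr.
by apply: eq_bigr => i _; rewrite mulrA.
Qed.

Lemma spanned_mem s g : g \in s -> spanned s g.
Proof.
move=> gs; have lt : (index g s < size s)%N by rewrite index_mem.
exists (fun i => (i == Ordinal lt)%:R); rewrite (bigD1 (Ordinal lt)) //= eqxx mul1r nth_index //.
by rewrite big1 ?addr0 // => i /negPf ->; rewrite mul0r.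
Qed.

Lemma spanned_sum (J : Type) (r : seq J) (P : pred J) (F : J -> {mpoly K[N]}) s :
  (forall j, P j -> spanned s (F j)) -> spanned s (\sum_(j <- r | P j) F j).
Proof. by move=> H; elim/big_ind: _ => //; [exact: spanned0|exact: spannedD]. Qed.

Lemma spanned_trans s t f : {in s, forall g, spanned t g} -> spanned s f -> spanned t f.
Proof.
move=> st [c ->]; apply: spanned_sum => i _; apply: spannedM; apply: st.
exact: mem_nth.
Qed.

Definition degree_at_most d g := (g \is homog mdeg) && ((msize g).-1 <= d)%N.

Lemma pihomog_mul k D (c g : {mpoly K[N]}) : g \is D.-homog ->
  exists2 p, pihomog mdeg k (c * g) = p * g & (k < D)%N -> p = 0.
Proof.
move=> hg; exists (\sum_(j < msize c | (j + D == k)%N) pihomog mdeg j c); last first.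
  by move=> kD; rewrite big1 // => j /eqP jk; move: kD; rewrite -jk ltnNge leq_addl.
rewrite {1}[c](pihomog_partitionE (mf := mdeg) (leqnn _)) !mulr_suml raddf_sum /=.
rewrite [RHS]big_mkcond; apply: eq_bigr => j _.
have hj : pihomog mdeg j c * g \is (j + D).-homog by apply: dhomogM => //; exact: pihomogP.
case: eqP => [<-|/eqP jk]; first exact: pihomog_dE.
exact: pihomog_ne0 jk hj.
Qed.

(* A minimal generator of degree above d is redundant: compare homogeneous
   components in degree at most d. *)
Lemma minimal_generator_degree I s d g : {in s, forall h, degree_at_most d h} -> generates s I ->
  minimal_generator I g -> ((msize g).-1 <= d)%N.
Proof.
move=> sd genI [t [[th gent mint] gt]]; rewrite leqNgt; apply/negP => dg.
apply: (mint g gt) => f; split=> [If|[c ->]]; last first.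
  apply/gent; apply: (@spanned_trans (rem g t)); last by exists c.
  by move=> h /mem_rem ht; apply: spanned_mem.
have /genI : I f by [].
apply: spanned_trans => h hs; have /andP[hh hd] := sd h hs.
have /gent [c hE] : I h by apply/genI; exact: spanned_mem.
have hom_h : h \is (msize h).-1.-homog by rewrite -homog_msize.
move: (msize h).-1 hd hom_h => k hd /pihomog_dE <-.
rewrite hE raddf_sum /=; apply: spanned_sum => i _.
have it : t`_i \in t by apply: mem_nth.
have [|p -> p0] := @pihomog_mul k (msize t`_i).-1 (c i) t`_i.
  by rewrite -homog_msize th.
have [E|ne] := eqVneq t`_i g.
  rewrite p0 ?mul0r; first exact: spanned0.
  by rewrite E (leq_ltn_trans hd).
apply: spannedM; apply: spanned_mem; have := perm_mem (perm_to_rem gt) t`_i.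
by rewrite it inE (negPf ne) /= => <-.
Qed.

Lemma minimal_subsystem I s : {in s, forall g, g \is homog mdeg} -> generates s I ->
  exists t, minimal_generating_system t I /\ {subset t <= s}.
Proof.
have [n] := ubnP (size s); elim: n s => // n IH s; rewrite ltnS => sn hs gs.
have [[g gins gens]|no] := pselect (exists2 g, g \in s & generates (rem g s) I); last first.
  by exists s; split=> //; split=> // g gins gens; apply: no; exists g.
have [||t [mt ts]] := IH (rem g s) _ _ gens.
- have s0 : (0 < size s)%N by case: (s) gins.
  by rewrite size_rem // (leq_trans _ sn) // ltn_predL.
- by move=> h /mem_rem; apply: hs.
- by exists t; split=> // h /ts /mem_rem.
Qed.

(** The largest degree in one minimal system bounds the degree of every minimal generator, so it is
    the value of [omega]. *)
Lemma omega_of_generates I s d : {in s, forall g, degree_at_most d g} -> generates s I ->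
  ~ (forall f, I f <-> f = 0) ->
  (forall g, I g -> g != 0 -> g \is homog mdeg -> (2 <= (msize g).-1)%N) ->
  exists e, [/\ (2 <= e)%N, (e <= d)%N & omega I e].
Proof.
move=> sd gs nz low; have [|t [mt ts]] := @minimal_subsystem I s _ gs.
  by move=> g /sd /andP[].
have [th gent mint] := mt.
pose e := \max_(g <- t) (msize g).-1.
have te : {in t, forall g, degree_at_most e g}.
  by move=> g gt; rewrite /degree_at_most th //= /e (big_rem g gt) /= leq_maxl.
have [g gt ge] : exists2 g, g \in t & (msize g).-1 = e.
  have [t0|] := eqVneq t [::].
    case: nz => f; split=> [/gent [c ->]|->]; first last.
      by apply/gent; exact: spanned0.
    by rewrite big1 // => -[i ilt] _; exfalso; move: (ilt); rewrite (congr1 size t0).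
  rewrite /e; elim: (t) => // g1 [|g2 t'] IH _; first by exists g1; rewrite ?mem_head // big_seq1.
  have [//|h ht hE] := IH; rewrite big_cons -hE; case: (leqP (msize g1).-1 (msize h).-1) => _.
    by exists h; rewrite // inE ht orbT.
  by exists g1; rewrite ?mem_head.
(* A zero member could be dropped from a minimal system. *)
have g0 : g != 0.
  apply/eqP => g0; apply: (mint g gt) => f; split=> [/gent sf|[c ->]].
    apply: spanned_trans sf => h ht; have := perm_mem (perm_to_rem gt) h; rewrite ht inE.
    move=> /esym /orP[/eqP ->|]; first by rewrite g0; exact: spanned0.
    exact: spanned_mem.
  apply/gent; apply: (@spanned_trans (rem g t)); last by exists c.
  by move=> h /mem_rem ht; apply: spanned_mem.
have e2 : (2 <= e)%N by rewrite -ge; apply: low => //; [apply/gent; exact: spanned_mem|exact: th].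
exists e; split=> //.
  by rewrite -ge; have /andP[] := sd g (ts g gt).
right; split=> //; split; first by exists g; split=> //; exists t.
by move=> h; apply: minimal_generator_degree te gent.
Qed.

End Spans.

(** * Binomials of a toric ideal *)

Section Toric.
Local Open Scope ring_scope.
Variables (K : fieldType) (n N : nat) (a : 'I_N -> 'X_{1..n}).
Implicit Types (m : 'X_{1..N}) (f g : {mpoly K[N]}).

(** The exponent of the image of the monomial with exponent [m]; the coordinate of [s] records the
    degree. *)
Definition texp m : 'X_{1..n.+1} := (\sum_(i < N) (mnmwiden (a i) + U_(ord_max)) *+ m i)%MM.

Lemma texp_widen m (j : 'I_n) : texp m (widen_ord (leqnSn n) j) = (\sum_i m i * a i j)%N.
Proof.
rewrite /texp mnm_sumE; apply: eq_bigr => i _.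
rewrite mulmnE mnmDE mnm1E mnmwiden_widen mulnC; congr (_ * _)%N.
by rewrite (_ : (_ == _) = false) ?addn0 //; apply/negbTE; rewrite -val_eqE /= gtn_eqF.
Qed.

Lemma texp_max m : texp m ord_max = mdeg m.
Proof.
rewrite /texp mnm_sumE mdegE; apply: eq_bigr => i _.
by rewrite mulmnE mnmDE mnm1E mnmwiden_ordmax eqxx mul1n.
Qed.

Lemma texp_eqP m1 m2 : texp m1 = texp m2 <->
  (forall j, \sum_i m1 i * a i j = \sum_i m2 i * a i j)%N /\ mdeg m1 = mdeg m2.
Proof.
split=> [E|[E1 E2]]; first by split=> [j|]; rewrite -?texp_widen -?texp_max E.
apply/mnmP => k; case: (unliftP ord_max k) => [j ->|->]; last by rewrite !texp_max.
have -> : lift ord_max j = widen_ord (leqnSn n) j by apply: val_inj; rewrite /= /bump leqNgt ltn_ord.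
by rewrite !texp_widen.
Qed.

Lemma toric_mapX m : toric_map K a 'X_[m] = 'X_[texp m].
Proof.
rewrite /toric_map mmapX /mmap1 /texp -mprodXE; apply: eq_bigr => i _.
by rewrite mwidenX -mpolyXD mpolyXn.
Qed.

Lemma toric_mapB f g : toric_map K a (f - g) = toric_map K a f - toric_map K a g.
Proof. exact: raddfB. Qed.

Lemma toric_mapM f g : toric_map K a (f * g) = toric_map K a f * toric_map K a g.
Proof. exact: rmorphM. Qed.

Lemma toric_map_sum (J : Type) (r : seq J) (F : J -> {mpoly K[N]}) :
  toric_map K a (\sum_(j <- r) F j) = \sum_(j <- r) toric_map K a (F j).
Proof. exact: raddf_sum. Qed.

Lemma toric_mapZ c f : toric_map K a (c *: f) = c *: toric_map K a f.
Proof. by rewrite /toric_map mmapZ mul_mpolyC. Qed.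

(** Monomials are independent in the target ring, so the coefficients over each fibre cancel. *)
Lemma toric_ideal_coeff f m : toric_ideal K a f -> \sum_(k <- msupp f | texp k == texp m) f@_k = 0.
Proof.
rewrite /toric_ideal {1}[f]mpolyE toric_map_sum => /(congr1 (mcoeff (texp m))).
rewrite mcoeff0 raddf_sum /= => E; rewrite -[RHS]E [LHS]big_mkcond; apply: eq_bigr => k _.
by rewrite toric_mapZ toric_mapX mcoeffZ mcoeffX; case: eqP; rewrite ?mulr1 ?mulr0.
Qed.

Lemma toric_idealX m1 m2 : texp m1 = texp m2 -> toric_ideal K a ('X_[m1] - 'X_[m2]).
Proof. by rewrite /toric_ideal toric_mapB !toric_mapX => ->; rewrite subrr. Qed.

Lemma toric_ideal_spanned s f : {in s, forall g, toric_ideal K a g} -> spanned s f -> toric_ideal K a f.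
Proof.
move=> sI [c ->]; rewrite /toric_ideal toric_map_sum big1 // => i _.
by rewrite toric_mapM (sI _ (mem_nth _ _)) ?mulr0.
Qed.

Lemma toric_ideal_alone f m : toric_ideal K a f -> (forall k, texp k = texp m -> k = m) -> f@_m = 0.
Proof.
move=> If alone; have [mf|/memN_msupp_eq0 //] := boolP (m \in msupp f).
rewrite -[RHS](toric_ideal_coeff m If) (big_rem m) //= eqxx big_seq_cond big1 ?addr0 // => k /andP[km /eqP /alone E].
by move: km; rewrite E mem_rem_uniq ?msupp_uniq // inE eqxx.
Qed.

(** A monomial of [f] has a partner of [f] in its fibre; subtracting a multiple of their binomial
    removes it and creates no new monomial. *)
Lemma toric_ideal_binomials s :
  (forall m1 m2, texp m1 = texp m2 -> spanned s ('X_[m1] - 'X_[m2] : {mpoly K[N]})) ->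
  forall f, toric_ideal K a f -> spanned s f.
Proof.
move=> sB f; have [b] := ubnP (size (msupp f)); elim: b f => // b IH f; rewrite ltnS => fb If.
have [f0|[m mf]] : f = 0 \/ exists m, m \in msupp f.
  case E : (msupp f) => [|m l]; last by right; exists m; rewrite inE eqxx.
  by left; apply/eqP; rewrite -msupp_eq0 E.
  by rewrite f0; exact: spanned0.
have [m' [m'f m'm E]] : exists m', [/\ m' \in msupp f, m' != m & texp m' = texp m].
  have [/hasP [m' m'f /andP[ne /eqP e]]|/hasPn no] := boolP (has (fun k => (k != m) && (texp k == texp m)) (msupp f)).
    by exists m'.
  have := toric_ideal_coeff m If; rewrite (big_rem m) //= eqxx big_seq_cond big1 => [|k /andP[km ek]].
    by rewrite addr0 => fm; move: mf; rewrite mcoeff_msupp fm eqxx.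
  have := no k (mem_rem km); rewrite ek andbT negbK => /eqP km'.
  by move: km; rewrite km' mem_rem_uniq ?msupp_uniq // inE eqxx.
have B : toric_ideal K a ('X_[m] - 'X_[m']) by apply: toric_idealX.
rewrite -[f](subrK (f@_m *: ('X_[m] - 'X_[m']))); apply: spannedD; last first.
  by rewrite -mul_mpolyC; apply: spannedM; apply: sB.
apply: IH; last by rewrite /toric_ideal toric_mapB toric_mapZ If B scaler0 subr0.
apply: leq_trans fb; rewrite -[size (msupp f)]prednK; last by case: (msupp f) mf.
rewrite ltnS -(size_rem mf); apply: uniq_leq_size; first exact: msupp_uniq.
move=> k; rewrite mcoeff_msupp mcoeffB mcoeffZ mcoeffB !mcoeffX mem_rem_uniq ?msupp_uniq // inE /=.
have [->|km] := eqVneq k m; first by rewrite (negPf m'm) subr0 mulr1 subrr => /eqP [].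
rewrite /= sub0r; have [<- _|_] := eqVneq m' k; first by [].
by rewrite oppr0 mulr0 subr0 mcoeff_msupp.
Qed.

Hypothesis a_inj : injective a.

(** The degree is the coordinate of [s], and distinct variables have distinct images because the
    lattice points are listed without repetition. *)
Lemma texp_inj1 m k : (mdeg m <= 1)%N -> texp k = texp m -> k = m.
Proof.
rewrite leq_eqVlt ltnS leqn0 => /orP[/mdeg1P [i /eqP ->]|]; last first.
  rewrite mdeg_eq0 => /eqP -> /texp_eqP [_]; rewrite mdeg0 => /eqP.
  by rewrite mdeg_eq0 => /eqP.
move=> E; have /texp_eqP [Ea] := E; rewrite mdeg1 => /eqP /mdeg1P [i' /eqP Ek].
suff -> : i = i' by [].
apply: a_inj; apply/mnmP => j; have := Ea j; rewrite Ek.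
have sumU (l : 'I_N) : (\sum_i U_(l)%MM i * a i j = a l j)%N.
  rewrite (bigD1 l) //= mnm1E eqxx mul1n big1 ?addn0 // => i0.
  by rewrite mnm1E eq_sym => /negPf ->.
by rewrite !sumU.
Qed.

Lemma toric_ideal_degree g : toric_ideal K a g -> g != 0 -> g \is homog mdeg -> (2 <= (msize g).-1)%N.
Proof.
rewrite homog_msize => Ig g0 hg; rewrite leqNgt; apply/negP => lt.
case/eqP: g0; apply/mpolyP => m; rewrite mcoeff0.
have [E|ne] := eqVneq (mdeg m) (msize g).-1; last exact: dhomog_nemf_coeff hg ne.
apply: toric_ideal_alone => // k; apply: texp_inj1.
by rewrite E -ltnS.
Qed.

End Toric.

Import Order.TTheory Num.Theory.

(** * Lattice points of the matching polytope *)

Section LatticePoints.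
Local Open Scope ring_scope.
Variables (R : realType) (T : finType) (G : graph T).
Variables (N : nat) (a : 'I_N -> 'X_{1..#|edges G|}).
Hypothesis ha : lattice_points (matching_polytope R G) a.
Implicit Types (M : {set {set T}}).

Lemma rhoE M j : rho R G M 0 j = (enum_val j \in M)%:R.
Proof.
rewrite /rho summxE big_mkcond (bigD1 j) //= big1 ?addr0 => [|k kj]; last first.
  by case: ifP => // _; rewrite mxE eqxx /= eq_sym (negPf kj).
by case: ifP => // _; rewrite mxE !eqxx.
Qed.

Lemma lattice_point_of_matching M : matching G M -> exists i, forall j, a i j = (enum_val j \in M).
Proof.
move=> mM; have [_ h] := ha.
have [|i E] := (h (\row_j (enum_val j \in M)%:Z)).1; last first.
  by exists i => j; have /matrixP/(_ 0 j) := E; rewrite !mxE => -[].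
exists (fun M' => (M' == M)%:R); split=> [M' _| |]; first exact: ler0n.
  by rewrite (bigD1 M) //= eqxx big1 ?addr0 // => M' /andP[_ /negPf ->].
rewrite (bigD1 M) //= eqxx scale1r big1 ?addr0 => [|M' /andP[_ /negPf ->]]; last exact: scale0r.
by apply/rowP => j; rewrite rhoE !mxE.
Qed.

(** In a convex combination of matchings each coordinate is at most one, and so is the sum of the
    coordinates of two edges that meet; an integral point is thus the indicator of a matching. *)
Lemma matching_of_lattice_point i : exists2 M, matching G M & forall j, a i j = (enum_val j \in M).
Proof.
have [_ h] := ha.
have [|c [c0 c1 E]] := (h (\row_j (a i j)%:Z)).2; first by exists i.
have xE j : (a i j)%:R = \sum_(M | matching G M) c M * (enum_val j \in M)%:R :> R.
  have /rowP/(_ j) := E; rewrite !mxE summxE -pmulrn => ->.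
  by apply: eq_bigr => M mM; rewrite mxE rhoE.
have le1 j : (a i j <= 1)%N.
  rewrite -(ler_nat R) xE -[leRHS]c1; apply: ler_sum => M mM.
  by apply: ler_piMr; [exact: c0|case: (_ \in _); rewrite ?lexx ?ler01].
have a01 j : a i j = (a i j == 1%N) by have := le1 j; case: (a i j) => [|[|]].
pose M := [set enum_val j | j in [set j : 'I_#|edges G| | a i j == 1%N]].
exists M => [|j]; last first.
  by rewrite mem_imset ?inE; [exact: a01|exact: enum_val_inj].
apply/andP; split.
  by apply/subsetP => _ /imsetP [j _ ->]; exact: enum_valP.
apply/trivIsetP => _ _ /imsetP [j /[!inE] /eqP aj ->] /imsetP [k /[!inE] /eqP ak ->] jk.
apply: contraT => nd.
have : (a i j)%:R + (a i k)%:R <= 1 :> R.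
  rewrite !xE -[leRHS]c1 -big_split /=; apply: ler_sum => M' mM'.
  rewrite /= -mulrDr -natrD; apply: ler_piMr; first exact: c0.
  rewrite -[leRHS]/(1%:R) ler_nat.
  case: (boolP (enum_val j \in M')) => jM; case: (boolP (enum_val k \in M')) => kM //.
  case/negP: nd; have /andP[_ /trivIsetP tM] := mM'; exact: tM.
by rewrite aj ak -natrD -[leRHS]/(1%:R) ler_nat.
Qed.

End LatticePoints.

(** * Fibres of the toric map as families of matchings *)

Section Fibres.
Variables (K : fieldType) (T : finType) (G : graph T).
Variables (N : nat) (a : 'I_N -> 'X_{1..#|edges G|}) (idx : {set {set T}} -> 'I_N) (mat : 'I_N -> {set {set T}}).
Hypotheses (a_inj : injective a) (idxE : forall M j, matching G M -> a (idx M) j = (enum_val j \in M)).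
Hypotheses (mat_matching : forall i, matching G (mat i)) (matE : forall i j, a i j = (enum_val j \in mat i)).
Implicit Types (M : {set {set T}}) (l : seq {set {set T}}) (m : 'X_{1..N}).

Definition mnm_of l : 'X_{1..N} := (\sum_(M <- l) U_(idx M))%MM.

Lemma idxK M : matching G M -> mat (idx M) = M.
Proof.
move=> mM; apply/setP => e; have [eG|eG] := boolP (e \in edges G); last first.
  by rewrite !(contraNF (matching_edge _) eG).
have := idxE (enum_rank_in eG e) mM; rewrite matE enum_rankK_in //.
by case: (e \in M); case: (e \in mat _).
Qed.

Lemma matK i : idx (mat i) = i.
Proof. by apply/a_inj/mnmP => j; rewrite idxE // matE. Qed.

Lemma mnm_of_cons M l : mnm_of (M :: l) = (U_(idx M) + mnm_of l)%MM.
Proof. by rewrite /mnm_of big_cons. Qed.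

Lemma mnm_of_cat l l' : mnm_of (l ++ l') = (mnm_of l + mnm_of l')%MM.
Proof. by rewrite /mnm_of big_cat. Qed.

Lemma mdeg_mnm_of l : mdeg (mnm_of l) = size l.
Proof. by elim: l => [|M l IH]; rewrite ?mnm_of_cons ?mdegD ?mdeg1 ?IH // /mnm_of big_nil mdeg0. Qed.

Lemma mnm_of_surj m : exists2 l, all (matching G) l & mnm_of l = m.
Proof.
have [k] := ubnP (mdeg m); elim: k m => // k IH m; rewrite ltnS => mk.
have [->|m0] := eqVneq m 0%MM; first by exists [::]; rewrite // /mnm_of big_nil.
have [i mi] : exists i, m i != 0.
  apply/existsP; apply: contraR m0 => /existsPn no; apply/eqP/mnmP => i.
  by rewrite mnm0E; apply/eqP; have := no i; rewrite negbK.
have le1 : (U_(i) <= m)%MM by rewrite lep1mP.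
have [|l ml lE] := IH (m - U_(i))%MM.
  apply: leq_trans mk; rewrite -{2}(submK le1) mdegD mdeg1 addn1; exact: leqnn.
exists (mat i :: l); first by rewrite /= mat_matching.
by rewrite mnm_of_cons matK lE addmC submK.
Qed.

Lemma texp_mnm_ofP l l' : all (matching G) l -> all (matching G) l' ->
  texp a (mnm_of l) = texp a (mnm_of l') <->
  size l = size l' /\ forall e, \sum_(M <- l) edge_weight M e = \sum_(M <- l') edge_weight M e.
Proof.
move=> ml ml'.
have sumE l1 j : all (matching G) l1 ->
    \sum_i mnm_of l1 i * a i j = \sum_(M <- l1) edge_weight M (enum_val j).
  move=> m1; transitivity (\sum_(M <- l1) a (idx M) j); last first.
    by apply: eq_big_seq => M /(allP m1) mM; rewrite idxE.
  rewrite (eq_bigr (fun i => \sum_(M <- l1) (idx M == i) * a i j)) => [|i _]; last first.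
    by rewrite /mnm_of mnm_sumE big_distrl; apply: eq_bigr => M _; rewrite mnm1E.
  rewrite exchange_big; apply: eq_bigr => M _; rewrite (bigD1 (idx M)) //= eqxx mul1n big1 ?addn0 //.
  by move=> i; rewrite eq_sym => /negPf ->.
have off l1 e : all (matching G) l1 -> e \notin edges G -> \sum_(M <- l1) edge_weight M e = 0.
  move=> m1 eG; rewrite big_seq big1 // => M /(allP m1) mM; rewrite /edge_weight.
  by rewrite (contraNF (matching_edge mM) eG).
split=> [/texp_eqP [E1 E2]|[E1 E2]].
  split=> [|e]; first by move: E2; rewrite !mdeg_mnm_of.
  have [eG|eG] := boolP (e \in edges G); last by rewrite !off.
  by have := E1 (enum_rank_in eG e); rewrite !sumE // enum_rankK_in.
by apply/texp_eqP; split=> [j|]; rewrite ?mdeg_mnm_of // !sumE.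
Qed.

Definition binomials d : seq {mpoly K[N]} :=
  [seq 'X_[bmnm p.1] - 'X_[bmnm p.2] |
    p <- enum {: 'X_{1..N < d.+1} * 'X_{1..N < d.+1} } & texp a (bmnm p.1) == texp a (bmnm p.2)]%R.

Lemma mem_binomials d m1 m2 : mdeg m1 <= d -> texp a m1 = texp a m2 ->
  ('X_[m1] - 'X_[m2])%R \in binomials d.
Proof.
rewrite -ltnS => d1 E; have [_ dE] := (texp_eqP a m1 m2).1 E.
have d2 : mdeg m2 < d.+1 by rewrite -dE.
apply/mapP; exists (BMultinom d1, BMultinom d2) => //.
by rewrite mem_filter /= E eqxx mem_enum.
Qed.

Lemma binomialsP d g : g \in binomials d -> exists m1 m2,
  [/\ mdeg m1 <= d, texp a m1 = texp a m2 & g = ('X_[m1] - 'X_[m2])%R].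
Proof.
case/mapP => -[m1 m2]; rewrite mem_filter /= => /andP[/eqP E _] ->.
by exists m1, m2; split=> //; rewrite -ltnS bmdeg.
Qed.

Lemma binomials_degree d : {in binomials d, forall g, degree_at_most d g}.
Proof.
move=> g /binomialsP [m1 [m2 [d1 E ->]]]; have [_ dE] := (texp_eqP a m1 m2).1 E.
have hg : ('X_[m1] - 'X_[m2] : {mpoly K[N]})%R \is (mdeg m1).-homog.
  by apply: rpredB; rewrite dhomogX // dE.
rewrite /degree_at_most (homogE hg) /=.
have [->|g0] := eqVneq ('X_[m1] - 'X_[m2] : {mpoly K[N]})%R 0%R; first by rewrite mmeasure0.
by rewrite (dhomog_uniq g0 (dhomog_msize hg) hg).
Qed.

Lemma linked_spanned d l l' : linked (@edge_weight T) (matching G) d l l' -> all (matching G) l ->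
  spanned (binomials d) ('X_[mnm_of l] - 'X_[mnm_of l'])%R.
Proof.
elim=> {l l'} [l l' ll'|x y r sx sy wxy my|l l' l2 L1 IH1 _ IH2] ml.
- rewrite /mnm_of (perm_big _ ll') subrr; exact: spanned0.
- rewrite !mnm_of_cat !mpolyXD -mulrBl mulrC; apply/spannedM/spanned_mem/mem_binomials.
    by rewrite mdeg_mnm_of.
  by apply/texp_mnm_ofP => //; move: ml; rewrite all_cat => /andP[].
- have -> : ('X_[mnm_of l] - 'X_[mnm_of l2] = ('X_[mnm_of l] - 'X_[mnm_of l']) + ('X_[mnm_of l'] - 'X_[mnm_of l2]) :> {mpoly K[N]})%R.
    by rewrite addrA subrK.
  by apply: spannedD (IH1 ml) (IH2 (linked_all L1 ml)).
Qed.

Lemma binomials_generate d : (forall l l', size l = size l' -> all (matching G) l -> all (matching G) l' ->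
    (forall e, \sum_(M <- l) edge_weight M e = \sum_(M <- l') edge_weight M e) -> linked (@edge_weight T) (matching G) d l l') ->
  generates (binomials d) (toric_ideal K a).
Proof.
move=> L f; split=> [If|sf].
  apply: (toric_ideal_binomials _ If) => m1 m2.
  have [l1 ml1 <-] := mnm_of_surj m1; have [l2 ml2 <-] := mnm_of_surj m2.
  by move=> /(texp_mnm_ofP ml1 ml2) [sz E]; apply: linked_spanned (L _ _ sz ml1 ml2 E) ml1.
apply: toric_ideal_spanned sf => g /binomialsP [m1 [m2 [_ E ->]]].
exact: toric_idealX.
Qed.

Lemma mnm_of2_alone M1 M2 : matching G M1 -> matching G M2 ->
  (forall N1 N2, matching G N1 -> matching G N2 ->
    (forall e, edge_weight N1 e + edge_weight N2 e = edge_weight M1 e + edge_weight M2 e) ->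
    N1 = M1 /\ N2 = M2 \/ N1 = M2 /\ N2 = M1) ->
  forall m, texp a m = texp a (mnm_of [:: M1; M2]) -> m = mnm_of [:: M1; M2].
Proof.
move=> m1 m2 uniq12 m; have [l ml <-] := mnm_of_surj m.
have ml12 : all (matching G) [:: M1; M2] by rewrite /= m1 m2.
move=> /(texp_mnm_ofP ml ml12) [].
case: l ml => [|N1 [|N2 [|]]] //= /and3P[n1 n2 _] _ E.
have [e|[-> ->] //|[-> ->]] := uniq12 _ _ n1 n2.
  by have := E e; rewrite !big_cons big_nil !addn0.
by rewrite !mnm_of_cons !addmA [(U_(idx M2) + _)%MM]addmC.
Qed.

(** If all minimal generators had degree at most two, the monomial [mm] would be a multiple of a
    monomial [k2] of some generator, of degree at most two. But [k2] is alone in its fibre, so its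
    coefficient in the generator vanishes. *)
Lemma theta_not_quadratic : odd_theta (adj G) -> ~ omega (toric_ideal K a) 2.
Proof.
case=> u [v [s th]] om; have [M [M' [mM mM' sumE neM uniqM]]] := theta_triples th.
pose mm := mnm_of (codom M); pose mm' := mnm_of (codom M').
have all_codom (F : 'I_3 -> {set {set T}}) : (forall c, matching G (F c)) -> all (matching G) (codom F).
  by move=> mF; apply/allP => _ /codomP [c ->].
have Emm : texp a mm = texp a mm'.
  apply/texp_mnm_ofP; rewrite ?all_codom //; split=> [|e]; first by rewrite !size_codom.
  by rewrite !big_map -!enumT !big_enum; apply: sumE.
have ne : mm' != mm.
  apply/eqP => /mnmP /(_ (idx (M ord0))); rewrite /mm /mm' /mnm_of !mnm_sumE.
  rewrite big1_seq => [|_ /codomP [c ->]]; last first.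
    rewrite mnm1E; apply/eqP; rewrite eqb0; apply: contraNneq (neM ord0 c) => E.
    by rewrite -(idxK (mM ord0)) -E idxK.
  by rewrite (big_rem (M ord0)) ?codom_f //= mnm1E eqxx.
pose f : {mpoly K[N]} := ('X_[mm] - 'X_[mm'])%R.
have If : toric_ideal K a f by apply: toric_idealX.
have fmm : (f@_mm = 1)%R by rewrite /f mcoeffB !mcoeffX eqxx (negPf ne) subr0.
case: om => [[I0 _]|[_ [[g [[t [mt gt]] _]] deg2]]].
  by have := fmm; rewrite (I0 f).1 // mcoeff0 => /esym/eqP; rewrite oner_eq0.
have [th_ gen _] := mt.
have [c fE] := (gen f).1 If.
have := fmm; rewrite fE raddf_sum /= big1 => [/esym/eqP|i _]; first by rewrite oner_eq0.
set h := nth _ _ _; have ht : h \in t by apply: mem_nth.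
have Ih : toric_ideal K a h by apply/gen; exact: spanned_mem.
have dh : (msize h).-1 <= 2 by apply: deg2; exists t.
have hh : h \is (msize h).-1.-homog by rewrite -homog_msize th_.
rewrite mcoeffM big1 // => -[k1 k2] /= /eqP.
move: (bmnm k1) (bmnm k2) => {}k1 {}k2 mmE.
suff -> : (h@_k2 = 0)%R by rewrite mulr0.
have [k2E|] := eqVneq (mdeg k2) (msize h).-1; last exact: dhomog_nemf_coeff hh.
have k2le : mdeg k2 <= 2 by rewrite k2E.
have [k2lt|k2gt] := leqP (mdeg k2) 1.
  by apply: (toric_ideal_alone Ih) => k; apply: texp_inj1.
have k22 : mdeg k2 = 2 by apply/eqP; rewrite eqn_leq k2le.
(* The cofactor [k1] is a single variable, so [k2] is the product of the other two matchings of the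
   triple. *)
have /mdeg1P [l /eqP k1E] : mdeg k1 == 1.
  have := congr1 mdeg mmE; rewrite mdegD k22 mdeg_mnm_of size_codom card_ord.
  by clear; lia.
have [c0 lE] : exists c0, l = idx (M c0).
  have : mm l != 0 by rewrite mmE k1E mnmDE mnm1E eqxx.
  rewrite /mm /mnm_of big_map -?enumT big_enum mnm_sumE /= => ne0.
  suff /existsP [c0 /eqP <-] : [exists c0, idx (M c0) == l] by exists c0.
  apply: contraR ne0 => /existsPn no; rewrite big1 // => c0 _.
  by rewrite mnm1E (negPf (no c0)).
have [d0 cd0] : exists d0, c0 != d0.
  by exists (if c0 == ord0 then ord_max else ord0); case: (eqVneq c0 ord0) => [->|].
have [e0 cde] := ord3_third cd0; have [_ _ de0] := uniq3 cde.
have k2M : k2 = mnm_of [:: M d0; M e0].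
  apply: (@addmI _ U_(idx (M c0))%MM); rewrite -mnm_of_cons -{1}lE -k1E -mmE /mm /mnm_of big_map.
  by rewrite -?enumT big_enum /= (perm_big _ cde) unlock.
apply: (toric_ideal_alone Ih) => k; rewrite k2M.
by apply: mnm_of2_alone => // N1 N2 n1 n2; apply: uniqM.
Qed.

End Fibres.

Theorem theorem1p4 (R : realType) (K : fieldType) (T : finType) (G : graph T)
    (hG : bipartite G)
    (N : nat) (a : 'I_N -> 'X_{1..#|edges G|})
    (ha : lattice_points (matching_polytope R G) a) :
  let i := omega (toric_ideal K a) 2 in
  let ii := ~ has_odd_subdivision (complete_bipartite 2 3) G in
  let iii := forall B : graph T, block B G ->
    bipartite B /\ ~ has_odd_subdivision (complete_bipartite 2 3) B in
  [/\ i <-> ii, ii <-> iii & ~ i -> omega (toric_ideal K a) 3].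
Proof.
move=> i ii iii; have [A bipA] := hG; have [a_inj _] := ha.
(* The empty matching provides a default index for sets that are not matchings. *)
have [i0 _] : exists i, forall j, a i j = (enum_val j \in (set0 : {set {set T}})).
  apply: lattice_point_of_matching ha _ _; rewrite /matching sub0set.
  by apply/trivIsetP => e e'; rewrite inE.
have /choice [idx idxE] M : exists k, matching G M -> forall j, a k j = (enum_val j \in M).
  have [mM|nM] := boolP (matching G M); last by exists i0.
  by have [k kE] := lattice_point_of_matching ha mM; exists k.
have /choice [mat matP] k : exists M, matching G M /\ forall j, a k j = (enum_val j \in M).
  by have [M mM ME] := matching_of_lattice_point ha k; exists M.
have idxE' M j : matching G M -> a (idx M) j = (enum_val j \in M) by move=> mM; apply: idxE.
have matm k := (matP k).1; have matE k := (matP k).2.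
have gen := binomials_generate (K := K) a_inj idxE' matm matE.
have low g := @toric_ideal_degree K _ _ a a_inj g.
have gen3 := gen 3 (matchings_linked3 bipA).
have iiE : ii <-> ~ odd_theta (adj G).
  by split=> h th; apply: h; [exact: subdivision_of_theta|exact: theta_of_subdivision].
have i_ii : i <-> ii.
  split=> [om|/iiE noth].
    by apply/iiE => th; apply: (theta_not_quadratic (K := K) a_inj idxE' matm matE th).
  have gen2 := gen 2 (fun l l' => matchings_linked2 bipA noth).
  (* The zero ideal has [omega] equal to 2 by convention. *)
  have [I0|nI0] := pselect (forall f, toric_ideal K a f <-> f = 0%R); first by left.
  have [e [e2 e2' om]] := omega_of_generates (@binomials_degree _ _ _ _ _ _) gen2 nI0 low.
  by move: om; have -> : e = 2 by [apply/eqP; rewrite eqn_leq e2 e2'].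
split=> //.
  split=> [noG B [BG _ _]|h].
    split; first by exists A => x y /(subgraph_adj BG) /bipA.
    by case=> H [HB odd_H]; apply: noG; exists H; split=> //; apply: subgraph_trans BG.
  move/theta_of_subdivision => [u [v [s th]]].
  (* The theta forms a nonseparable subgraph, which lies in a block. *)
  have [B [bB tB]] := block_exists (theta_graph_sub th) (theta_graph_nonseparable th).
  have [_] := h B bB; apply; apply: subdivision_of_theta.
  exact: odd_theta_sub (subgraph_adj tB) (theta_graph_theta th).
move=> ni.
have [I0|nI0] := pselect (forall f, toric_ideal K a f <-> f = 0%R); first by case: ni; left.
have [e [e2 e3 om]] := omega_of_generates (@binomials_degree _ _ _ _ _ _) gen3 nI0 low.
move: e3; rewrite leq_eqVlt => /orP[/eqP <- //|e3].
by case: ni; move: om; have -> : e = 2 by [apply/eqP; rewrite eqn_leq e2 -ltnS e3].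
Qed.
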